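(* Let $n\ge 3$, let $h_1,\dots,h_{n-1}>0$, and let $f_{\boldsymbol h}$ be the $\mathbb{Z}_2$-harmonic function branching along the ellipsoid $E_{\boldsymbol h}$ described in the context. Then there exists a family of $\mathbb{Z}_2$-functions $F_t$ on $\mathbb{R}^n$, parametrized by all sufficiently large $t>0$, each branching along $E_{\boldsymbol h}$ and each defining a Lawlor's neck (that is, for each $t$ there is $\boldsymbol c\in(0,\infty)^n$ such that the two-valued graph of $dF_t$ in $T^*\mathbb{R}^n=\mathbb{C}^n$ is the Lawlor's neck $L_{\boldsymbol c}$), such that $tF_t$ converges to $f_{\boldsymbol h}$ in $C^\infty_{loc}(\mathbb{R}^n\setminus E_{\boldsymbol h})$ as $t\to\infty$.
   Context: $\mathbb{Z}_2$-functions. Let $E_{\boldsymbol h}=\{x\in\mathbb{R}^n:\sum_{i=1}^{n-1}x_i^2/h_i^2=1,\ x_n=0\}$, and let $L$ be the flat real line bundle (structure group $\{\pm1\}$) over $\mathbb{R}^n\setminus E_{\boldsymbol h}$ with monodromy $-1$ around small loops linking $E_{\boldsymbol h}$. A $\mathbb{Z}_2$-function branching along $E_{\boldsymbol h}$ is a section of $L$ over $\mathbb{R}^n\setminus E_{\boldsymbol h}$, equivalently a function on the double cover of $\mathbb{R}^n$ branched along $E_{\boldsymbol h}$ that is odd under the covering involution; it is considered up to a global sign. Locally such an $F$ is given by two ordinary functions $\pm F$, and its differential has a two-valued graph. It is $\mathbb{Z}_2$-harmonic if $F,\nabla F\in L^2_{loc}$ and $\Delta F=0$ on $\mathbb{R}^n\setminus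 E_{\boldsymbol h}$. Outside a large ball $L$ is trivial, so $F$ has a single-valued branch there. Convergence in $C^\infty_{loc}(\mathbb{R}^n\setminus E_{\boldsymbol h})$ means that, for a suitable choice of global signs, the sections of $L$ converge with all derivatives uniformly on compact subsets of $\mathbb{R}^n\setminus E_{\boldsymbol h}$. Non-degenerate. Let $N$ be the normal bundle of $E_{\boldsymbol h}$ viewed as a complex line bundle, and $\zeta$ the inverse of the normal exponential map near $E_{\boldsymbol h}$. A $\mathbb{Z}_2$-harmonic function $f$ is non-degenerate if near $E_{\boldsymbol h}$ it has the form $f=\mathrm{Re}(B\zeta^{3/2})+O(|\zeta|^{5/2})$ with $B$ a nowhere vanishing section of $N^{-3/2}$ (where $N^{1/2}$ is the square root defined by the monodromy of $L$). The function $f_{\boldsymbol h}$. Let $S(y)=\prod_{i=1}^{n-1}(y+h_i^2)$, $a_i=\frac{\prod_j h_j}{2}\int_0^\infty\frac{du}{(u^2+h_i^2)\sqrt{S(u^2)}}$ for $1\le i\le n-1$, $a_n=-\sum_{i=1}^{n-1}a_i$, $a_0=\frac{\prod_j h_j}{2}\int_0^\infty\frac{du}{\sqrt{S(u^2)}}$. Then $f_{\boldsymbol h}$ is the non-degenerate $\mathbb{Z}_2$-harmonic function with branching set $E_{\boldsymbol h}$ that has, on a single-valued branch outside a large ball, the expansion $f_{\boldsymbol h}=a_0-\sum_{i=1}^n a_ix_i^2+O(|x|^{2-n})$; it exists and is determined up to sign by these properties. Lawlor's necks. Identify $T^*\mathbb{R}^n$ with $\mathbb{C}^n$ by $z_i=x_i+\sqrt{-1}\,y_i$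 ($x$ the base point, $y$ the covector). For $\boldsymbol c=(c_1,\dots,c_n)$ with $c_i>0$ put $$P(y^2)=\Big(\prod_{k=1}^n(1+c_k^2y^2)-1\Big)/y^2,\qquad \psi_i(s)=\int_0^s\frac{c_i^2\,dy}{(1+c_i^2y^2)\sqrt{P(y^2)}},$$ $z_k(s)=e^{\sqrt{-1}\psi_k(s)}\sqrt{c_k^{-2}+s^2}$ for $1\le k\le n-1$, and $z_n(s)=e^{\sqrt{-1}(\pi/2+\psi_n(s))}\sqrt{c_n^{-2}+s^2}$. The Lawlor's neck is $$L_{\boldsymbol c}=\{(z_1(s)w_1,\dots,z_n(s)w_n):\ (w_1,\dots,w_n)\in S^{n-1}\subset\mathbb{R}^n,\ s\in\mathbb{R}\}.$$ ''The two-valued graph of $dF$ is $L_{\boldsymbol c}$'' means that the closure in $\mathbb{C}^n$ of the set of points $x+\sqrt{-1}\,y$ with $x\in\mathbb{R}^n\setminus E_{\boldsymbol h}$ and $y=\pm\nabla F(x)$ equals $L_{\boldsymbol c}$. *)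

(* Defs.v *)
From HB Require Import structures.
From mathcomp Require Import all_boot all_order all_algebra.
From mathcomp Require Import all_classical all_reals all_analysis.
From mathcomp Require Import complex.

Set Implicit Arguments.
Unset Strict Implicit.
Unset Printing Implicit Defensive.

Import Order.TTheory GRing.Theory Num.Theory.
Import numFieldNormedType.Exports.

Local Open Scope classical_set_scope.
Local Open Scope ring_scope.
Local Open Scope complex_scope.

(* Throughout n = m.+1, the first m coordinates of R^n are those of index
   [lift ord_max j] with j : 'I_m, and the last one has index [ord_max]. *)

Section Euclidean.
Context {R : realType} {n : nat}.
Local Notation Rn := 'rV[R]_n.

(* Euclidean norm; the library norm on 'rV_n is the sup norm. *)
Definition enorm (x : Rn) : R := Num.sqrt (\sum_i x 0 i ^+ 2).

Definition ebase (i : 'I_n) : Rn := delta_mx 0 i.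

Definition grad (f : Rn -> R) (x : Rn) : Rn := \row_i 'D_(ebase i) f x.

Definition laplacian (f : Rn -> R) (x : Rn) : R :=
  \sum_i 'D_(ebase i) ('D_(ebase i) f) x.

Fixpoint iter_partial (s : seq 'I_n) (f : Rn -> R) : Rn -> R :=
  if s is i :: s' then 'D_(ebase i) (iter_partial s' f) else f.

(* f is C^oo on the open set U: every iterated partial derivative is
   differentiable, hence continuous, at every point of U. *)
Definition smooth_on (U : set Rn) (f : Rn -> R) : Prop :=
  forall (s : seq 'I_n) (x : Rn), U x -> differentiable (iter_partial s f) x.

End Euclidean.

Section LebesgueRn.
Context {R : realType}.
Local Notation RR := (measurableTypeR R).

Definition tcons n (p : n.-tuple RR * RR) : n.+1.-tuple RR :=
  [tuple of p.2 :: p.1].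

Lemma measurable_tcons n : measurable_fun [set: n.-tuple RR * RR] (@tcons n).
Proof. exact: measurable_cons. Qed.

Definition tcons_measure n (mu : {measure set (n.-tuple RR) -> \bar R}) :
    set (n.+1.-tuple RR) -> \bar R :=
  pushforward (mu \x @lebesgue_measure R)%E (@tcons n).

Section tcons_measure_isMeasure.
Variables (n : nat) (mu : {measure set (n.-tuple RR) -> \bar R}).

Let tcons_measure0 : tcons_measure mu set0 = 0%E.
Proof. by rewrite /tcons_measure /pushforward preimage_set0 measure0. Qed.

Let tcons_measure_ge0 A : (0 <= tcons_measure mu A)%E.
Proof. by rewrite /tcons_measure /pushforward measure_ge0. Qed.

Let tcons_measure_sigma_additive : semi_sigma_additive (tcons_measure mu).
Proof.
move=> F mF tF mUF; rewrite /tcons_measure /pushforward preimage_bigcup.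
apply: measure_semi_sigma_additive.
- by move=> k; rewrite -[X in measurable X]setTI; exact: measurable_tcons.
- apply/trivIsetP => /= i j _ _ ij; rewrite -preimage_setI.
  by move/trivIsetP : tF => /(_ _ _ _ _ ij) ->//; rewrite preimage_set0.
- rewrite -preimage_bigcup -[X in measurable X]setTI.
  exact: measurable_tcons.
Qed.

HB.instance Definition _ := isMeasure.Build _ _ _ (tcons_measure mu)
  tcons_measure0 tcons_measure_ge0 tcons_measure_sigma_additive.

End tcons_measure_isMeasure.

(* n-dimensional Lebesgue measure, as an iterated product measure. *)
Fixpoint lebesgue_Rn n : {measure set (n.-tuple RR) -> \bar R} :=
  if n is k.+1 then tcons_measure (lebesgue_Rn k)
  else dirac ([tuple] : 0.-tuple RR).

Definition vec n (t : n.-tuple RR) : 'rV[R]_n := \row_i tnth t i.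

End LebesgueRn.

Section Z2functions.
Context {R : realType} {m : nat}.
Variable h : 'I_m -> R.
Local Notation Rn := 'rV[R]_m.+1.

Definition equatorial (x : Rn) : R :=
  \sum_(j < m) x 0 (lift ord_max j) ^+ 2 / h j ^+ 2.

Definition ellipsoid : set Rn :=
  [set x | equatorial x = 1 /\ x 0 ord_max = 0].

Definition disc : set Rn :=
  [set x | equatorial x <= 1 /\ x 0 ord_max = 0].

Definition outer_chart : set Rn := ~` disc.

Definition inner_chart : set Rn :=
  ~` [set x | 1 <= equatorial x /\ x 0 ord_max = 0].

(* The line bundle L is given by a {1,-1}-valued cocycle: the open sets
   outer_chart and inner_chart cover the complement of the ellipsoid, they
   overlap in {x_n <> 0}, and the transition function is 1 on {x_n > 0} and -1
   on {x_n < 0}.  A small loop linking the ellipsoid meets each chart in an arc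
   and crosses each half space once, so that the monodromy is -1.  A section of
   L is a pair of functions that match on the overlap; the values of each
   function outside its chart are irrelevant. *)
Record Z2fun := MkZ2fun {
  outer : Rn -> R;
  inner : Rn -> R;
  glue : forall x : Rn, outer_chart x -> inner_chart x ->
    inner x = Num.sg (x 0 ord_max) * outer x }.

Lemma Z2scale_glue (a : R) (F : Z2fun) (x : Rn) :
  outer_chart x -> inner_chart x ->
  a * inner F x = Num.sg (x 0 ord_max) * (a * outer F x).
Proof. by move=> ox ix; rewrite (glue F ox ix) mulrCA. Qed.

Definition Z2scale (a : R) (F : Z2fun) : Z2fun :=
  MkZ2fun (Z2scale_glue a F).

(* For x off the ellipsoid, the branch of F near x read in a chart containing
   x; the choice of chart depends on x only, and another one changes the sign. *)
Definition branch (F : Z2fun) (x : Rn) : Rn -> R :=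
  if x \in disc then inner F else outer F.

Definition Z2smooth (F : Z2fun) : Prop :=
  smooth_on outer_chart (outer F) /\ smooth_on inner_chart (inner F).

Definition L2loc (u : Rn -> R) : Prop :=
  forall K : set Rn, compact K ->
    (lebesgue_Rn m.+1).-integrable (@vec R m.+1 @^-1` (K `\` ellipsoid))
      (fun t => (u (vec t) ^+ 2)%:E).

Definition Z2harmonic (F : Z2fun) : Prop :=
  [/\ Z2smooth F,
      L2loc (fun x => branch F x x),
      forall i : 'I_m.+1, L2loc (fun x => grad (branch F x) x 0 i)
    & forall x, ~ ellipsoid x -> laplacian (branch F x) x = 0].

Definition expi (t : R) : R[i] := cos t +i* sin t.

Definition outer_normal (p : Rn) : Rn :=
  let g : Rn :=
    \row_k (if unlift ord_max k is Some j then p 0 k / h j ^+ 2 else 0) in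
  (enorm g)^-1 *: g.

(* The normal space at p is identified with the complex plane by means of the
   frame (outer unit normal inside {x_n = 0}, e_n). *)
Definition normal_exp (p : Rn) (zeta : R[i]) : Rn :=
  p + complex.Re zeta *: outer_normal p + complex.Im zeta *: ebase ord_max.

(* Points at angle theta = pi are those of the disc.  For theta in ]-pi, pi],
   zeta = r e^(i theta), the root r^(1/2) e^(i theta/2) is continuous on the
   outer chart, and at theta = pi it is the limit from {x_n > 0}, in agreement
   with the branch of F selected by [branch]: this is the root of N defined by
   the monodromy of L.  In this frame a section of N^(-3/2) is a complex
   function B on the ellipsoid; smoothness of B is that of an extension. *)
Definition Z2nondegenerate (F : Z2fun) : Prop :=
  exists B : Rn -> R[i],
  [/\ exists2 V : set Rn, open V /\ ellipsoid `<=` V &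
        smooth_on V (fun x => complex.Re (B x)) /\
        smooth_on V (fun x => complex.Im (B x)),
      forall p, ellipsoid p -> B p <> 0
    & exists C r0 : R, 0 < r0 /\
      forall p r theta, ellipsoid p -> 0 < r < r0 -> - pi < theta <= pi ->
        let x := normal_exp p (r%:C * expi theta) in
        `| branch F x x
           - complex.Re (B p * (r `^ (3 / 2))%:C * expi (3 / 2 * theta)) |
          <= C * r `^ (5 / 2)].

Definition Spoly (y : R) : R := \prod_(j < m) (y + h j ^+ 2).

Definition coef_a (j : 'I_m) : R :=
  (\prod_(k < m) h k) / 2 *
  (\int[lebesgue_measure]_(u in `[0, +oo[)
     ((u ^+ 2 + h j ^+ 2) * Num.sqrt (Spoly (u ^+ 2)))^-1)%R.

Definition coef_an : R := - \sum_(j < m) coef_a j.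

Definition coef_a0 : R :=
  (\prod_(k < m) h k) / 2 *
  (\int[lebesgue_measure]_(u in `[0, +oo[)
     (Num.sqrt (Spoly (u ^+ 2)))^-1)%R.

Definition asymptotic_poly (x : Rn) : R :=
  coef_a0 - (\sum_(j < m) coef_a j * x 0 (lift ord_max j) ^+ 2
             + coef_an * x 0 ord_max ^+ 2).

(* The outer chart contains the complement of a large ball, where the
   single-valued branches are therefore [outer F] and its opposite.  The
   exponent 2 - n is - m.-1. *)
Definition has_expansion (F : Z2fun) : Prop :=
  exists2 eps : R, eps = 1 \/ eps = -1 &
  exists C rho : R, 0 < rho /\ forall x : Rn, rho <= enorm x ->
    `| eps * outer F x - asymptotic_poly x | <= C * enorm x ^- m.-1.

Definition is_f_h (F : Z2fun) : Prop :=
  [/\ Z2harmonic F, Z2nondegenerate F & has_expansion F].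

Definition cvg_Cinf_loc (G : R -> Z2fun) (F : Z2fun) : Prop :=
  exists2 eps : R -> R, (forall t, eps t = 1 \/ eps t = -1) &
  forall (K : set Rn), compact K -> K `<=` ~` ellipsoid ->
  forall (s : seq 'I_m.+1) (e : R), 0 < e ->
  \forall t \near +oo, forall x, K x ->
    `| iter_partial s (branch (Z2scale (eps t) (G t)) x) x
       - iter_partial s (branch F x) x | < e.

Definition two_valued_graph (F : Z2fun) : set (Rn * Rn) :=
  [set p | ~ ellipsoid p.1 /\
     (p.2 = grad (branch F p.1) p.1 \/ p.2 = - grad (branch F p.1) p.1)].

End Z2functions.

Section Lawlor.
Context {R : realType} {m : nat}.
Variable c : 'I_m.+1 -> R.

(* Here P (y^2) is only used under an integral sign, so that its value at the
   point y = 0, where the division is by 0, is irrelevant. *)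
Definition lawlor_P (y2 : R) : R :=
  (\prod_(k < m.+1) (1 + c k ^+ 2 * y2) - 1) / y2.

Definition lawlor_psi (k : 'I_m.+1) (s : R) : R :=
  let g (y : R) :=
    c k ^+ 2 / ((1 + c k ^+ 2 * y ^+ 2) * Num.sqrt (lawlor_P (y ^+ 2))) in
  if 0 <= s then (\int[lebesgue_measure]_(y in `[0%R, s]) g y)%R
  else - (\int[lebesgue_measure]_(y in `[s, 0%R]) g y)%R.

Definition lawlor_z (k : 'I_m.+1) (s : R) : R[i] :=
  expi ((if k == ord_max then pi / 2 else 0) + lawlor_psi k s)
  * (Num.sqrt (c k ^- 2 + s ^+ 2))%:C.

Definition lawlor_neck : set 'rV[R[i]]_m.+1 :=
  [set z | exists (w : 'rV[R]_m.+1) (s : R), \sum_k w 0 k ^+ 2 = 1 /\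
     z = \row_k (lawlor_z k s * (w 0 k)%:C)].

Definition cotangent_to_C (p : 'rV[R]_m.+1 * 'rV[R]_m.+1) : 'rV[R[i]]_m.+1 :=
  \row_k (p.1 0 k +i* p.2 0 k).

End Lawlor.

(* The closure is taken in R^n x R^n, homeomorphic to C^n by cotangent_to_C. *)
Definition defines_lawlor_neck (R : realType) (m : nat) (h : 'I_m -> R)
    (F : Z2fun h) (c : 'I_m.+1 -> R) : Prop :=
  closure (two_valued_graph F) = @cotangent_to_C R m @^-1` lawlor_neck c.

(* Main.v *)
Require Import Defs.
From HB Require Import structures.
From mathcomp Require Import all_boot all_order all_algebra.
From mathcomp Require Import all_classical all_reals all_analysis.
From mathcomp Require Import complex ring lra.

Set Implicit Arguments.
Unset Strict Implicit.
Unset Printing Implicit Defensive.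

Import Order.TTheory GRing.Theory Num.Theory.
Import numFieldNormedType.Exports.

Local Open Scope classical_set_scope.
Local Open Scope ring_scope.

(* Put e = 1/t and c = (1/h_1, ..., 1/h_(n-1), 1/e).  The points of the neck
   L_c over x are those of parameter s with
     sum_j a_j(s) x_j^2 + x_n^2 / v(s)^2 = 1,
   where -v(s) is the real part of z_n(s) and a_j(s)^(-1/2) that of z_j(s).  For
   small e this equation has exactly one solution s > 0 off the disc bounded by
   the ellipsoid E, and with w = x_n / v(s) > 0 it has exactly one solution s of
   any sign over the disc.  The neck is then the two-valued graph of e dPhi, with
   Phi explicit in s and w.
   After division by e all formulas extend to e = 0.  The partial derivatives of
   s and w are rational in finitely many functions whose derivatives are again
   of this kind, so that every partial derivative of Phi is continuous in (e, x).
   At e = 0 the hypersurfaces {s = const} are confocal ellipsoids, and Phi_0 is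
   harmonic, vanishes along E, and differs by o(1) from minus the polynomial in
   the expansion of f_h at infinity.  With the sign given by that expansion,
   |f_h + Phi_0| is continuous, tends to 0 at infinity and vanishes on E, so that
   it is 0 by the maximum principle. *)

(** * Derivatives in a direction and primitives *)

(** The obstacle is the last angle psi_n: as e tends to 0 its integrand concentrates at 0. An
    identity between the angles removes it. With Q = prod_k (1 + c_k^2 s^2) = 1 + s^2 P, the sum of
    all psi_k has derivative Q' / (2 s Q sqrt P), which is that of arctan (s sqrt P). So psi_n is
    this arctangent minus the other psi_j, which are O(e), and z_n has a closed form that is regular
    in e.

    The potential comes from 2 y dx = d(x.y) + (y dx - x dy). On the neck, with sphere coordinates
    omega_k and r_k^2 = c_k^-2 + s^2, one has y dx - x dy = - sum_k r_k^2 omega_k^2 dpsi_k = - ds /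
    sqrt P. Hence e Phi is x.y / 2 minus half a primitive of 1 / sqrt P.

    The unknowns are s and w together, since x_n / v(s) is undetermined at s = 0, over the disc. The
    system v(s) w = x_n, sum_j a_j x_j^2 + w^2 = 1 is regular off E, and (s, w) -> (-s, -w) is the
    covering involution. Monotonicity in s yields existence, uniqueness and continuity of its
    solutions, also at e = 0. *)

Section DerivRules.
Context {R : realType} {V : normedModType R}.
Implicit Types (f g : V -> R) (x v : V).

Lemma isdD f g x v a b : is_derive x v f a -> is_derive x v g b ->
  is_derive x v (fun y => f y + g y) (a + b).
Proof. by move=> fa gb; exact: is_deriveD. Qed.

Lemma isdB f g x v a b : is_derive x v f a -> is_derive x v g b ->
  is_derive x v (fun y => f y - g y) (a - b).
Proof. by move=> fa gb; exact: is_deriveB. Qed.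

Lemma isdN f x v a : is_derive x v f a -> is_derive x v (fun y => - f y) (- a).
Proof. by move=> fa; exact: is_deriveN. Qed.

Lemma isdC (c : R) x v : is_derive x v (fun=> c) 0.
Proof. exact: is_derive_cst. Qed.

Lemma isdM f g x v a b : is_derive x v f a -> is_derive x v g b ->
  is_derive x v (fun y => f y * g y) (a * g x + f x * b).
Proof.
move=> fa gb; apply: (is_derive_eq (is_deriveM fa gb)).
by rewrite [X in _ = X]addrC /GRing.scale /= [X in _ + X]mulrC.
Qed.

Lemma isdZ (c : R) f x v a : is_derive x v f a ->
  is_derive x v (fun y => c * f y) (c * a).
Proof.
by move=> fa; apply: (is_derive_eq (isdM (isdC c x v) fa)); rewrite mul0r add0r.
Qed.

Lemma isdX f x v a n : is_derive x v f a ->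
  is_derive x v (fun y => f y ^+ n) (n%:R * f x ^+ n.-1 * a).
Proof.
move=> fa; rewrite (_ : (fun y => _) = f ^+ n); last by rewrite exprfctE.
exact: is_deriveX.
Qed.

Lemma isdS n (f : 'I_n -> V -> R) x v (a : 'I_n -> R) :
  (forall i, is_derive x v (f i) (a i)) ->
  is_derive x v (fun y => \sum_i f i y) (\sum_i a i).
Proof.
move=> fa; rewrite (_ : (fun y => _) = \sum_i f i); first exact: is_derive_sum.
by apply/funext => y; rewrite fct_sumE.
Qed.

Lemma isdV f x v a : is_derive x v f a -> f x != 0 ->
  is_derive x v (fun y => (f y)^-1) (- a / f x ^+ 2).
Proof.
case=> df Df fx0; apply: (DeriveDef (derivableV fx0 df)).
by rewrite (deriveV fx0 df) Df /GRing.scale /= !mulNr mulrC.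
Qed.

End DerivRules.

Lemma isd_comp {R : realType} {V : normedModType R} (g : R -> R) (f : V -> R)
    x v (a b : R) :
  differentiable f x -> is_derive x v f a -> is_derive (f x) 1 g b ->
  is_derive x v (fun y => g (f y)) (a * b).
Proof.
move=> df fa gb.
have dg : differentiable g (f x) by apply/derivable1_diffP; apply: ex_derive.
have dgf : differentiable (g \o f) x by exact: differentiable_comp.
split; first exact: diff_derivable.
have Ef : 'd f x v = a by case: fa => _ <-; rewrite deriveE.
have Eg : 'd g (f x) 1 = b by case: gb => _ <-; rewrite deriveE.
rewrite deriveE// diff_comp//= Ef -[X in 'd g (f x) X]mulr1.
by rewrite -/(a *: (1 : R)) linearZ /= Eg.
Qed.

Lemma isd_comp1 {R : realType} (g f : R -> R) (x a b : R) :
  is_derive x 1 f a -> is_derive (f x) 1 g b ->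
  is_derive x 1 (fun y => g (f y)) (a * b).
Proof.
move=> fa gb; apply: isd_comp => //.
by apply/derivable1_diffP; apply: ex_derive.
Qed.

Lemma isd_eq {R : realType} {V : normedModType R} (f : V -> R) x v (a b : R) :
  is_derive x v f a -> a = b -> is_derive x v f b.
Proof. by move=> fa <-. Qed.

Lemma isd_cont {R : realType} (f : R -> R) (x a : R) :
  is_derive x 1 f a -> {for x, continuous f}.
Proof.
move=> fa; apply: differentiable_continuous.
by apply/derivable1_diffP; apply: ex_derive.
Qed.

Section Monotone.
Context {R : realType}.
Implicit Types f g df dg : R -> R.

Lemma isd_within f df (a b : R) :
  (forall x, a <= x <= b -> is_derive x 1 f (df x)) ->
  {within `[a, b], continuous f}.
Proof.
move=> fd; apply: continuous_in_subspaceT => x /set_mem /= xab.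
by apply: (@isd_cont _ f _ (df x)); apply: fd; rewrite in_itv in xab.
Qed.

Lemma isd_mvt f df (a b : R) : a <= b ->
  (forall x, a <= x <= b -> is_derive x 1 f (df x)) ->
  exists2 c, a <= c <= b & f b - f a = df c * (b - a).
Proof.
move=> ab fd.
have [||c cab ->] := @MVT_segment R f df a b ab.
- by move=> x xab; apply: fd; rewrite !ltW ?(itvP xab).
- exact: isd_within fd.
- by exists c => //; rewrite in_itv in cab.
Qed.

Lemma isd_le f df (a b : R) : a <= b ->
  (forall x, a <= x <= b -> is_derive x 1 f (df x)) ->
  (forall x, a <= x <= b -> 0 <= df x) -> f a <= f b.
Proof.
move=> ab fd d0; have [c cab e] := isd_mvt ab fd.
by rewrite -subr_ge0 e mulr_ge0 ?subr_ge0 ?d0.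
Qed.

Lemma isd_lt f df (a b : R) : a < b ->
  (forall x, a <= x <= b -> is_derive x 1 f (df x)) ->
  (forall x, a < x < b -> 0 < df x) -> f a < f b.
Proof.
move=> ab fd d0; have [||c cab e] := @MVT R f df a b ab.
- by move=> x xab; apply: fd; rewrite !ltW ?(itvP xab).
- exact: isd_within fd.
- by rewrite -subr_gt0 e mulr_gt0 ?subr_gt0// d0 ?(itvP cab).
Qed.

Lemma isd_cst f (a : R) : (forall x : R, is_derive x 1 f 0) -> f a = f 0.
Proof.
move=> fd; case: (leP 0 a) => [|/ltW] a0;
  have [c _ /eqP] := @isd_mvt f (fun=> 0) _ _ a0 (fun x _ => fd x);
  by rewrite mul0r subr_eq0 => /eqP.
Qed.

Lemma isd_bound f df (K : R) (a b : R) :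
  (forall x : R, is_derive x 1 f (df x)) ->
  (forall x, `|df x| <= K) -> `|f b - f a| <= K * `|b - a|.
Proof.
move=> fd dK; wlog ab : a b / a <= b => [hw|].
  case: (leP a b) => [/hw//|/ltW /hw].
  by rewrite distrC [`|b - a|]distrC.
have [c _ ->] := @isd_mvt f df a b ab (fun x _ => fd x).
by rewrite normrM ler_wpM2r.
Qed.

End Monotone.

Section Primitive.
Context {R : realType}.
Implicit Types g : R -> R.
Local Notation mu := (@lebesgue_measure R).

(** Same shape as the integral in [lawlor_psi], with the sign change for s < 0, so that [eq_prim]
    applies to the latter by conversion. *)
Definition prim g (s : R) : R :=
  if 0 <= s then (\int[mu]_(y in `[0%R, s]) g y)%R
  else - (\int[mu]_(y in `[s, 0%R]) g y)%R.

Lemma prim0 g : prim g 0 = 0.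
Proof. by rewrite /prim lexx set_itv1 Rintegral_set1. Qed.

Lemma continuous_integrable_itv g (a b : R) : continuous g ->
  mu.-integrable `[a, b] (EFin \o g).
Proof.
move=> cg; apply: continuous_compact_integrable; first exact: segment_compact.
by apply: continuous_in_subspaceT => x _; exact: cg.
Qed.

(** A base point to the left of both 0 and s removes the case distinction, so that the fundamental
    theorem of calculus also applies at s = 0. *)
Lemma primE g (N s : R) : continuous g -> - N <= s -> 0 <= N ->
  prim g s = (\int[mu]_(y in `[- N, s]) g y)%R
             - (\int[mu]_(y in `[- N, 0%R]) g y)%R.
Proof.
move=> cg Ns N0; have N0' : - N <= 0 by rewrite oppr_le0.
rewrite /prim; case: ifPn => [s0|]; last rewrite -ltNge => /ltW s0.
  rewrite Rintegral_itvB ?bnd_simp//; last exact: continuous_integrable_itv.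
  rewrite Rintegral_itv_obnd_cbnd//.
  apply: integrableS (continuous_integrable_itv 0 s cg) => //.
  exact: subset_itv_oc_cc.
rewrite -[RHS]opprB Rintegral_itvB ?bnd_simp//; last exact: continuous_integrable_itv.
rewrite Rintegral_itv_obnd_cbnd//.
apply: integrableS (continuous_integrable_itv s 0 cg) => //.
exact: subset_itv_oc_cc.
Qed.

Lemma is_derive_prim g (s : R) : continuous g -> is_derive s 1 (prim g) (g s).
Proof.
move=> cg; pose N := `|s| + 1.
have N0 : 0 < N by rewrite ltr_pwDr.
have Ns : - N < s by rewrite ltrNl (le_lt_trans (ler_norm _))// normrN /N ltrDl.
have s1 : s < s + 1 by rewrite ltrDl.
have [dF F'] := continuous_FTC1_closed s1
  (continuous_integrable_itv (- N) (s + 1) cg) Ns (cg s).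
have D1 : is_derive s 1
    (fun x => (\int[mu]_(t in `[- N, x]) g t)%R - (\int[mu]_(y in `[- N, 0%R]) g y)%R)
    (g s).
  have D0 : is_derive s 1 (fun x => (\int[mu]_(t in `[- N, x]) g t)%R) (g s).
    by apply: DeriveDef; [exact: dF|rewrite -F' derive1E].
  by apply: (isd_eq (isdB D0 (isdC _ _ _))); rewrite subr0.
apply: near_eq_is_derive D1.
near=> x; rewrite -primE//; last exact: ltW.
by apply/ltW; near: x; exact: lt_nbhsr.
Unshelve. all: by end_near. Qed.

End Primitive.

(** * The profile functions of a neck *)

Section GeneralizedTrig.
Context {R : realType}.
Implicit Types e z : R.

Definition cs e z : R := cos (e * z).

(** The rescaled sine keeps a limit at e = 0. The later identities rest on sn' = cs, cs' = - e^2 sn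
    and cs^2 + e^2 sn^2 = 1, which hold for every e. *)
Definition sn e z : R := if e == 0 then z else sin (e * z) / e.

Lemma sn_e e z : e * sn e z = sin (e * z).
Proof.
rewrite /sn; case: eqP => [->|/eqP e0]; first by rewrite !mul0r sin0.
by rewrite mulrC divfK.
Qed.

Lemma cs0 z : cs 0 z = 1. Proof. by rewrite /cs mul0r cos0. Qed.

Lemma sn0 z : sn 0 z = z. Proof. by rewrite /sn eqxx. Qed.

Lemma csz0 e : cs e 0 = 1. Proof. by rewrite /cs mulr0 cos0. Qed.

Lemma snz0 e : sn e 0 = 0.
Proof. by rewrite /sn mulr0 sin0 mul0r; case: ifP. Qed.

Lemma csN e z : cs e (- z) = cs e z. Proof. by rewrite /cs mulrN cosN. Qed.

Lemma snN e z : sn e (- z) = - sn e z.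
Proof. by rewrite /sn mulrN sinN mulNr; case: ifP. Qed.

Lemma cs2sn2 e z : cs e z ^+ 2 + e ^+ 2 * sn e z ^+ 2 = 1.
Proof. by rewrite -exprMn sn_e cos2Dsin2. Qed.

Lemma is_derive_emul e z : is_derive z 1 (fun x => e * x) e.
Proof. by apply: (isd_eq (isdZ e (is_derive_id z 1))); rewrite mulr1. Qed.

Lemma is_derive_cs e z : is_derive z 1 (cs e) (- e ^+ 2 * sn e z).
Proof.
apply: (isd_eq (isd_comp1 (is_derive_emul e z) (is_derive_cos _))).
by rewrite -sn_e; ring.
Qed.

Lemma is_derive_sn e z : is_derive z 1 (sn e) (cs e z).
Proof.
have [->|e0] := eqVneq e 0.
  rewrite cs0 (_ : sn 0 = id); last by apply/funext => x; rewrite sn0.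
  exact: is_derive_id.
rewrite (_ : sn e = fun x => e^-1 * sin (e * x)); last first.
  by apply/funext => x; rewrite /sn (negbTE e0) mulrC.
apply: (isd_eq (isdZ _ (isd_comp1 (is_derive_emul e z) (is_derive_sin _)))).
by rewrite mulKf.
Qed.

Lemma norm_cs_le1 e z : `|cs e z| <= 1. Proof. exact: cos_max. Qed.

Lemma norm_sn_le e z : `|sn e z| <= `|z|.
Proof.
have := @isd_bound R (sn e) (cs e) 1 0 z (is_derive_sn e) (norm_cs_le1 e).
by rewrite snz0 !subr0 mul1r.
Qed.

Lemma dist_cs_le e z : `|cs e z - 1| <= `|e * z|.
Proof.
have H := @isd_bound R cos (fun x => - sin x) 1 0 (e * z).
have := H (fun x => is_derive_cos x) (fun x => _).
rewrite cos0 subr0 mul1r; apply => x.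
by rewrite normrN sin_max.
Qed.

(** The mean value theorem for sn - id, whose derivative cs - 1 is at most |e z|. This controls [sn]
    across e = 0, where its definition changes form. *)
Lemma dist_sn_le e z : `|sn e z - z| <= `|e| * `|z| * `|z|.
Proof.
wlog z0 : z / 0 <= z.
  move=> hw; case: (leP 0 z) => [/hw//|/ltW zn].
  have := hw (- z); rewrite oppr_ge0 => /(_ zn).
  by rewrite snN -opprD normrN !normrN.
have H1 : forall x : R, 0 <= x <= z ->
    is_derive x 1 (fun x => sn e x - x) (cs e x - 1).
  by move=> x _; exact: isdB (is_derive_sn e x) (is_derive_id x 1).
have [c /andP[c0 cz]] := isd_mvt z0 H1.
rewrite snz0 !subr0 => ->; rewrite normrM ler_wpM2r//.
rewrite (le_trans (dist_cs_le _ _))// normrM ler_wpM2l//.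
by rewrite ger0_norm// ger0_norm.
Qed.

Lemma cs_ge e z : `|e * z| <= 1 -> cos 1 <= cs e z.
Proof.
move=> ez; rewrite /cs -[cos (e * z)]cos_norm.
have [/eqP ->//|ne] := boolP (`|e * z| == 1).
have p2 := @pihalf_ge1 R; have p0 := @pi_gt0 R.
have p1 : 1 <= pi :> R by lra.
apply/ltW; rewrite ltr_cos ?lt_neqAle ?ne//= in_itv /=.
- by rewrite normr_ge0/= (le_trans ez).
- by rewrite ler01.
Qed.

End GeneralizedTrig.

Section PrimitiveParity.
Context {R : realType}.
Implicit Types g : R -> R.

Lemma primN g (s : R) : continuous g -> (forall x, g (- x) = g x) ->
  prim g (- s) = - prim g s.
Proof.
move=> cg ge; apply/eqP; rewrite -addr_eq0.
have H (x : R) : is_derive x 1 (fun x => prim g (- x) + prim g x) 0.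
  apply: (isd_eq (isdD (isd_comp1 (isdN (is_derive_id x 1))
    (is_derive_prim _ cg)) (is_derive_prim _ cg))).
  by rewrite ge mulN1r addNr.
by rewrite (isd_cst s H) oppr0 prim0 addr0.
Qed.

Lemma dist_prim_le g1 g2 (K s : R) : continuous g1 -> continuous g2 ->
  (forall x, `|g1 x - g2 x| <= K) -> `|prim g1 s - prim g2 s| <= K * `|s|.
Proof.
move=> c1 c2 gK.
have H (x : R) : is_derive x 1 (fun y => prim g1 y - prim g2 y) (g1 x - g2 x).
  exact: isdB (is_derive_prim _ c1) (is_derive_prim _ c2).
by have := @isd_bound R _ _ K 0 s H gK; rewrite !prim0 !subr0.
Qed.

Lemma prim_ge0 g (s : R) : continuous g -> (forall x, 0 <= g x) -> 0 <= s ->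
  0 <= prim g s.
Proof.
move=> cg g0 s0; rewrite -(prim0 g); apply: (isd_le s0 (df := g)) => // x _.
exact: is_derive_prim.
Qed.

Lemma norm_prim_le g (K s : R) : continuous g -> (forall x, `|g x| <= K) ->
  `|prim g s| <= K * `|s|.
Proof.
move=> c gK.
have := @isd_bound R _ _ K 0 s (fun x => is_derive_prim x c) gK.
by rewrite prim0 !subr0.
Qed.

End PrimitiveParity.

(** * The polynomial quotient that regularizes P at 0 *)

Section TelescopedPolynomial.
Context {R : realType}.
Implicit Types (cs : seq R) (x : R).

(* The polynomial p with prod (1 + c^2 X^2) = 1 + X^2 p. *)
Fixpoint quot_poly cs : {poly R} :=
  if cs is c :: cs' then
    quot_poly cs' + c ^+ 2 *: (1 + 'X^2 * quot_poly cs')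
  else 0.

Lemma quot_poly_cons c cs x : (quot_poly (c :: cs)).[x] =
  (quot_poly cs).[x] + c ^+ 2 * (1 + x ^+ 2 * (quot_poly cs).[x]).
Proof. by rewrite /= hornerD hornerZ hornerD hornerM hornerXn hornerC. Qed.

Lemma quot_polyE cs x :
  \prod_(c <- cs) (1 + c ^+ 2 * x ^+ 2) = 1 + x ^+ 2 * (quot_poly cs).[x].
Proof.
elim: cs => [|c cs IH]; first by rewrite big_nil /= horner0 mulr0 addr0.
by rewrite big_cons IH quot_poly_cons; ring.
Qed.

Lemma quot_poly0 cs : (quot_poly cs).[0] = \sum_(c <- cs) c ^+ 2.
Proof.
elim: cs => [|c cs IH]; first by rewrite big_nil /= horner0.
by rewrite big_cons quot_poly_cons IH; ring.
Qed.

Lemma quot_poly_ge0 cs x : 0 <= (quot_poly cs).[x].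
Proof.
elim: cs => [|c cs IH]; first by rewrite horner0.
by rewrite quot_poly_cons addr_ge0// mulr_ge0 ?sqr_ge0// addr_ge0// mulr_ge0// sqr_ge0.
Qed.

(** In the telescoped form of (Q - 1) / x^2 each c^2 is multiplied by a partial product of Q, which
    is at most Q. This makes [MM] comparable to [qq], uniformly in s. *)
Lemma quot_poly_le cs x : (quot_poly cs).[x] <=
  (\sum_(c <- cs) c ^+ 2) * \prod_(c <- cs) (1 + c ^+ 2 * x ^+ 2).
Proof.
elim: cs => [|c cs IH]; first by rewrite !big_nil /= horner0 mul0r lexx.
rewrite !big_cons quot_poly_cons -quot_polyE.
have c0 : 0 <= c ^+ 2 := sqr_ge0 c; have x0 : 0 <= x ^+ 2 := sqr_ge0 x.
have s0 : 0 <= \sum_(c <- cs) c ^+ 2 by apply: sumr_ge0 => i _; exact: sqr_ge0.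
move: IH.
have q1 : 1 <= \prod_(c <- cs) (1 + c ^+ 2 * x ^+ 2).
  by rewrite quot_polyE lerDl mulr_ge0// quot_poly_ge0.
set q := \prod_(c <- cs) _ in q1 *; set p := _.[x] => IH.
set S := \sum_(c <- cs) _ in s0 IH *.
rewrite mulrDl [X in _ <= X]addrC lerD//.
  rewrite (le_trans IH)// ler_wpM2l// ler_peMl ?(le_trans ler01)//.
  by rewrite lerDl mulr_ge0.
by rewrite ler_wpM2l// ler_peMl ?(le_trans ler01)// lerDl mulr_ge0.
Qed.

End TelescopedPolynomial.

Section Profile.
Context {R : realType} {m : nat}.
Variable h : 'I_m -> R.
Hypothesis h_gt0 : forall k, 0 < h k.
Implicit Types (e s u : R) (k : 'I_m).

Let h_neq0 k : h k != 0. Proof. by rewrite gt_eqF. Qed.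

Let cs_h : seq R := [seq (h k)^-1 | k <- index_enum 'I_m].

Definition qq s : R := \prod_(k < m) (1 + (h k)^-1 ^+ 2 * s ^+ 2).

Definition pp : {poly R} := quot_poly [seq (h k)^-1 | k <- index_enum 'I_m].

Definition Khh : R := \sum_(k < m) (h k)^-1 ^+ 2.

(** For e > 0 this is e^2 P(s^2): the factor of index n is 1 + s^2 / e^2, and (1 + s^2 / e^2) qq - 1
    = s^2 (pp + qq / e^2). *)
Definition MM e s : R := qq s + e ^+ 2 * pp.[s].
Definition rho e s : R := (Num.sqrt (MM e s))^-1.
Definition etaq s : R := (Num.sqrt (qq s))^-1.
(** This is sqrt (qq / MM), equal to 1 at e = 0; the derivatives of [vv] and [uu] will be [kap]
    times [CC] and [SS]. *)
Definition kap e s : R := qq s * etaq s * rho e s.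
Definition lam k s : R := (h k ^+ 2 + s ^+ 2)^-1.
Definition Lam s : R := \sum_k lam k s.

Lemma qqE s : qq s = 1 + s ^+ 2 * pp.[s].
Proof. by rewrite -quot_polyE big_map. Qed.

Lemma pp_ge0 s : 0 <= pp.[s]. Proof. exact: quot_poly_ge0. Qed.

Lemma pp0 : pp.[0] = Khh.
Proof. by rewrite quot_poly0 big_map. Qed.

Lemma Khh_ge0 : 0 <= Khh. Proof. by rewrite -pp0 pp_ge0. Qed.

Lemma pp_le s : pp.[s] <= Khh * qq s.
Proof. by have := quot_poly_le cs_h s; rewrite !big_map. Qed.

Lemma qq_ge1 s : 1 <= qq s.
Proof. by rewrite qqE lerDl mulr_ge0 ?sqr_ge0 ?pp_ge0. Qed.

Lemma qq_gt0 s : 0 < qq s. Proof. exact: lt_le_trans (qq_ge1 s). Qed.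

Lemma MM_geq e s : qq s <= MM e s.
Proof. by rewrite lerDl mulr_ge0 ?sqr_ge0 ?pp_ge0. Qed.

Lemma MM_ge1 e s : 1 <= MM e s.
Proof. exact: le_trans (qq_ge1 s) (MM_geq e s). Qed.

Lemma MM_gt0 e s : 0 < MM e s. Proof. exact: lt_le_trans (MM_ge1 e s). Qed.

Lemma MM_le e s : MM e s <= qq s * (1 + e ^+ 2 * Khh).
Proof.
rewrite /MM mulrDr mulr1 lerD2l mulrCA ler_wpM2l ?sqr_ge0//.
by rewrite mulrC pp_le.
Qed.

Lemma rho_gt0 e s : 0 < rho e s. Proof. by rewrite invr_gt0 sqrtr_gt0 MM_gt0. Qed.
Lemma eta_gt0 s : 0 < etaq s. Proof. by rewrite invr_gt0 sqrtr_gt0 qq_gt0. Qed.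

Lemma rho_le1 e s : rho e s <= 1.
Proof.
rewrite /rho invf_le1 ?sqrtr_gt0 ?MM_gt0// -sqrtr1.
by rewrite ler_wsqrtr// MM_ge1.
Qed.

Lemma rho2 e s : rho e s ^+ 2 * MM e s = 1.
Proof.
rewrite /rho exprVn sqr_sqrtr ?ltW ?MM_gt0// mulVf// gt_eqF// MM_gt0//.
Qed.

Lemma eta2 s : etaq s ^+ 2 * qq s = 1.
Proof.
by rewrite /etaq exprVn sqr_sqrtr ?ltW ?qq_gt0// mulVf// gt_eqF// qq_gt0.
Qed.

Lemma lam_gt0 k s : 0 < lam k s.
Proof. by rewrite invr_gt0 ltr_pwDl ?sqr_ge0// exprn_gt0. Qed.

Lemma lamV k s : lam k s * (h k ^+ 2 + s ^+ 2) = 1.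
Proof. by rewrite mulVf// gt_eqF// -invr_gt0 lam_gt0. Qed.

Lemma lam_le k s : lam k s <= (h k)^-1 ^+ 2.
Proof.
rewrite exprVn lef_pV2 ?posrE ?exprn_gt0 ?lerDl ?sqr_ge0//.
by rewrite -invr_gt0 lam_gt0.
Qed.

Lemma lam0 k : lam k 0 = (h k)^-1 ^+ 2.
Proof. by rewrite /lam expr0n addr0 exprVn. Qed.

Lemma is_derive_sq (s : R) : is_derive s 1 (fun x : R => x ^+ 2) (2 * s).
Proof. by apply: (isd_eq (isdX 2 (is_derive_id s 1))); rewrite mulr1 expr1. Qed.

Lemma is_derive_lam k s : is_derive s 1 (lam k) (- (2 * s * lam k s ^+ 2)).
Proof.
have n0 : h k ^+ 2 + s ^+ 2 != 0 by rewrite gt_eqF// -invr_gt0 lam_gt0.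
apply: (isd_eq (isdV (isdD (isdC (h k ^+ 2) s 1) (is_derive_sq s)) n0)).
by rewrite add0r /lam exprVn mulNr.
Qed.

Lemma is_derive_horner (P : {poly R}) s : is_derive s 1 (horner P) P^`().[s].
Proof.
apply: DeriveDef; first exact: derivable_horner.
by rewrite derivE derive1E.
Qed.

Lemma is_derive_prod (I : Type) (r : seq I) (f df : I -> R -> R) s :
  (forall i, f i s != 0) -> (forall i, is_derive s 1 (f i) (df i s)) ->
  is_derive s 1 (fun x => \prod_(i <- r) f i x)
    ((\prod_(i <- r) f i s) * \sum_(i <- r) df i s / f i s).
Proof.
move=> f0 fd; elim: r => [|i r IH].
  under eq_fun do rewrite big_nil.
  by apply: (isd_eq (isdC _ _ _)); rewrite !big_nil mulr0.
under eq_fun do rewrite big_cons.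
apply: (isd_eq (isdM (fd i) IH)); rewrite !big_cons.
set P := \prod_(i <- r) _; set S := \sum_(i <- r) _.
by field.
Qed.

Lemma is_derive_qq s : is_derive s 1 qq (2 * s * qq s * Lam s).
Proof.
have n0 k : 1 + (h k)^-1 ^+ 2 * s ^+ 2 != 0.
  by rewrite gt_eqF// ltr_pwDl// mulr_ge0 ?sqr_ge0.
have fd k : is_derive s 1 (fun x => 1 + (h k)^-1 ^+ 2 * x ^+ 2)
    ((h k)^-1 ^+ 2 * (2 * s)).
  apply: (isd_eq (isdD (isdC (1 : R) s 1) (isdZ _ (is_derive_sq s)))).
  by rewrite add0r.
apply: (isd_eq (@is_derive_prod _ (index_enum 'I_m) _
  (fun k x => (h k)^-1 ^+ 2 * (2 * x)) s n0 fd)).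
rewrite -/(qq s) /Lam [RHS]mulrC mulrA mulrC; congr (_ * _).
rewrite mulrC mulr_sumr; apply: eq_bigr => k _.
have := n0 k; have := lamV k s; have hk := h_neq0 k; rewrite /lam => l1 n1.
have n2 : h k ^+ 2 + s ^+ 2 != 0 by rewrite gt_eqF// -invr_gt0 lam_gt0.
by field; rewrite ?n2 ?hk.
Qed.

(** Two computations of the derivative of qq = 1 + s^2 pp, compared and divided by s. At s = 0 both
    sides vanish because pp(0) and Lam(0) are both the sum of the h_k^-2. *)
Lemma horner_pp_deriv s : s * pp^`().[s] = 2 * (qq s * Lam s - pp.[s]).
Proof.
have D : is_derive s 1 qq (2 * s * pp.[s] + s ^+ 2 * pp^`().[s]).
  rewrite (_ : qq = fun x => 1 + x ^+ 2 * pp.[x]); last exact/funext/qqE.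
  apply: (isd_eq (isdD (isdC (1 : R) s 1)
    (isdM (is_derive_sq s) (is_derive_horner _ s)))).
  by rewrite add0r.
have [s0|s0] := eqVneq s 0.
  rewrite s0 mul0r qqE pp0 expr0n !mul0r addr0 mul1r /Lam.
  by rewrite (eq_bigr _ (fun k _ => lam0 k)) subrr mulr0.
have E : 2 * s * qq s * Lam s = 2 * s * pp.[s] + s ^+ 2 * pp^`().[s].
  by case: D => _ <-; case: (is_derive_qq s) => _ ->.
apply: (mulfI s0); rewrite -[LHS](addKr (2 * s * pp.[s])) mulrA -expr2 -E.
by ring.
Qed.

Lemma is_derive_MM e s :
  is_derive s 1 (MM e) (2 * s * qq s * Lam s + e ^+ 2 * pp^`().[s]).
Proof. exact: isdD (is_derive_qq s) (isdZ _ (is_derive_horner _ s)). Qed.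

Lemma is_derive_rsqrt (f : R -> R) s d : 0 < f s -> is_derive s 1 f d ->
  is_derive s 1 (fun x => (Num.sqrt (f x))^-1)
    (- d / 2 * (Num.sqrt (f s))^-1 ^+ 3).
Proof.
move=> f0 fd; have n0 : Num.sqrt (f s) != 0 by rewrite gt_eqF// sqrtr_gt0.
apply: (isd_eq (isdV (isd_comp1 fd (is_derive1_sqrt f0)) n0)).
rewrite -(sqr_sqrtr (ltW f0)); set r := Num.sqrt _ in n0 *.
rewrite sqrtr_sqr ger0_norm ?sqrtr_ge0//.
by field.
Qed.

Lemma is_derive_rho e s : is_derive s 1 (rho e)
  (- (2 * s * qq s * Lam s + e ^+ 2 * pp^`().[s]) / 2 * rho e s ^+ 3).
Proof. exact: is_derive_rsqrt (MM_gt0 e s) (is_derive_MM e s). Qed.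

Lemma is_derive_eta s : is_derive s 1 etaq (- s * Lam s * etaq s).
Proof.
apply: (isd_eq (is_derive_rsqrt (qq_gt0 s) (is_derive_qq s))).
rewrite -/(etaq s) exprS.
rewrite (_ : _ / 2 = - s * Lam s * qq s); last by field.
by rewrite -!mulrA (mulrA (qq s)) (mulrC (qq s)) -mulrA (mulrC (qq s)) eta2 mulr1.
Qed.

End Profile.

Section Profile2.
Context {R : realType} {m : nat}.
Variable h : 'I_m -> R.
Hypothesis h_gt0 : forall k, 0 < h k.
Implicit Types (e s u : R) (k : 'I_m).

Local Notation qq := (qq h).
Local Notation pp := (pp h).
Local Notation MM := (MM h).
Local Notation rho := (rho h).
Local Notation etaq := (etaq h).
Local Notation kap := (kap h).
Local Notation lam := (lam h).
Local Notation Lam := (Lam h).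

Let h_neq0 k : h k != 0. Proof. by rewrite gt_eqF. Qed.

(* For [e > 0] the angles of the neck with [c = (1/h_1, .., 1/h_(n-1), 1/e)] are
   [psi_k = e * II k e], and its last coordinate is [- vv + i e uu]; dividing by
   [e] by means of [cs] and [sn] makes sense of all this at [e = 0]. *)
Definition JJ e s : R := prim (rho e) s.
Definition II k e s : R := prim (fun u => rho e u * lam k u) s.
Definition IS e s : R := \sum_k II k e s.
Definition CC e s : R := cs e (IS e s).
Definition SS e s : R := sn e (IS e s).
Definition ckk k e s : R := cs e (II k e s).
(** The tangent of the angle e II divided by e: over x the neck has y_j = e tau_j x_j. *)
Definition tau k e s : R := sn e (II k e s) / ckk k e s.
Definition aa k e s : R := lam k s / ckk k e s ^+ 2.
(** Minus half the logarithmic derivative of [aa] in s; it is s lam at e = 0. *)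
Definition bb k e s : R := lam k s * (s - e ^+ 2 * rho e s * tau k e s).
(** Here MM rho = sqrt MM, and arctan (s sqrt P) is the argument of e + i s sqrt MM. Subtracting the
    angles of the first coordinates gives e uu + i vv = etaq (e + i s MM rho) exp (- i e IS), in
    which psi_n no longer occurs. *)
Definition vv e s : R := etaq s * (s * (MM e s * rho e s) * CC e s - e ^+ 2 * SS e s).
Definition uu e s : R := etaq s * (s * (MM e s * rho e s) * SS e s + CC e s).

Lemma continuous_rho e : continuous (rho e).
Proof. by move=> s; apply: isd_cont (is_derive_rho h_gt0 e s). Qed.

Lemma continuous_lam k : continuous (lam k).
Proof. by move=> s; apply: isd_cont (is_derive_lam h_gt0 k s). Qed.

Lemma continuous_rholam k e : continuous (fun u => rho e u * lam k u).
Proof.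
move=> s.
by apply: isd_cont (isdM (is_derive_rho h_gt0 e s) (is_derive_lam h_gt0 k s)).
Qed.

Lemma is_derive_JJ e s : is_derive s 1 (JJ e) (rho e s).
Proof. exact: is_derive_prim (@continuous_rho e). Qed.

Lemma is_derive_II k e s : is_derive s 1 (II k e) (rho e s * lam k s).
Proof. exact: is_derive_prim (@continuous_rholam k e). Qed.

Lemma is_derive_IS e s : is_derive s 1 (IS e) (rho e s * Lam s).
Proof.
rewrite mulr_sumr; apply: (@isdS R R^o m (fun k x => II k e x)) => k.
exact: is_derive_II.
Qed.

Lemma is_derive_CC e s : is_derive s 1 (CC e) (- e ^+ 2 * SS e s * rho e s * Lam s).
Proof.
apply: (isd_eq (isd_comp1 (is_derive_IS e s) (is_derive_cs _ _))).
by rewrite /SS; ring.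
Qed.

Lemma is_derive_SS e s : is_derive s 1 (SS e) (CC e s * rho e s * Lam s).
Proof.
apply: (isd_eq (isd_comp1 (is_derive_IS e s) (is_derive_sn _ _))).
by rewrite /CC; ring.
Qed.

Lemma is_derive_ckk k e s : is_derive s 1 (ckk k e)
  (- e ^+ 2 * sn e (II k e s) * rho e s * lam k s).
Proof.
apply: (isd_eq (isd_comp1 (is_derive_II k e s) (is_derive_cs _ _))).
by ring.
Qed.

Lemma is_derive_tau k e s : ckk k e s != 0 ->
  is_derive s 1 (tau k e) (rho e s * aa k e s).
Proof.
move=> c0.
apply: (isd_eq (isdM (isd_comp1 (is_derive_II k e s) (is_derive_sn _ _))
  (isdV (is_derive_ckk k e s) c0))).
rewrite /aa -[rho e s * (_ / _)]mulr1 -(cs2sn2 e (II k e s)) -/(ckk k e s).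
by field.
Qed.

Lemma is_derive_aa k e s : ckk k e s != 0 ->
  is_derive s 1 (aa k e) (- 2 * aa k e s * bb k e s).
Proof.
move=> c0.
apply: (isd_eq (isdM (is_derive_lam h_gt0 k s)
  (isdV (isdX 2 (is_derive_ckk k e s)) (expf_neq0 2 c0)))).
by rewrite /aa /bb /tau /= expr1; field.
Qed.

Lemma is_derive_MMrho e s : is_derive s 1 (fun x => MM e x * rho e x)
  (rho e s * (2 * s * qq s * Lam s + e ^+ 2 * pp^`().[s]) / 2).
Proof.
apply: (isd_eq (isdM (is_derive_MM h_gt0 e s) (is_derive_rho h_gt0 e s))).
set d := 2 * s * _ * _ + _.
rewrite exprS (_ : d * _ + _ =
   d * rho e s - d / 2 * rho e s * (rho e s ^+ 2 * MM e s)); last by field.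
by rewrite rho2 mulr1; field.
Qed.

(** [horner_pp_deriv] eliminates pp' and [qqE] the powers of s; the terms in s^2 Lam then cancel. *)
Lemma is_derive_y e s : is_derive s 1 (fun x => etaq x * (x * (MM e x * rho e x)))
  (etaq s * rho e s * (qq s + e ^+ 2 * Lam s)).
Proof.
apply: (isd_eq (isdM (is_derive_eta h_gt0 s)
  (isdM (is_derive_id s 1) (is_derive_MMrho e s)))).
have := horner_pp_deriv h_gt0 s; have := qqE h s.
set d := pp^`().[s]; set p := pp.[s] => Eq Ep.
transitivity (etaq s * rho e s * (MM e s - s * Lam s * s * MM e s
   + s * s * qq s * Lam s + e ^+ 2 * (s * d) / 2)); first by field.
rewrite Ep /MM -/p; rewrite {1 2 3}(_ : qq s = 1 + s ^+ 2 * p)//; rewrite Eq.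
by field.
Qed.

(** The other terms in [Lam] cancel by rho^2 MM = 1. The simple form left over shows that v
    increases as long as the total angle e IS has a positive cosine. *)
Lemma is_derive_vv e s : is_derive s 1 (vv e) (CC e s * kap e s).
Proof.
have D := isdB (isdM (is_derive_y e s) (is_derive_CC e s))
  (isdZ (e ^+ 2) (isdM (is_derive_eta h_gt0 s) (is_derive_SS e s))).
rewrite (_ : vv e = fun x => etaq x * (x * (MM e x * rho e x)) * CC e x
   - e ^+ 2 * (etaq x * SS e x)); last by apply/funext => x; rewrite /vv; ring.
apply: (isd_eq D); rewrite /kap.
transitivity (CC e s * (qq s * etaq s * rho e s) + e ^+ 2 * s * etaq s * SS e s
  * Lam s * (1 - rho e s ^+ 2 * MM e s)); first by ring.
by rewrite rho2 subrr mulr0 addr0.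
Qed.

Lemma is_derive_uu e s : is_derive s 1 (uu e) (SS e s * kap e s).
Proof.
have D := isdD (isdM (is_derive_y e s) (is_derive_SS e s))
  (isdM (is_derive_eta h_gt0 s) (is_derive_CC e s)).
rewrite (_ : uu e = fun x => etaq x * (x * (MM e x * rho e x)) * SS e x
   + etaq x * CC e x); last by apply/funext => x; rewrite /uu; ring.
apply: (isd_eq D); rewrite /kap.
transitivity (SS e s * (qq s * etaq s * rho e s) - s * etaq s * CC e s
  * Lam s * (1 - rho e s ^+ 2 * MM e s)); first by ring.
by rewrite rho2 subrr mulr0 subr0.
Qed.

Lemma qqN s : qq (- s) = qq s.
Proof. by apply: eq_bigr => k _; rewrite sqrrN. Qed.

Lemma ppN s : pp.[- s] = pp.[s].
Proof.
have [->|s0] := eqVneq s 0; first by rewrite oppr0.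
have := qqE h (- s); rewrite qqN qqE sqrrN => /addrI /mulfI-> //.
by rewrite expf_neq0.
Qed.

Lemma MMN e s : MM e (- s) = MM e s. Proof. by rewrite /MM qqN ppN. Qed.
Lemma rhoN e s : rho e (- s) = rho e s. Proof. by rewrite /rho MMN. Qed.
Lemma etaN s : etaq (- s) = etaq s. Proof. by rewrite /etaq qqN. Qed.
Lemma lamN k s : lam k (- s) = lam k s. Proof. by rewrite /lam sqrrN. Qed.

Lemma JJN e s : JJ e (- s) = - JJ e s.
Proof. by apply: primN => [|x]; [exact: continuous_rho|exact: rhoN]. Qed.

Lemma IIN k e s : II k e (- s) = - II k e s.
Proof.
by apply: primN => [|x]; [exact: continuous_rholam|rewrite rhoN lamN].
Qed.

Lemma ISN e s : IS e (- s) = - IS e s.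
Proof. by rewrite /IS -sumrN; apply: eq_bigr => k _; exact: IIN. Qed.

Lemma CCN e s : CC e (- s) = CC e s. Proof. by rewrite /CC ISN csN. Qed.
Lemma SSN e s : SS e (- s) = - SS e s. Proof. by rewrite /SS ISN snN. Qed.
Lemma ckkN k e s : ckk k e (- s) = ckk k e s. Proof. by rewrite /ckk IIN csN. Qed.
Lemma tauN k e s : tau k e (- s) = - tau k e s.
Proof. by rewrite /tau IIN snN ckkN mulNr. Qed.
Lemma aaN k e s : aa k e (- s) = aa k e s. Proof. by rewrite /aa lamN ckkN. Qed.
Lemma bbN k e s : bb k e (- s) = - bb k e s.
Proof. by rewrite /bb lamN rhoN tauN; ring. Qed.
Lemma vvN e s : vv e (- s) = - vv e s.
Proof. by rewrite /vv etaN MMN rhoN CCN SSN; ring. Qed.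
Lemma uuN e s : uu e (- s) = uu e s.
Proof. by rewrite /uu etaN MMN rhoN CCN SSN; ring. Qed.

Lemma JJ0 e : JJ e 0 = 0. Proof. exact: prim0. Qed.
Lemma II0 k e : II k e 0 = 0. Proof. exact: prim0. Qed.
Lemma IS0 e : IS e 0 = 0.
Proof. by apply: big1 => k _; exact: II0. Qed.
Lemma vv0 e : vv e 0 = 0.
Proof. by rewrite /vv /SS IS0 snz0 !mul0r mulr0 subr0 mulr0. Qed.
Lemma aa0 k e : aa k e 0 = (h k)^-1 ^+ 2.
Proof. by rewrite /aa /ckk II0 csz0 expr1n divr1 lam0. Qed.

Lemma rho_lam_ge0 k e u : 0 <= rho e u * lam k u.
Proof. by rewrite mulr_ge0// ltW// ?rho_gt0 ?lam_gt0. Qed.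

Lemma II_ge0 k e s : 0 <= s -> 0 <= II k e s.
Proof.
by apply: prim_ge0 => [|u]; [exact: continuous_rholam|exact: rho_lam_ge0].
Qed.

Lemma norm_II k e s : `|II k e s| <= (h k)^-1 ^+ 2 * `|s|.
Proof.
apply: norm_prim_le => [|u]; first exact: continuous_rholam.
rewrite ger0_norm ?rho_lam_ge0// -[X in _ <= X]mul1r.
by rewrite ler_pM ?lam_le ?rho_le1// ltW// ?rho_gt0 ?lam_gt0.
Qed.

Lemma norm_JJ e s : `|JJ e s| <= `|s|.
Proof.
rewrite -[X in _ <= X]mul1r; apply: norm_prim_le => [|u].
  exact: continuous_rho.
by rewrite gtr0_norm ?rho_gt0// rho_le1.
Qed.

Lemma II_le_atan k e s : 0 <= s -> II k e s <= (h k)^-1 * atan ((h k)^-1 * s).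
Proof.
move=> s0.
have D u : is_derive u 1 (fun x => (h k)^-1 * atan ((h k)^-1 * x) - II k e x)
    (lam k u - rho e u * lam k u).
  apply: isdB (is_derive_II k e u).
  apply: (isd_eq (isdZ _ (isd_comp1 (is_derive_emul _ _) (is_derive1_atan _)))).
  have hk := h_neq0 k; have := lamV h_gt0 k u.
  have n2 : h k ^+ 2 + u ^+ 2 != 0 by rewrite gt_eqF// -invr_gt0 (lam_gt0 h_gt0).
  by rewrite /lam => _; field; rewrite hk n2.
have := isd_le s0 (fun u _ => D u).
rewrite mulr0 atan0 mulr0 II0 subr0 subr_ge0; apply => u _.
by rewrite subr_ge0 ger_pMl ?lam_gt0// rho_le1.
Qed.

(** Since rho <= 1, each integral is at most that of [lam], an arctangent. The bound is uniform in e
    and s, so a small e keeps e IS in [-1, 1] along the whole neck. *)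
Lemma IS_bounded : exists2 B : R, 0 < B & forall e s, `|IS e s| <= B.
Proof.
exists (1 + \sum_k (h k)^-1 * (pi / 2)) => [|e s].
  rewrite ltr_pwDl// sumr_ge0// => k _.
  by rewrite mulr_ge0 ?divr_ge0 ?pi_ge0// invr_ge0 ltW.
rewrite -[leLHS]add0r lerD//.
wlog s0 : s / 0 <= s => [hw|].
  by case: (leP 0 s) => [/hw//|/ltW s0]; rewrite -normrN -ISN hw// oppr_ge0.
rewrite ger0_norm; last by apply: sumr_ge0 => k _; exact: II_ge0.
apply: ler_sum => k _; rewrite (le_trans (II_le_atan k e s0))//.
by rewrite ler_wpM2l ?invr_ge0 ?(ltW (h_gt0 k))// ltW// atan_ltpi2.
Qed.

(** The II_j have a common sign, so that a bound on their sum controls each single angle. *)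
Lemma norm_II_le_IS k e s : `|II k e s| <= `|IS e s|.
Proof.
wlog s0 : s / 0 <= s => [hw|].
  case: (leP 0 s) => [/hw//|/ltW s0].
  by rewrite -normrN -IIN -[in leRHS]normrN -ISN hw// oppr_ge0.
rewrite !ger0_norm ?II_ge0//; last by apply: sumr_ge0 => j _; exact: II_ge0.
by rewrite /IS (bigD1 k)//= lerDl sumr_ge0// => j _; exact: II_ge0.
Qed.

End Profile2.

(** * Joint continuity at the parameter e = 0 *)

Section JointConvergence.
Context {R : realType}.

Lemma cvg0_le {T : Type} {F : set_system T} {FF : Filter F} (f g : T -> R) :
  (forall t, `|f t| <= g t) -> g @ F --> 0 -> f @ F --> 0.
Proof.
move=> fg /cvgr0Pnorm_lt g0; apply/cvgr0Pnorm_lt => e e0.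
apply: filterS (g0 e e0) => t; apply: le_lt_trans.
exact: le_trans (fg t) (ler_norm _).
Qed.

Lemma cvg_sumr {T : Type} {F : set_system T} {FF : Filter F} (I : Type)
    (r : seq I) (f : I -> T -> R) (a : I -> R) :
  (forall i, f i @ F --> a i) ->
  \sum_(i <- r) f i t @[t --> F] --> \sum_(i <- r) a i.
Proof.
move=> fa; elim: r => [|i r IH].
  by rewrite big_nil; under eq_fun do rewrite big_nil; exact: cvg_cst.
by rewrite big_cons; under eq_fun do rewrite big_cons; exact: cvgD.
Qed.

(* Joint continuity of a family [G e s] at the points of parameter [e = 0]. *)
Definition jcvg (G : R -> R -> R) : Prop :=
  forall (T : Type) (F : set_system T) (FF : Filter F) (E S : T -> R) (s0 : R),
  E @ F --> (0 : R) -> S @ F --> s0 -> G (E t) (S t) @[t --> F] --> G 0 s0.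

Lemma jcvg_s (g : R -> R) : continuous g -> jcvg (fun=> g).
Proof. by move=> cg T F FF E S s0 E0 Ss; apply: (continuous_cvg _ (cg s0)). Qed.

Lemma jcvg_id : jcvg (fun _ s => s). Proof. by move=> T F FF E S s0 E0 Ss. Qed.

Lemma jcvg_e : jcvg (fun e _ => e). Proof. by move=> T F FF E S s0 E0 Ss. Qed.

Lemma jcvg_c {c : R} : jcvg (fun _ _ => c).
Proof. by move=> T F FF E S s0 E0 Ss; exact: cvg_cst. Qed.

Lemma jcvgD G1 G2 : jcvg G1 -> jcvg G2 -> jcvg (fun e s => G1 e s + G2 e s).
Proof. by move=> g1 g2 T F FF E S s0 E0 Ss; apply: cvgD; [exact: g1|exact: g2]. Qed.

Lemma jcvgN G1 : jcvg G1 -> jcvg (fun e s => - G1 e s).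
Proof. by move=> g1 T F FF E S s0 E0 Ss; apply: cvgN; exact: g1. Qed.

Lemma jcvgM G1 G2 : jcvg G1 -> jcvg G2 -> jcvg (fun e s => G1 e s * G2 e s).
Proof. by move=> g1 g2 T F FF E S s0 E0 Ss; apply: cvgM; [exact: g1|exact: g2]. Qed.

Lemma jcvgX G1 n : jcvg G1 -> jcvg (fun e s => G1 e s ^+ n).
Proof.
move=> g1; elim: n => [|n IH]; first exact: jcvg_c.
move=> T F FF E S s0 E0 Ss; rewrite exprS; under eq_fun do rewrite exprS.
exact: (jcvgM g1 IH).
Qed.

Lemma jcvgV G1 : (forall s, G1 0 s != 0) -> jcvg G1 -> jcvg (fun e s => (G1 e s)^-1).
Proof. by move=> n0 g1 T F FF E S s0 E0 Ss; apply: cvgV; [exact: n0|exact: g1]. Qed.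

Lemma jcvg_sum n (G : 'I_n -> R -> R -> R) : (forall i, jcvg (G i)) ->
  jcvg (fun e s => \sum_i G i e s).
Proof.
by move=> g T F FF E S s0 E0 Ss; apply: cvg_sumr => i; exact: g.
Qed.

(** Splits G e s into (G e s - G 0 s) + G 0 s. For the primitives [JJ] and [II] the bound K comes
    from an estimate of the integrands, which replaces passing to the limit under the integral. *)
Lemma jcvg_near0 G1 (K : R -> R -> R) : continuous (G1 0) -> jcvg K ->
  (forall s, K 0 s = 0) ->
  (forall e s, `|G1 e s - G1 0 s| <= K e s) -> jcvg G1.
Proof.
move=> c0 jK K0 GK T F FF E S s0 E0 Ss.
rewrite (_ : (fun t => _) = (fun t => (G1 (E t) (S t) - G1 0 (S t)) + G1 0 (S t)));
  last by apply/funext => t; rewrite subrK.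
rewrite -[G1 0 s0]add0r; apply: cvgD.
  apply: (@cvg0_le _ F FF _ (fun t => K (E t) (S t))) => [t|]; first exact: GK.
  by rewrite -(K0 s0); exact: jK.
by apply: (continuous_cvg _ (c0 s0)).
Qed.

Lemma jcvg_comp (g : R -> R) G1 : (forall s, {for G1 0 s, continuous g}) ->
  jcvg G1 -> jcvg (fun e s => g (G1 e s)).
Proof.
by move=> cg g1 T F FF E S s0 E0 Ss; apply: (continuous_cvg _ (cg s0)); exact: g1.
Qed.

Lemma jcvg_cs G1 : jcvg G1 -> jcvg (fun e s => cs e (G1 e s)).
Proof.
move=> g1; apply: (@jcvg_comp cos (fun e s => e * G1 e s)).
  by move=> s; exact: continuous_cos.
exact: jcvgM jcvg_e g1.
Qed.

Lemma jcvg_norm G1 : jcvg G1 -> jcvg (fun e s => `|G1 e s|).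
Proof. by move=> g1 T F FF E S s0 E0 Ss; apply: cvg_norm; exact: g1. Qed.

Lemma jcvg_sn G1 : jcvg G1 -> jcvg (fun e s => sn e (G1 e s)).
Proof.
move=> g1 T F FF E S s0 E0 Ss; rewrite sn0.
rewrite (_ : (fun t => _) = (fun t => (sn (E t) (G1 (E t) (S t)) - G1 (E t) (S t))
   + G1 (E t) (S t))); last by apply/funext => t; rewrite subrK.
rewrite -[G1 0 s0]add0r; apply: cvgD; last exact: g1.
apply: (cvg0_le (fun t => dist_sn_le _ _)).
have j := jcvgM (jcvgM (jcvg_norm jcvg_e) (jcvg_norm g1)) (jcvg_norm g1).
by have := j T F FF E S s0 E0 Ss; rewrite normr0 !mul0r.
Qed.

End JointConvergence.

Section Profile3.
Context {R : realType} {m : nat}.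
Variable h : 'I_m -> R.
Hypothesis h_gt0 : forall k, 0 < h k.
Implicit Types (e s u : R) (k : 'I_m).

Lemma jcvg_MM : jcvg (MM h).
Proof.
apply: jcvgD.
  by apply: jcvg_s => s; exact: isd_cont (is_derive_qq h_gt0 s).
apply: jcvgM; first exact: (jcvgX jcvg_e).
by apply: jcvg_s => s; exact: isd_cont (is_derive_horner _ s).
Qed.

Lemma jcvg_rho : jcvg (rho h).
Proof.
apply: jcvgV => [s|]; first by rewrite gt_eqF// sqrtr_gt0 MM_gt0.
by apply: jcvg_comp jcvg_MM => s; exact: sqrt_continuous.
Qed.

Lemma jcvg_eta : jcvg (fun _ => etaq h).
Proof. by apply: jcvg_s => s; exact: isd_cont (is_derive_eta h_gt0 s). Qed.

Lemma jcvg_lam k : jcvg (fun _ => lam h k).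
Proof. by apply: jcvg_s => s; exact: continuous_lam. Qed.

(** With a and b the values at e and at 0, b^2 - a^2 = a^2 b^2 e^2 pp. Then pp <= Khh qq, b^2 qq = 1
    and a^2 <= a + b give the bound after division by a + b. *)
Lemma dist_rho_le e u : `|rho h e u - rho h 0 u| <= e ^+ 2 * Khh h.
Proof.
set a := rho h e u; set b := rho h 0 u.
have a0 : 0 < a := rho_gt0 h e u; have b0 : 0 < b := rho_gt0 h 0 u.
have a1 : a <= 1 := rho_le1 h e u; have b1 : b <= 1 := rho_le1 h 0 u.
have ea : a ^+ 2 * MM h e u = 1 := rho2 h e u.
have eb : b ^+ 2 * qq h u = 1.
  by have := rho2 h 0 u; rewrite /MM expr0n mul0r addr0.
have p0 := pp_ge0 h u; have ple := pp_le h u.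
have q1 := qq_ge1 h u; have e20 := sqr_ge0 e.
have K0 := Khh_ge0 h.
rewrite /MM in ea; set p := (pp h).[u] in ea p0 ple; set q := qq h u in ea eb q1 ple.
have E : (b - a) * (b + a) = a ^+ 2 * b ^+ 2 * (e ^+ 2 * p).
  transitivity (b ^+ 2 * 1 - a ^+ 2 * 1); first by ring.
  by rewrite -{1}ea -eb; ring.
have D0 : 0 <= a ^+ 2 * b ^+ 2 * (e ^+ 2 * p).
  by apply: mulr_ge0; apply: mulr_ge0 => //; exact: sqr_ge0.
have ba : a <= b.
  by rewrite -subr_ge0 -(pmulr_lge0 _ (addr_gt0 b0 a0)) E.
rewrite distrC ger0_norm ?subr_ge0//.
rewrite -(ler_pM2r (addr_gt0 b0 a0)) E.
have H1 : a ^+ 2 * b ^+ 2 * (e ^+ 2 * p) <= a ^+ 2 * b ^+ 2 * (e ^+ 2 * (Khh h * q)).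
  apply: ler_wpM2l; first by apply: mulr_ge0; exact: sqr_ge0.
  exact: ler_wpM2l.
apply: (le_trans H1).
rewrite (_ : _ * _ = e ^+ 2 * Khh h * (a ^+ 2 * (b ^+ 2 * q))); last by ring.
rewrite eb mulr1; apply: ler_wpM2l; first exact: mulr_ge0.
by rewrite expr2 (le_trans (ler_piMr (ltW a0) a1))// lerDr ltW.
Qed.

Lemma jcvg_JJ : jcvg (JJ h).
Proof.
apply: (@jcvg_near0 _ _ (fun e s => e ^+ 2 * Khh h * `|s|)).
- by move=> s; exact: isd_cont (is_derive_JJ h_gt0 0 s).
- exact: jcvgM (jcvgM (jcvgX jcvg_e) jcvg_c) (jcvg_norm jcvg_id).
- by move=> s; rewrite expr0n !mul0r.
- move=> e s; apply: dist_prim_le; [exact: continuous_rho|exact: continuous_rho|].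
  exact: dist_rho_le.
Qed.

Lemma jcvg_II k : jcvg (II h k).
Proof.
apply: (@jcvg_near0 _ _ (fun e s => e ^+ 2 * Khh h * (h k)^-1 ^+ 2 * `|s|)).
- by move=> s; exact: isd_cont (is_derive_II h_gt0 k 0 s).
- exact: jcvgM (jcvgM (jcvgM (jcvgX jcvg_e) jcvg_c) jcvg_c) (jcvg_norm jcvg_id).
- by move=> s; rewrite expr0n !mul0r.
- move=> e s; apply: dist_prim_le => [||x]; [exact: continuous_rholam..|].
  rewrite -mulrBl normrM ler_pM// ?dist_rho_le//.
  by rewrite gtr0_norm ?lam_gt0// lam_le.
Qed.

Lemma jcvg_IS : jcvg (IS h).
Proof. by apply: jcvg_sum => k; exact: jcvg_II. Qed.

Lemma jcvg_CC : jcvg (CC h). Proof. exact: (jcvg_cs jcvg_IS). Qed.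
Lemma jcvg_SS : jcvg (SS h). Proof. exact: (jcvg_sn jcvg_IS). Qed.
Lemma jcvg_ckk k : jcvg (ckk h k). Proof. exact: (jcvg_cs (@jcvg_II k)). Qed.

Lemma ckk0 k s : ckk h k 0 s = 1. Proof. exact: cs0. Qed.

Lemma jcvg_tau k : jcvg (tau h k).
Proof.
apply: jcvgM; first exact: (jcvg_sn (@jcvg_II k)).
by apply: (jcvgV _ (@jcvg_ckk k)) => s; rewrite ckk0 oner_neq0.
Qed.

Lemma jcvg_aa k : jcvg (aa h k).
Proof.
apply: jcvgM; first exact: jcvg_lam.
apply: jcvgV; last exact: (jcvgX (@jcvg_ckk k)).
by move=> s; rewrite ckk0 expr1n oner_neq0.
Qed.

Lemma jcvg_vv : jcvg (vv h).
Proof.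
apply: jcvgM; first exact: jcvg_eta.
apply: jcvgD; last exact: jcvgN (jcvgM (jcvgX jcvg_e) jcvg_SS).
exact: jcvgM (jcvgM jcvg_id (jcvgM jcvg_MM jcvg_rho)) jcvg_CC.
Qed.

Lemma jcvg_uu : jcvg (uu h).
Proof.
apply: jcvgM; first exact: jcvg_eta.
apply: jcvgD; last exact: jcvg_CC.
exact: jcvgM (jcvgM jcvg_id (jcvgM jcvg_MM jcvg_rho)) jcvg_SS.
Qed.

(* Keeps the angles [e * II h k e s] in [[-1, 1]], where [cos] is positive. *)
Definition good e : Prop :=
  (forall s, `|e * IS h e s| <= 1) /\ e ^+ 2 * Khh h <= cos 1 / 2.

Lemma good_small : exists2 e0 : R, 0 < e0 & forall e, `|e| < e0 -> good e.
Proof.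
have [B B0 HB] := IS_bounded h_gt0.
have c0 := @cos1_gt0 R; have K0 := Khh_ge0 h.
have K1 : 0 < Khh h + 1 by rewrite ltr_wpDl.
exists (Num.min (Num.min 1 B^-1) (cos 1 / 2 / (Khh h + 1))).
  by rewrite !lt_min ltr01 invr_gt0 B0 /= !divr_gt0.
move=> e; rewrite !lt_min => /andP[/andP[e1 eB] eK]; split.
  move=> s; rewrite normrM (le_trans (ler_pM _ _ (ltW eB) (HB e s)))//.
  by rewrite mulVf// gt_eqF.
have e2 : e ^+ 2 <= `|e|.
  have -> : e ^+ 2 = `|e| ^+ 2 by rewrite -normrX ger0_norm ?sqr_ge0.
  by rewrite expr2 ler_piMr// ltW.
have /ltW : `|e| * (Khh h + 1) < cos 1 / 2 by rewrite -ltr_pdivlMr.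
apply: le_trans; apply: ler_pM => //; first exact: sqr_ge0.
by rewrite lerDl.
Qed.

Lemma good0 : good 0.
Proof.
have c0 := @cos1_gt0 R.
split=> [s|]; first by rewrite mul0r normr0 ler01.
by rewrite expr0n mul0r ltW// divr_gt0.
Qed.

Section Good.
Variable e : R.
Hypothesis ge : good e.

Lemma CC_ge s : cos 1 <= CC h e s. Proof. by apply: cs_ge; exact: ge.1. Qed.
Lemma ckk_ge k s : cos 1 <= ckk h k e s.
Proof.
apply: cs_ge; apply: le_trans (ge.1 s); rewrite !normrM ler_wpM2l//.
exact: norm_II_le_IS.
Qed.

Lemma ckk_gt0 k s : 0 < ckk h k e s.
Proof. exact: lt_le_trans (@cos1_gt0 R) (ckk_ge k s). Qed.

Lemma ckk_neq0 k s : ckk h k e s != 0. Proof. by rewrite gt_eqF// ckk_gt0. Qed.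

Lemma aa_gt0 k s : 0 < aa h k e s.
Proof. by rewrite divr_gt0 ?lam_gt0// exprn_gt0// ckk_gt0. Qed.

Lemma kap_gt0 s : 0 < kap h e s.
Proof. by rewrite !mulr_gt0// ?qq_gt0 ?eta_gt0 ?rho_gt0. Qed.

(** kap^2 = qq / MM is at least 1 / (1 + e^2 Khh), and [good] bounds e^2 Khh by 1/2. *)
Lemma kap_ge s : 1 / 2 <= kap h e s.
Proof.
have k0 := kap_gt0 s.
rewrite -(@ler_pXn2r _ 2) ?nnegrE ?(ltW k0) ?divr_ge0//.
have E : kap h e s ^+ 2 * MM h e s = qq h s.
  transitivity ((rho h e s ^+ 2 * MM h e s) * (etaq h s ^+ 2 * qq h s) * qq h s).
    by rewrite /kap; ring.
  by rewrite rho2 eta2 !mul1r.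
have M0 := MM_gt0 h e s.
rewrite -(ler_pM2r M0) E expr_div_n expr1n.
apply: le_trans (ler_wpM2l _ (MM_le h e s)) _ => //.
have c1 : cos 1 <= 1 :> R := cos_le1 1.
have := ge.2; set x := e ^+ 2 * Khh h => x1.
have q0 := qq_gt0 h s; rewrite mulrCA ger_pMr//.
by lra.
Qed.

(** A lower bound for the derivative of [vv], uniform in e and s: cos 1 bounds [CC] and 1/2 bounds
    [kap]. *)
Definition cvv : R := cos 1 / 2.

Lemma cvv_gt0 : 0 < cvv. Proof. by rewrite divr_gt0// cos1_gt0. Qed.

Lemma dvv_ge s : cvv <= CC h e s * kap h e s.
Proof.
rewrite /cvv -[cos 1 / 2](mulr1 (cos 1 / 2)) mulrAC mulr1.
have := kap_ge s; rewrite div1r => k2.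
by rewrite ler_pM ?CC_ge// ltW// cos1_gt0.
Qed.

Lemma dvv_gt0 s : 0 < CC h e s * kap h e s.
Proof. exact: lt_le_trans cvv_gt0 (dvv_ge s). Qed.

Lemma vv_incr s1 s2 : s1 < s2 -> vv h e s1 < vv h e s2.
Proof.
move=> s12; apply: (isd_lt s12 (fun x _ => is_derive_vv h_gt0 e x)) => x _.
exact: dvv_gt0.
Qed.

Lemma vv_ge s : 0 <= s -> cvv * s <= vv h e s.
Proof.
move=> s0; rewrite -subr_ge0.
have D (x : R) : is_derive x 1 (fun x => vv h e x - cvv * x) (CC h e x * kap h e x - cvv).
  apply: (isd_eq (isdB (is_derive_vv h_gt0 e x) (is_derive_emul cvv x))) => //.
have := isd_le s0 (fun x _ => D x).
rewrite vv0 mulr0 subr0; apply => x _.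
by rewrite subr_ge0 dvv_ge.
Qed.

Lemma vv_gt0 s : 0 < s -> 0 < vv h e s.
Proof. by move=> s0; rewrite -(vv0 h e) vv_incr. Qed.

Lemma norm_tau k s : `|tau h k e s| <= (h k)^-1 ^+ 2 / cos 1 * `|s|.
Proof.
rewrite normrM normfV [`|ckk _ _ _ _|]gtr0_norm ?ckk_gt0//.
rewrite mulrAC ler_pM// ?invr_ge0 ?(ltW (ckk_gt0 _ _))//.
  by rewrite (le_trans (norm_sn_le _ _))// norm_II.
by rewrite lef_pV2 ?posrE ?ckk_ge ?ckk_gt0 ?cos1_gt0.
Qed.

Lemma hk_le_Khh k : (h k)^-1 ^+ 2 <= Khh h.
Proof. by rewrite /Khh (bigD1 k)//= lerDl sumr_ge0// => j _; exact: sqr_ge0. Qed.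

(** The correction e^2 rho tau is at most e^2 Khh / cos 1 times s, hence at most s / 2 by the second
    condition in [good]. Consequently [aa] decreases for s > 0 and the hypersurfaces of constant s
    are nested. *)
Lemma bb_gt0 k s : 0 < s -> 0 < bb h k e s.
Proof.
move=> s0; rewrite mulr_gt0 ?lam_gt0// subr_gt0.
have c0 := @cos1_gt0 R.
have H : e ^+ 2 * rho h e s * tau h k e s <= e ^+ 2 * 1 * (Khh h / cos 1 * s).
  have t := norm_tau k s; rewrite [`|s|]gtr0_norm// in t.
  apply: (@le_trans _ _ (e ^+ 2 * rho h e s * `|tau h k e s|)).
    by rewrite ler_wpM2l ?ler_norm// mulr_ge0 ?sqr_ge0// ltW// rho_gt0.
  apply: ler_pM => //; first by rewrite mulr_ge0 ?sqr_ge0// ltW// rho_gt0.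
    by rewrite ler_wpM2l ?sqr_ge0// rho_le1.
  apply: (le_trans t); rewrite ler_wpM2r ?(ltW s0)// ler_wpM2r ?invr_ge0 ?(ltW c0)//.
  exact: hk_le_Khh.
apply: (le_lt_trans H).
have E : e ^+ 2 * Khh h / cos 1 <= 1 / 2.
  by rewrite ler_pdivrMr//; have := ge.2; lra.
rewrite mulr1 !mulrA -[X in _ < X]mul1r ltr_pM2r//.
by rewrite (le_lt_trans E)// ltr_pdivrMr// mul1r ltr1n.
Qed.

Lemma vv_lt0 s : s < 0 -> vv h e s < 0.
Proof. by move=> s0; rewrite -(vv0 h e) vv_incr. Qed.

(** Both factors are odd in s and positive for s > 0. This keeps the Jacobian [chD] nonnegative for
    negative s as well, which occur over the cylinder. *)
Lemma vv_bb_ge0 k s : 0 <= vv h e s * bb h k e s.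
Proof.
have [s0|s0|->] := ltgtP s 0; last by rewrite vv0 mul0r.
- rewrite -mulrNN -!(vvN, bbN) // mulr_ge0// ltW// ?bb_gt0 ?vv_gt0 ?oppr_gt0//.
- by rewrite mulr_ge0// ltW// ?bb_gt0 ?vv_gt0.
Qed.

Lemma aa_decr k s1 s2 : 0 <= s1 -> s1 < s2 -> aa h k e s2 < aa h k e s1.
Proof.
move=> s10 s12; rewrite -ltrN2.
have D (x : R) : is_derive x 1 (fun x => - aa h k e x) (- (- 2 * aa h k e x * bb h k e x)).
  exact: isdN (is_derive_aa h_gt0 (ckk_neq0 k x)).
apply: (isd_lt s12 (fun x _ => D x)) => x /andP[s1x _].
have b0 := bb_gt0 k (le_lt_trans s10 s1x); have a0 := aa_gt0 k x.
by rewrite !mulNr opprK mulr_gt0// mulr_gt0.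
Qed.

Lemma aa_lt0 k s : s != 0 -> aa h k e s < (h k)^-1 ^+ 2.
Proof.
move=> s0; rewrite -(aa0 h k e); have [sn|sp|/eqP] := ltgtP s 0.
- by rewrite -[ltLHS](aaN h_gt0) aa_decr// oppr_gt0.
- by rewrite aa_decr.
- by rewrite (negbTE s0).
Qed.

Lemma aa_le0 k s : aa h k e s <= (h k)^-1 ^+ 2.
Proof.
by have [->|/aa_lt0 /ltW //] := eqVneq s 0; rewrite aa0.
Qed.

Lemma aa_le k s : 0 < s -> aa h k e s <= (cos 1 * s) ^- 2.
Proof.
move=> s0; have c0 := @cos1_gt0 R.
rewrite exprMn invfM mulrC /aa ler_pM// ?(ltW (lam_gt0 _ _ _))//.
- by rewrite invr_ge0 sqr_ge0.
- by rewrite lef_pV2 ?posrE ?exprn_gt0// ?lerDr ?sqr_ge0// addr_gt0// exprn_gt0.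
- by rewrite lef_pV2 ?posrE ?exprn_gt0// ?ckk_gt0// ler_pXn2r ?nnegrE ?ckk_ge// ltW// ckk_gt0.
Qed.

End Good.
End Profile3.

(** * Implicit functions and families of smooth functions *)

Section DiffEps.
Context {R : realType} {V : normedModType R}.
Implicit Types (f : V -> R) (x : V).

Lemma diff_eps f x : differentiable f x ->
  forall e : R, 0 < e ->
  \forall y \near x, `|f y - f x - 'd f x (y - x)| <= e * `|y - x|.
Proof.
move=> df; have /eqaddoP H := diff_locally df => e e0.
have := H _ e0; rewrite !near_simpl (near_shift x 0).
apply: filterS => y /=; rewrite sub0r /cst /=.
by rewrite [X in `|X|](_ : _ = f (y - x + x) - (f x + 'd f x (y - x)))// subrK opprD addrA.
Qed.

Lemma differentiable_eps f x (l : {linear V -> R}) : continuous l ->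
  (forall e : R, 0 < e ->
    \forall y \near x, `|f y - f x - l (y - x)| <= e * `|y - x|) ->
  differentiable f x /\ 'd f x = l :> (V -> R).
Proof.
move=> cl H.
have E : f \o shift x = cst (f x) + l +o_ 0 id.
  apply/eqaddoP => e e0; have := H e e0; rewrite (near_shift 0 x).
  apply: filterS => y /=; rewrite subr0 addrK.
  by rewrite [X in _ -> `|X| <= _](_ : _ = f (y + x) - (f x + l y))// opprD addrA.
have D := diff_unique cl E; split => //.
by apply/diff_locallyP; rewrite D.
Qed.

Lemma diff_is_derive f x v : differentiable f x -> is_derive x v f ('d f x v).
Proof.
by move=> df; apply: (DeriveDef (diff_derivable df)); rewrite deriveE.
Qed.

End DiffEps.

Section ImplicitFunction.
Context {R : realType} {V : normedModType R}.

Section PartialDiff.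
Variables (l : {linear (V * R)%type -> R}) (b : R).

Definition implicit_diff (v : V) : R := - l (v, 0) / b.

Lemma implicit_diff_is_linear : linear implicit_diff.
Proof.
move=> a u v; rewrite /implicit_diff.
rewrite (_ : (a *: u + v, 0) = a *: (u, 0) + (v, 0)); last first.
  by congr (_, _); rewrite /= scaler0 addr0.
by rewrite linearP /= opprD mulrDl -mulrN -mulrA.
Qed.

HB.instance Definition _ := GRing.isLinear.Build R V R *:%R implicit_diff
  implicit_diff_is_linear.

End PartialDiff.

Lemma implicit_diffP (l : {linear (V * R)%type -> R}) (v : V) (r : R) :
  l (v, r) = l (v, 0) + r * l (0, 1).
Proof.
rewrite (_ : (v, r) = (v, 0) + r *: (0, 1)) ?linearD ?linearZ//.
by congr (_, _); rewrite /= ?scaler0 ?addr0// add0r [RHS]mulr1.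
Qed.

(** Continuity of S is supplied by [implicit_cvg], so a bootstrap suffices. The differential of H
    gives |l(dx) + b dS| = o(|dx| + |dS|); a first use with the constant |b| / 2 yields |dS| <= K
    |dx|, after which the error is o(|dx|). *)
Lemma implicit_differentiable (H : V * R -> R) (S : V -> R) (x0 : V) (b : R) :
  differentiable H (x0, S x0) -> b = 'd H (x0, S x0) (0, 1) -> b != 0 ->
  {for x0, continuous S} ->
  (\forall x \near x0, H (x, S x) = H (x0, S x0)) ->
  differentiable S x0 /\
  forall v, is_derive x0 v S (- 'd H (x0, S x0) (v, 0) / b).
Proof.
move=> dH bE b0 cS HS.
set l := [the {linear (V * R)%type -> R} of 'd H (x0, S x0)] in bE *.
have cl : continuous l by exact: diff_continuous.
have [C C0 lC] := linear_lipschitz cl.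
have cL : continuous (implicit_diff l b).
  move=> v.
  have lv : l (u, 0) @[u --> v] --> l (v, 0).
    apply: (@continuous_cvg V (V * R)%type R (nbhs v) _ (fun v => (v, 0)) l (v, 0)).
      exact: cl.
    exact: cvg_pair (@cvg_id _ _) (@cvg_cst _ _ _ _ _).
  by apply: cvgM; [exact: cvgN lv|exact: cvg_cst].
have b'0 : 0 < `|b| by rewrite normr_gt0.
have lx v : `|l (v, 0)| <= C * `|v|.
  apply: le_trans (lC _) _; rewrite ler_wpM2l ?(ltW C0)//.
  by rewrite prod_normE /= normr0 ge_max lexx normr_ge0.
(* Solves |b| |dS| <= |b| / 2 (|dx| + |dS|) + C |dx| for |dS|. *)
pose K := 2 * C / `|b| + 1.
have K0 : 0 < K by rewrite ltr_pwDr// mulr_ge0 ?invr_ge0// mulr_ge0// ltW.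
have near_pair (P : V * R -> Prop) : (\forall z \near (x0, S x0), P z) ->
    \forall x \near x0, P (x, S x).
  by move=> HP; have : (x, S x) @[x --> x0] --> (x0, S x0);
    [exact: cvg_pair (@cvg_id _ _) cS|apply].
have key (e : R) : 0 < e -> \forall x \near x0,
    `|l (x - x0, 0) + (S x - S x0) * b| <= e * (`|x - x0| + `|S x - S x0|).
  move=> e0; have := near_pair _ (diff_eps dH e0).
  apply: filterS2 HS => x -> /=; rewrite subrr sub0r normrN => h1.
  rewrite bE -implicit_diffP; apply: (le_trans h1); rewrite ler_wpM2l ?(ltW e0)//.
  by rewrite prod_normE /= ge_max lerDl lerDr !normr_ge0.
have b20 : 0 < `|b| / 2 by rewrite divr_gt0.
have bound : \forall x \near x0, `|S x - S x0| <= K * `|x - x0|.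
  apply: filterS (key _ b20) => x.
  have := lx (x - x0); set dx := `|x - x0|; set L := l _; set D := S x - S x0.
  move=> hL hk.
  have h2 : `|D * b| <= `|L + D * b| + `|L|.
    by have := ler_normB (L + D * b) L; rewrite addrAC subrr add0r.
  rewrite normrM in h2.
  have h3 : `|D| * `|b| <= `|b| / 2 * (dx + `|D|) + C * dx.
    by apply: (le_trans h2); rewrite lerD.
  rewrite -(ler_pM2r b'0) /K.
  rewrite [X in _ <= X](_ : _ = 2 * C * dx + `|b| * dx); last by field; rewrite gt_eqF.
  by lra.
have H1 (e : R) : 0 < e -> \forall y \near x0,
    `|S y - S x0 - implicit_diff l b (y - x0)| <= e * `|y - x0|.
  move=> e0; have e1 : 0 < e * `|b| / (1 + K) by rewrite divr_gt0 ?mulr_gt0// addr_gt0.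
  apply: filterS2 bound (key _ e1) => x hb hk.
  have -> : S x - S x0 - implicit_diff l b (x - x0) =
      (l (x - x0, 0) + (S x - S x0) * b) / b.
    by rewrite /implicit_diff; field.
  rewrite normrM normfV ler_pdivrMr//; apply: (le_trans hk).
  have K1 : 0 < 1 + K by rewrite addr_gt0.
  rewrite [X in _ <= X](_ : _ = e * `|b| / (1 + K) * ((1 + K) * `|x - x0|)); last first.
    by field; rewrite gt_eqF.
  by rewrite ler_wpM2l ?(ltW e1)// mulrDl mul1r lerD2l.
have [dS E] := differentiable_eps cL H1.
by split => // v; have := diff_is_derive v dS; rewrite E.
Qed.

(** The root is trapped between s0 - r and s0 + r by the signs of H there. Since only these two
    points are tested, convergence of H t at each fixed s is enough. *)
Lemma implicit_cvg {T : Type} {F : set_system T} {FF : Filter F}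
    (H : T -> R -> R) (H0 : R -> R) (S : T -> R) (s0 : R) (I : set R) :
  nbhs s0 I ->
  (forall s, I s -> H t s @[t --> F] --> H0 s) ->
  (forall s, I s -> s < s0 -> H0 s < 0) ->
  (forall s, I s -> s0 < s -> 0 < H0 s) ->
  (\forall t \near F, forall s, I s -> (H t s < 0 -> s <= S t) /\
     (0 < H t s -> S t <= s)) ->
  S @ F --> s0.
Proof.
move=> /nbhs_ballP[d /= d0 dI] HH Hlt Hgt HS; apply/cvgrPdist_le => e e0.
(* Keeps both test points inside I and within e of s0. *)
pose r := Num.min (d / 2) e.
have r0 : 0 < r by rewrite lt_min e0 divr_gt0.
have rd : r < d by rewrite gt_min ltr_pdivrMr// ltr_pMr// ltr1n.
have I1 : I (s0 - r) by apply: dI; rewrite /ball /= opprB addrC subrK gtr0_norm.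
have I2 : I (s0 + r).
  by apply: dI; rewrite /ball /= opprD addrA subrr sub0r normrN gtr0_norm.
have n1 : \forall t \near F, H t (s0 - r) < 0.
  by apply: (cvgr_lt (H0 (s0 - r)) (HH _ I1)); apply: Hlt => //; rewrite ltrBlDr ltrDl.
have n2 : \forall t \near F, 0 < H t (s0 + r).
  by apply: (cvgr_gt (H0 (s0 + r)) (HH _ I2)); apply: Hgt => //; rewrite ltrDl.
apply: filterS3 n1 n2 HS => t h1 h2 hS.
have re : r <= e by rewrite ge_min lexx orbT.
have := (hS _ I1).1 h1; have := (hS _ I2).2 h2.
by rewrite ler_distl => a1 a2; apply/andP; split; lra.
Qed.

End ImplicitFunction.

(** * Families of smooth functions of x with a parameter *)

Section Families.
Context {R : realType} {n : nat}.
Local Notation V := 'rV[R]_n.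

Lemma near_eq_differentiable (f g : V -> R) (x : V) :
  (\near x, f x = g x) -> differentiable f x -> differentiable g x.
Proof.
move=> fg df.
have cl : continuous [the {linear V -> R} of 'd f x] by exact: diff_continuous.
have H (e : R) : 0 < e -> \forall y \near x,
    `|g y - g x - [the {linear V -> R} of 'd f x] (y - x)| <= e * `|y - x|.
  move=> e0; rewrite -(nbhs_singleton fg).
  by apply: filterS2 fg (diff_eps df e0) => y ->.
exact: (differentiable_eps cl H).1.
Qed.

Lemma is_derive_coord (x v : V) (j : 'I_n) :
  is_derive x v (fun y : V => y 0 j) (v 0 j).
Proof.
apply: DeriveDef; first exact: diff_derivable (differentiable_coord _ _ _).
have := @derive_mx R V 1 n id x v (@derivable_id _ _ x v).
by rewrite derive_id => /matrixP/(_ 0 j); rewrite mxE.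
Qed.

Variables (P : set R) (U : set V).
Hypothesis P0 : nbhs 0 P.
Hypothesis oU : open U.
Implicit Types (G : R -> V -> R) (k : nat).

Definition pcont G : Prop :=
  forall x, U x -> G z.1 z.2 @[z --> ((0 : R), x)] --> G 0 x.

(** Differentiability is in x alone, at each parameter in P, while dependence on the parameter is
    recorded only as continuity at e = 0: what convergence of all derivatives as e -> 0 consumes.
    The derivative family is existential, so that a closed formula can be supplied for it. *)
Fixpoint Ck k G : Prop :=
  pcont G /\
  if k is k'.+1 then
    (forall e x, P e -> U x -> differentiable (G e) x) /\
    forall i, exists2 G', Ck k' G' &
      forall e x, P e -> U x -> is_derive x (ebase i) (G e) (G' e x)
  else True.

Lemma Ck_pcont k G : Ck k G -> pcont G. Proof. by case: k => [|k] []. Qed.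

Lemma Ck_lower k G : Ck k.+1 G -> Ck k G.
Proof.
elim: k G => [|k IH] G /=; first by case.
move=> [cG [dG HG]]; split => //; split => // i.
by have [G' CG' DG'] := HG i; exists G' => //; exact: IH.
Qed.

Lemma nbhs_PU x : U x -> \forall z \near ((0 : R), x), P z.1 /\ U z.2.
Proof.
move=> Ux; exists (P, U); last by case=> a b [].
by split => //=; exact: open_nbhs_nbhs.
Qed.

Lemma pcont_ext G G' : (forall e x, P e -> U x -> G e x = G' e x) ->
  pcont G -> pcont G'.
Proof.
move=> GG' cG x Ux; rewrite -GG'//; last exact: nbhs_singleton P0.
apply: cvg_trans (cG x Ux); apply: near_eq_cvg.
by apply: filterS (nbhs_PU Ux) => z [Pz Uz]; rewrite GG'.
Qed.

Lemma near_U x (f g : V -> R) : U x -> (forall y, U y -> f y = g y) ->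
  \near x, f x = g x.
Proof.
by move=> Ux fg; apply: filterS (open_nbhs_nbhs (conj oU Ux)) => y; exact: fg.
Qed.

Lemma Ck_ext k G G' : (forall e x, P e -> U x -> G e x = G' e x) ->
  Ck k G -> Ck k G'.
Proof.
move=> GG'; case: k => [|k] /= [cG HG]; split => //; try exact: pcont_ext cG.
have [dG DG] := HG; split => [e x Pe Ux|i].
  by apply: near_eq_differentiable (dG e x Pe Ux); apply: near_U => // y; exact: GG'.
have [G1 CG1 DG1] := DG i; exists G1 => // e x Pe Ux.
by apply: near_eq_is_derive (DG1 e x Pe Ux); apply: near_U => // y; exact: GG'.
Qed.

Lemma Ck_c k (c : R) : Ck k (fun _ _ => c).
Proof.
elim: k c => [|k IH] c /=; split => //; try by move=> x _; exact: cvg_cst.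
split => [e x _ _|i]; first exact: differentiable_cst.
by exists (fun _ _ => 0) => // e x _ _; exact: isdC.
Qed.

Lemma Ck_e2 k : Ck k (fun e _ => e ^+ 2).
Proof.
have c : pcont (fun e _ => e ^+ 2).
  move=> x Ux; have H : z.1 @[z --> ((0 : R), x)] --> (0 : R) by exact: cvg_fst.
  exact: (cvgM H H).
case: k => [|k] /=; split => //; split => [e x _ _|i].
  exact: differentiable_cst.
by exists (fun _ _ => 0) => [|e x _ _]; [exact: Ck_c|exact: isdC].
Qed.

Lemma CkD k G1 G2 : Ck k G1 -> Ck k G2 -> Ck k (fun e x => G1 e x + G2 e x).
Proof.
elim: k G1 G2 => [|k IH] G1 G2 /= [c1 H1] [c2 H2].
  by split => // x Ux; apply: cvgD; [exact: c1|exact: c2].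
case: H1 => d1 H1; case: H2 => d2 H2.
split; first by move=> x Ux; apply: cvgD; [exact: c1|exact: c2].
split => [e x Pe Ux|i]; first exact: differentiableD (d1 _ _ Pe Ux) (d2 _ _ Pe Ux).
have [G1' C1 D1] := H1 i; have [G2' C2 D2] := H2 i.
exists (fun e x => G1' e x + G2' e x) => [|e x Pe Ux]; first exact: IH.
exact: isdD (D1 _ _ Pe Ux) (D2 _ _ Pe Ux).
Qed.

Lemma CkM k G1 G2 : Ck k G1 -> Ck k G2 -> Ck k (fun e x => G1 e x * G2 e x).
Proof.
elim: k G1 G2 => [|k IH] G1 G2 C1 C2.
  by split => // x Ux; apply: cvgM; [exact: C1.1|exact: C2.1].
have L1 := Ck_lower C1; have L2 := Ck_lower C2.
case: C1 => c1 [d1 H1]; case: C2 => c2 [d2 H2].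
split; first by move=> x Ux; apply: cvgM; [exact: c1|exact: c2].
split => [e x Pe Ux|i]; first exact: differentiableM (d1 _ _ Pe Ux) (d2 _ _ Pe Ux).
have [G1' C1 D1] := H1 i; have [G2' C2 D2] := H2 i.
exists (fun e x => G1' e x * G2 e x + G1 e x * G2' e x) => [|e x Pe Ux].
  by apply: CkD; exact: IH.
exact: isdM (D1 _ _ Pe Ux) (D2 _ _ Pe Ux).
Qed.

Lemma CkN k G1 : Ck k G1 -> Ck k (fun e x => - G1 e x).
Proof.
move=> C1; apply: (Ck_ext _ (CkM (Ck_c k (-1)) C1)) => e x _ _.
by rewrite mulN1r.
Qed.

Lemma CkB k G1 G2 : Ck k G1 -> Ck k G2 -> Ck k (fun e x => G1 e x - G2 e x).
Proof. by move=> C1 C2; apply: CkD => //; exact: CkN. Qed.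

Lemma CkX k G1 j : Ck k G1 -> Ck k (fun e x => G1 e x ^+ j).
Proof.
move=> C1; elim: j => [|j IH]; first exact: (Ck_c k 1).
by apply: (Ck_ext _ (CkM C1 IH)) => e x _ _; rewrite exprS.
Qed.

Lemma Ck_sum k (I : Type) (r : seq I) (G : I -> R -> V -> R) :
  (forall i, Ck k (G i)) -> Ck k (fun e x => \sum_(i <- r) G i e x).
Proof.
move=> CG; elim: r => [|i r IH].
  by apply: (Ck_ext _ (Ck_c k 0)) => e x _ _; rewrite big_nil.
by apply: (Ck_ext _ (CkD (CG i) IH)) => e x _ _; rewrite big_cons.
Qed.

Lemma Ck_horner k (p : {poly R}) G : Ck k G -> Ck k (fun e x => p.[G e x]).
Proof.
move=> CG; elim/poly_ind: p => [|p c IH].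
  by apply: (Ck_ext _ (Ck_c k 0)) => e x _ _; rewrite horner0.
apply: (Ck_ext _ (CkD (CkM IH CG) (Ck_c k c))) => e x _ _.
by rewrite hornerMXaddC.
Qed.

Lemma CkV k G : (forall e x, P e -> U x -> G e x != 0) -> Ck k G ->
  Ck k (fun e x => (G e x)^-1).
Proof.
move=> G0; have c : pcont G -> pcont (fun e x => (G e x)^-1).
  by move=> c x Ux; apply: cvgV (c x Ux); apply: G0 => //; exact: nbhs_singleton P0.
elim: k => [|k IH] CG; first by split => //; exact: c CG.1.
have VG := IH (Ck_lower CG); case: CG => cG [dG HG].
split; first exact: c.
split => [e x Pe Ux|i].
  by apply: (differentiableV (dG _ _ Pe Ux)); exact: G0.
have [G' C1 D1] := HG i.
exists (fun e x => - G' e x * ((G e x)^-1 * (G e x)^-1)) => [|e x Pe Ux].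
  by apply: CkM; [exact: CkN|exact: CkM].
apply: (isd_eq (isdV (D1 _ _ Pe Ux) (G0 _ _ Pe Ux))).
by rewrite expr2 invfM.
Qed.

Lemma Ck_coord k (j : 'I_n) : Ck k (fun _ x => x 0 j).
Proof.
have c : pcont (fun _ x => x 0 j).
  move=> x Ux; apply: (@continuous_cvg _ _ _ _ _ (fun z : R * V => z.2)
    (fun y : V => y 0 j) x); first exact: coord_continuous.
  exact: cvg_snd.
case: k => [|k]; split => //; split => [e x _ _|i].
  exact: differentiable_coord.
exists (fun _ _ => (ebase i : V) 0 j) => [|e x _ _]; first exact: Ck_c.
exact: is_derive_coord.
Qed.

Lemma Ck_iter k G (s : seq 'I_n) : Ck k G -> (size s <= k)%N ->
  exists2 G', Ck (k - size s) G' &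
    forall e x, P e -> U x -> iter_partial s (G e) x = G' e x.
Proof.
move=> CG; elim: s => [|i s IH] /= sk.
  by rewrite subn0; exists G.
have [G' CG' E] := IH (ltnW sk); move: CG'.
rewrite -(subnSK sk) => -[_ [_ /(_ i)[G'' CG'' DG'']]].
exists G'' => // e x Pe Ux; case: (DG'' e x Pe Ux) => _ <-.
by apply: near_eq_derive; apply: near_U => // y; exact: E.
Qed.

Lemma Ck_smooth G e : (forall k, Ck k G) -> P e -> smooth_on U (G e).
Proof.
(* One order more than the length of [s], because the iterated partial derivative must itself be
   differentiable. *)
move=> CG Pe s x Ux; have [G' + E] := Ck_iter (CG (size s).+1) (leqnSn (size s)).
rewrite subSnn => -[_ [dG' _]]; apply: near_eq_differentiable (dG' e x Pe Ux).
by apply: near_U => // y Uy; rewrite E.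
Qed.

Lemma Ck_iter_pcont G (s : seq 'I_n) : (forall k, Ck k G) ->
  pcont (fun e => iter_partial s (G e)).
Proof.
move=> CG; have [G' CG' E] := Ck_iter (CG (size s)) (leqnn (size s)).
by apply: pcont_ext (Ck_pcont CG') => e x Pe Ux; rewrite E.
Qed.

End Families.

(** * The potential of a neck in a chart *)

Arguments Ck : simpl never.

Section Chart.
Context {R : realType} {m : nat}.
Variable h : 'I_m -> R.
Hypothesis h_gt0 : forall k, 0 < h k.
Local Notation V := 'rV[R]_m.+1.
Implicit Types (e s : R) (x y v : V) (j : 'I_m).

Definition xj x j : R := x 0 (lift ord_max j).
Definition xn x : R := x 0 ord_max.

Definition chB e x s : R := \sum_j xj x j ^+ 2 * aa h j e s * bb h j e s.
(** The Jacobian determinant, up to a factor 2, of the system v(s) w = x_n, chA + w^2 = 1 in the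
    unknowns (s, w); - 2 chB is the derivative of chA in s. *)
Definition chD e x s w : R := CC h e s * kap h e s * w ^+ 2 + vv h e s * chB e x s.
Definition chL e x s v : R := \sum_j aa h j e s * xj x j * xj v j.
Definition chA e x s : R := \sum_j xj x j ^+ 2 * aa h j e s.

(* When [w = x_n / vv], the derivative in [s] is [rho / 2 * (chA + w ^ 2 - 1)]:
   it vanishes on the chart, so that only [x] contributes to the gradient. *)
Definition Phi e x s w : R :=
  1 / 2 * (- JJ h e s + \sum_j tau h j e s * xj x j ^+ 2
           - uu h e s * vv h e s * w ^+ 2).

Variables (P : set R) (U : set V).
Hypothesis P0 : nbhs 0 P.
Hypothesis oU : open U.
Hypothesis Pgood : forall e, P e -> good h e.

(** A branch (S, W) of solutions of that system, with the derivatives given by Cramer's rule. The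
    outer chart and the cylinder find their solutions differently but obey these same formulas, so
    regularity, gradient and harmonicity are proved once for both. *)
Record chart (S W : R -> V -> R) : Prop := Chart {
  chart_S0 : pcont U S;
  chart_W0 : pcont U W;
  chart_D : forall e x, P e -> U x -> chD e x (S e x) (W e x) != 0;
  chart_xn : forall e x, P e -> U x -> vv h e (S e x) * W e x = xn x;
  chart_eq : forall e x, P e -> U x -> chA e x (S e x) + W e x ^+ 2 = 1;
  chart_dS : forall e x, P e -> U x -> differentiable (S e) x;
  chart_dW : forall e x, P e -> U x -> differentiable (W e) x;
  chart_DS : forall e x v, P e -> U x -> is_derive x v (S e)
    ((vv h e (S e x) * chL e x (S e x) v + W e x * xn v)
     / chD e x (S e x) (W e x));
  chart_DW : forall e x v, P e -> U x -> is_derive x v (W e)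
    ((chB e x (S e x) * xn v
      - CC h e (S e x) * kap h e (S e x) * W e x * chL e x (S e x) v)
     / chD e x (S e x) (W e x)) }.

Variables S W : R -> V -> R.
Hypothesis ch : chart S W.

(* The partial derivatives of these functions along a chart are polynomials in
   them: this closes the induction on the order of differentiability. *)
Inductive gen :=
  | gX of 'I_m.+1 | gS | gW | gJ | gTau of 'I_m | gA of 'I_m | gLam of 'I_m
  | gRho | gEta | gU | gV | gSS | gCC | gD.

Definition gen_sem (g : gen) e x : R :=
  match g with
  | gX i => x 0 i
  | gS => S e x
  | gW => W e x
  | gJ => JJ h e (S e x)
  | gTau j => tau h j e (S e x)
  | gA j => aa h j e (S e x)
  | gLam j => lam h j (S e x)
  | gRho => rho h e (S e x)
  | gEta => etaq h (S e x)
  | gU => uu h e (S e x)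
  | gV => vv h e (S e x)
  | gSS => SS h e (S e x)
  | gCC => CC h e (S e x)
  | gD => (chD e x (S e x) (W e x))^-1
  end.

Lemma pcont_comp (g : R -> R -> R) : jcvg g -> pcont U (fun e x => g e (S e x)).
Proof.
move=> jg x Ux; apply: (jg _ _ _ (fun z : R * V => z.1) (fun z : R * V => S z.1 z.2)).
  exact: cvg_fst.
exact: (chart_S0 ch).
Qed.

Local Notation CK := (Ck P U).

Ltac ck := repeat first
  [ done
  | lazymatch goal with
    | |- Ck _ _ _ (fun e x => @?f e x + @?g e x) => apply: (@CkD _ _ _ _ _ f g)
    | |- Ck _ _ _ (fun e x => @?f e x * @?g e x) => apply: (@CkM _ _ _ _ _ f g)
    | |- Ck _ _ _ (fun e x => - @?f e x) => apply: (@CkN _ _ _ _ P0 oU _ f)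
    | |- Ck _ _ _ (fun e x => e ^+ 2) => exact: Ck_e2
    | |- Ck _ _ _ (fun e x => @?f e x ^+ ?i) => apply: (@CkX _ _ _ _ P0 oU _ f i)
    end
  | exact: Ck_c ].

Lemma Ck_comp k (g g' : R -> R -> R) : jcvg g ->
  (forall e x, P e -> U x -> is_derive (S e x) 1 (g e) (g' e (S e x))) ->
  CK k.+1 S -> CK k (fun e x => g' e (S e x)) ->
  CK k.+1 (fun e x => g e (S e x)).
Proof.
move=> jg Dg [_ [_ HS]] Cg'; split; first exact: pcont_comp.
split => [e x Pe Ux|i].
  apply: (@differentiable_comp _ _ _ _ (S e) (g e)); first exact: (chart_dS ch).
  by apply/derivable1_diffP; case: (Dg e x Pe Ux).
have [S' CS' DS'] := HS i.
exists (fun e x => S' e x * g' e (S e x)) => [|e x Pe Ux]; first exact: CkM.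
exact: isd_comp (chart_dS ch Pe Ux) (DS' e x Pe Ux) (Dg e x Pe Ux).
Qed.

Section Closure.
Variable k : nat.
Hypothesis IH : forall g, g <> gD -> CK k (gen_sem g).
Hypothesis CD : CK k (fun e x => (chD e x (S e x) (W e x))^-1).

Let CX i : CK k (fun _ x => x 0 i) .
Proof. exact: (IH (g := (gX i))). Qed.
Let Cxj j : CK k (fun _ x => xj x j) .
Proof. exact: (IH (g := (gX (lift ord_max j)))). Qed.
Let CS : CK k S .
Proof. exact: (IH (g := gS)). Qed.
Let CS' : CK k (fun e x => S e x) .
Proof. exact: (IH (g := gS)). Qed.
Let CW : CK k W .
Proof. exact: (IH (g := gW)). Qed.
Let CW' : CK k (fun e x => W e x) .
Proof. exact: (IH (g := gW)). Qed.
Let CJ : CK k (fun e x => JJ h e (S e x)) .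
Proof. exact: (IH (g := gJ)). Qed.
Let CTau j : CK k (fun e x => tau h j e (S e x)) .
Proof. exact: (IH (g := (gTau j))). Qed.
Let CA j : CK k (fun e x => aa h j e (S e x)) .
Proof. exact: (IH (g := (gA j))). Qed.
Let CLam j : CK k (fun e x => lam h j (S e x)) .
Proof. exact: (IH (g := (gLam j))). Qed.
Let CRho : CK k (fun e x => rho h e (S e x)) .
Proof. exact: (IH (g := gRho)). Qed.
Let CEta : CK k (fun e x => etaq h (S e x)) .
Proof. exact: (IH (g := gEta)). Qed.
Let CU : CK k (fun e x => uu h e (S e x)) .
Proof. exact: (IH (g := gU)). Qed.
Let CV : CK k (fun e x => vv h e (S e x)) .
Proof. exact: (IH (g := gV)). Qed.
Let CSS : CK k (fun e x => SS h e (S e x)) .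
Proof. exact: (IH (g := gSS)). Qed.
Let CCC : CK k (fun e x => CC h e (S e x)) .
Proof. exact: (IH (g := gCC)). Qed.

Lemma Ck_bbS j : CK k (fun e x => bb h j e (S e x)).
Proof. by rewrite /bb; ck. Qed.

Lemma Ck_polyS (p : {poly R}) : CK k (fun e x => p.[S e x]).
Proof. exact: Ck_horner. Qed.

Lemma Ck_qqS : CK k (fun e x => qq h (S e x)).
Proof.
apply: (Ck_ext _ _ (G := fun e x => 1 + S e x ^+ 2 * (pp h).[S e x])) => //.
  by move=> e x _ _; rewrite qqE.
by have := Ck_polyS (pp h) => ?; ck.
Qed.

Lemma Ck_kapS : CK k (fun e x => kap h e (S e x)).
Proof. by have := Ck_qqS; rewrite /kap => ?; ck. Qed.

Lemma Ck_LamS : CK k (fun e x => Lam h (S e x)).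
Proof. by apply: Ck_sum. Qed.

Lemma Ck_chB : CK k (fun e x => chB e x (S e x)).
Proof. by apply: Ck_sum => // j; have := Ck_bbS j => ?; ck. Qed.

Lemma Ck_chD : CK k (fun e x => chD e x (S e x) (W e x)).
Proof. by have := Ck_chB; have := Ck_kapS; rewrite /chD => ? ?; ck. Qed.

Lemma Ck_chL v : CK k (fun e x => chL e x (S e x) v).
Proof. by apply: Ck_sum => // j; ck. Qed.

Lemma Ck_S1 : CK k.+1 S.
Proof.
split; first exact: (chart_S0 ch).
split => [|i]; first exact: (chart_dS ch).
exists (fun e x => (vv h e (S e x) * chL e x (S e x) (ebase i)
   + W e x * xn (ebase i)) / chD e x (S e x) (W e x)) => [|e x Pe Ux]; last first.
  exact: (chart_DS ch).
by have := Ck_chL (ebase i) => ?; ck.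
Qed.

Lemma Ck_W1 : CK k.+1 W.
Proof.
split; first exact: (chart_W0 ch).
split => [|i]; first exact: (chart_dW ch).
exists (fun e x => (chB e x (S e x) * xn (ebase i)
      - CC h e (S e x) * kap h e (S e x) * W e x * chL e x (S e x) (ebase i))
     / chD e x (S e x) (W e x)) => [|e x Pe Ux]; last first.
  exact: (chart_DW ch).
by have := Ck_chL (ebase i); have := Ck_chB; have := Ck_kapS => ? ? ?; ck.
Qed.

Lemma Ck_gen1 g : g <> gD -> CK k.+1 (gen_sem g).
Proof.
have CS1 := Ck_S1; have Cqq := Ck_qqS; have CL := Ck_LamS; have Ck := Ck_kapS.
have Cp := Ck_polyS.
case: g => [i| | | |j|j|j| | | | | | |] // _ /=.
- exact: Ck_coord.
- exact: Ck_W1.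
- apply: (@Ck_comp _ _ (rho h) (jcvg_JJ h_gt0) _ CS1) => // e x Pe Ux.
  exact: is_derive_JJ.
- apply: (@Ck_comp _ _ (fun e s => rho h e s * aa h j e s) (@jcvg_tau _ _ _ h_gt0 j) _ CS1).
    by move=> e x Pe Ux; apply: is_derive_tau => //; exact: (ckk_neq0 h_gt0 (Pgood Pe)).
  by ck.
- apply: (@Ck_comp _ _ (fun e s => - 2 * aa h j e s * bb h j e s) (@jcvg_aa _ _ _ h_gt0 j) _ CS1).
    by move=> e x Pe Ux; apply: is_derive_aa => //; exact: (ckk_neq0 h_gt0 (Pgood Pe)).
  by have := Ck_bbS j => ?; ck.
- apply: (@Ck_comp _ _ (fun e s => - (2 * s * lam h j s ^+ 2)) (@jcvg_lam _ _ _ h_gt0 j) _ CS1).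
    by move=> e x Pe Ux; exact: is_derive_lam.
  by ck.
- apply: (@Ck_comp _ _ (fun e s => - (2 * s * qq h s * Lam h s + e ^+ 2 * (pp h)^`().[s]) / 2
     * rho h e s ^+ 3) (jcvg_rho h_gt0) _ CS1).
    by move=> e x Pe Ux; exact: is_derive_rho.
  by ck.
- apply: (@Ck_comp _ _ (fun e s => - s * Lam h s * etaq h s) (jcvg_eta h_gt0) _ CS1).
    by move=> e x Pe Ux; exact: is_derive_eta.
  by ck.
- apply: (@Ck_comp _ _ (fun e s => SS h e s * kap h e s) (jcvg_uu h_gt0) _ CS1).
    by move=> e x Pe Ux; exact: is_derive_uu.
  by ck.
- apply: (@Ck_comp _ _ (fun e s => CC h e s * kap h e s) (jcvg_vv h_gt0) _ CS1).
    by move=> e x Pe Ux; exact: is_derive_vv.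
  by ck.
- apply: (@Ck_comp _ _ (fun e s => CC h e s * rho h e s * Lam h s) (jcvg_SS h_gt0) _ CS1).
    by move=> e x Pe Ux; exact: is_derive_SS.
  by ck.
- apply: (@Ck_comp _ _ (fun e s => - e ^+ 2 * SS h e s * rho h e s * Lam h s) (jcvg_CC h_gt0) _ CS1).
    by move=> e x Pe Ux; exact: is_derive_CC.
  by ck.
Qed.

End Closure.
(** The generator [gD] is the only one that is not a coordinate, S, W or a function of (e, S). It is
    recovered at each order from the others, as the inverse of a polynomial in them. *)
Lemma Ck_chDV k : (forall g, g <> gD -> CK k (gen_sem g)) ->
  CK k (fun e x => (chD e x (S e x) (W e x))^-1).
Proof. by move=> IH; apply: CkV (Ck_chD IH) => //; exact: (chart_D ch). Qed.

Lemma pcont_gen g : g <> gD -> pcont U (gen_sem g).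
Proof.
case: g => [i| | | |j|j|j| | | | | | |] //= _.
- exact: (Ck_pcont (@Ck_coord _ _ P U 0 i)).
- exact: (chart_S0 ch).
- exact: (chart_W0 ch).
- exact: pcont_comp (jcvg_JJ h_gt0).
- exact: pcont_comp (@jcvg_tau _ _ _ h_gt0 j).
- exact: pcont_comp (@jcvg_aa _ _ _ h_gt0 j).
- exact: pcont_comp (@jcvg_lam _ _ _ h_gt0 j).
- exact: pcont_comp (jcvg_rho h_gt0).
- exact: pcont_comp (jcvg_eta h_gt0).
- exact: pcont_comp (jcvg_uu h_gt0).
- exact: pcont_comp (jcvg_vv h_gt0).
- exact: pcont_comp (jcvg_SS h_gt0).
- exact: pcont_comp (jcvg_CC h_gt0).
Qed.

Lemma Ck_gen k g : g <> gD -> CK k (gen_sem g).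
Proof.
elim: k g => [|k IH] g ng; first by split => //; exact: pcont_gen.
exact: Ck_gen1 (Ck_chDV IH) _ ng.
Qed.

Lemma Ck_Phi k : CK k (fun e x => Phi e x (S e x) (W e x)).
Proof.
have IH := @Ck_gen k; rewrite /Phi; apply: CkM; first exact: Ck_c.
apply: CkB => //.
  apply: CkD; first by apply: CkN => //; exact: (IH gJ).
  apply: Ck_sum => // j; apply: CkM; first exact: (IH (gTau j)).
  by apply: CkX => //; exact: (IH (gX (lift ord_max j))).
apply: CkM; last by apply: CkX => //; exact: (IH gW).
by apply: CkM; [exact: (IH gU)|exact: (IH gV)].
Qed.

Lemma is_derive_Phi e x v : P e -> U x ->
  is_derive x v (fun x => Phi e x (S e x) (W e x))
    (\sum_j tau h j e (S e x) * xj x j * xj v j - uu h e (S e x) * W e x * xn v).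
Proof.
move=> Pe Ux; have ge := Pgood Pe.
set s := S e x; set w := W e x.
have Ds := chart_DS ch v Pe Ux; have Dw := chart_DW ch v Pe Ux.
have D0 := chart_D ch Pe Ux; have dS := chart_dS ch Pe Ux.
set ds := (X in is_derive x v (S e) X) in Ds.
set dw := (X in is_derive x v (W e) X) in Dw.
have Dc (g : R -> R) (d : R) : is_derive s 1 g d ->
  is_derive x v (fun x => g (S e x)) (ds * d) by exact: isd_comp.
have Dj j : is_derive x v (fun y => xj y j) (xj v j) by exact: is_derive_coord.
have DT : is_derive x v (fun y => \sum_j tau h j e (S e y) * xj y j ^+ 2)
   (\sum_j (ds * (rho h e s * aa h j e s) * xj x j ^+ 2
      + tau h j e s * (2 * xj x j * xj v j))).
  apply: (@isdS R V m (fun j y => tau h j e (S e y) * xj y j ^+ 2)) => j.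
  apply: isdM; first exact: (Dc _ _ (is_derive_tau h_gt0 (ckk_neq0 h_gt0 ge j s))).
  by apply: (isd_eq (isdX 2 (Dj j))); rewrite expr1.
apply: (isd_eq (isdZ (1 / 2) (isdB (isdD (isdN (Dc _ _ (is_derive_JJ h_gt0 e s))) DT)
  (isdM (isdM (Dc _ _ (is_derive_uu h_gt0 e s)) (Dc _ _ (is_derive_vv h_gt0 e s)))
    (isdX 2 Dw))))).
(* [E1] differentiates v w = x_n and [E2] follows from CC uu - SS vv = etaq. Together with the
   constraint [E3] they cancel every term in ds and dw. *)
have E1 : vv h e s * dw + CC h e s * kap h e s * w * ds = xn v.
  rewrite /dw /ds -/s -/w; move: D0; rewrite -/s -/w /chD.
  set B := chB _ _ _; set L := chL _ _ _ _ => D0.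
  by field.
have E2 : kap h e s * (CC h e s * uu h e s - SS h e s * vv h e s) = rho h e s.
  rewrite /kap /uu /vv /CC /SS.
  transitivity ((etaq h s ^+ 2 * qq h s) * rho h e s *
    (cs e (IS h e s) ^+ 2 + e ^+ 2 * sn e (IS h e s) ^+ 2)); first by ring.
  by rewrite eta2 cs2sn2 mul1r mulr1.
have E3 : chA e x s + w ^+ 2 = 1 := chart_eq ch Pe Ux.
have -> : \sum_j (ds * (rho h e s * aa h j e s) * xj x j ^+ 2
      + tau h j e s * (2 * xj x j * xj v j)) =
    ds * rho h e s * chA e x s + 2 * \sum_j tau h j e s * xj x j * xj v j.
  rewrite big_split /= /chA !mulr_sumr; congr (_ + _); apply: eq_bigr => j _; ring.
rewrite -/s -/w expr1; set T := \sum_j _.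
apply/eqP; rewrite -subr_eq0; apply/eqP.
transitivity (- (uu h e s * w) * (vv h e s * dw + CC h e s * kap h e s * w * ds - xn v)
  + ds * w ^+ 2 / 2 * (kap h e s * (CC h e s * uu h e s - SS h e s * vv h e s) - rho h e s)
  + ds * rho h e s / 2 * (chA e x s + w ^+ 2 - 1)); first by field.
by rewrite E1 E2 E3 !subrr !mulr0 !addr0.
Qed.

End Chart.

Section DirectionalProduct.
Context {R : realType} {n : nat}.
Local Notation V := 'rV[R]_n.
Implicit Types (z : V * R) (v : V) (r : R) (i : 'I_n).

Lemma differentiable_fst z : differentiable (fst : V * R -> V) z.
Proof. by apply: linear_differentiable => x; exact: cvg_fst. Qed.

Lemma differentiable_snd z : differentiable (snd : V * R -> R) z.
Proof. by apply: linear_differentiable => x; exact: cvg_snd. Qed.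

Lemma differentiable_fst_coord z i : differentiable (fun z : V * R => z.1 0 i) z.
Proof.
apply: (@differentiable_comp _ _ _ _ (fst : V * R -> V) (fun y : V => y 0 i)).
  exact: differentiable_fst.
exact: differentiable_coord.
Qed.

Lemma is_derive_snd z v r : is_derive z (v, r) (fun z : V * R => z.2) r.
Proof.
have D := diff_is_derive (v, r) (differentiable_snd z).
apply: (isd_eq D).
have cs : continuous (snd : V * R -> R) by move=> x; exact: cvg_snd.
by rewrite (diff_lin _ cs).
Qed.

Lemma is_derive_fst_coord z v r i :
  is_derive z (v, r) (fun z : V * R => z.1 0 i) (v 0 i).
Proof.
have D := diff_is_derive (v, r) (differentiable_fst_coord z i).
apply: (isd_eq D).
have cs : continuous (fst : V * R -> V) by move=> x; exact: cvg_fst.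
rewrite (@diff_comp _ _ _ _ (fst : V * R -> V) (fun y : V => y 0 i)) /=.
- rewrite (diff_lin _ cs) /= -deriveE; last exact: differentiable_coord.
  by case: (is_derive_coord z.1 v i).
- exact: differentiable_fst.
- exact: differentiable_coord.
Qed.

End DirectionalProduct.

Section EllipsoidalCoordinates.
Context {R : realType} {m : nat}.
Variable h : 'I_m -> R.
Hypothesis h_gt0 : forall k, 0 < h k.
Local Notation V := 'rV[R]_m.+1.
Implicit Types (e s r : R) (x y v : V) (j : 'I_m) (z : V * R).

Lemma differentiable_sumr n (f : 'I_n -> V * R -> R) z :
  (forall i, differentiable (f i) z) -> differentiable (fun z => \sum_i f i z) z.
Proof.
move=> df; rewrite (_ : (fun z => _) = \sum_i f i); first exact: differentiable_sum.
by apply/funext => t; rewrite fct_sumE.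
Qed.

Lemma differentiable_comp_snd (g : R -> R) z d : is_derive z.2 1 g d ->
  differentiable (fun z : V * R => g z.2) z.
Proof.
move=> gd; apply: (@differentiable_comp _ _ _ _ (snd : V * R -> R) g).
  exact: differentiable_snd.
by apply/derivable1_diffP; case: gd.
Qed.

Lemma is_derive_comp_snd (g : R -> R) z v r d : is_derive z.2 1 g d ->
  is_derive z (v, r) (fun z : V * R => g z.2) (r * d).
Proof. exact: isd_comp (differentiable_snd z) (is_derive_snd z v r). Qed.

Section FixedParameter.
Variable e : R.
Hypothesis ge : good h e.
Let c0 j s : ckk h j e s != 0. Proof. exact: ckk_neq0. Qed.

Lemma differentiable_chA z : differentiable (fun z => chA h e z.1 z.2) z.
Proof.
apply: differentiable_sumr => j; apply: differentiableM.
  have D := differentiable_fst_coord z (lift ord_max j).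
  exact: (differentiableM D D).
exact: differentiable_comp_snd (is_derive_aa h_gt0 (c0 j _)).
Qed.

Lemma is_derive_chA z v r : is_derive z (v, r) (fun z => chA h e z.1 z.2)
  (2 * chL h e z.1 z.2 v - 2 * r * chB h e z.1 z.2).
Proof.
have D := @isdS R (V * R)%type m
  (fun j z => xj z.1 j ^+ 2 * aa h j e z.2) z (v, r) _ (fun j =>
  isdM (isdX 2 (is_derive_fst_coord z v r (lift ord_max j)))
    (is_derive_comp_snd v r (is_derive_aa h_gt0 (c0 j z.2)))).
apply: (isd_eq D).
rewrite /chL /chB !mulr_sumr -sumrB; apply: eq_bigr => j _.
by rewrite -/(xj z.1 j) -/(xj v j) /=; ring.
Qed.

Lemma is_derive_chA_s x s : is_derive s 1 (chA h e x) (- 2 * chB h e x s).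
Proof.
have D := @isdS R R^o m (fun j s => xj x j ^+ 2 * aa h j e s) s 1 _ (fun j =>
  isdZ _ (is_derive_aa h_gt0 (c0 j s))).
apply: (isd_eq D).
by rewrite /chB mulr_sumr; apply: eq_bigr => j _; ring.
Qed.

Lemma chA_ge0 x s : 0 <= chA h e x s.
Proof. by apply: sumr_ge0 => j _; rewrite mulr_ge0 ?sqr_ge0 ?ltW ?aa_gt0. Qed.

Lemma chA0 x : chA h e x 0 = equatorial h x.
Proof. by apply: eq_bigr => j _; rewrite aa0 exprVn. Qed.

Lemma chA_le_equatorial x s : chA h e x s <= equatorial h x.
Proof.
apply: ler_sum => j _; rewrite ler_wpM2l ?sqr_ge0//.
by rewrite -exprVn aa_le0.
Qed.

Lemma chA_decr x s1 s2 : 0 <= s1 -> s1 <= s2 -> chA h e x s2 <= chA h e x s1.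
Proof.
move=> s10; rewrite le_eqVlt => /predU1P[->//|s12].
by apply: ler_sum => j _; rewrite ler_wpM2l ?sqr_ge0// ltW// aa_decr.
Qed.

Lemma chA_neq0 x s : chA h e x s != 0 -> exists j, xj x j != 0.
Proof.
move=> A0; apply/existsP; apply: contraNT A0 => /existsPn H.
apply/eqP; apply: big1 => j _; have := H j; rewrite negbK => /eqP ->.
by rewrite expr0n mul0r.
Qed.

Lemma chA_sdecr x s1 s2 : (exists j, xj x j != 0) -> 0 <= s1 -> s1 < s2 ->
  chA h e x s2 < chA h e x s1.
Proof.
move=> [j xj0] s10 s12; rewrite /chA (bigD1 j)//= [X in _ < X](bigD1 j)//=.
apply: ltr_leD; last first.
  by apply: ler_sum => i _; rewrite ler_wpM2l ?sqr_ge0// ltW// aa_decr.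
by rewrite ltr_pM2l ?aa_decr// lt_neqAle sqr_ge0 eq_sym sqrf_eq0 xj0.
Qed.

Lemma chB_gt0 x s : (exists j, xj x j != 0) -> 0 < s -> 0 < chB h e x s.
Proof.
move=> [j xj0] s0; rewrite /chB (bigD1 j)//=; apply: ltr_pwDl.
  rewrite mulr_gt0 ?bb_gt0// mulr_gt0 ?aa_gt0//.
  by rewrite lt_neqAle sqr_ge0 eq_sym sqrf_eq0 xj0.
apply: sumr_ge0 => i _; have /ltW a0 := aa_gt0 h_gt0 ge i s.
have /ltW b0 := bb_gt0 h_gt0 ge i s0.
by apply: mulr_ge0 => //; apply: mulr_ge0 => //; exact: sqr_ge0.
Qed.

Lemma vv_chB_ge0 x s : 0 <= vv h e s * chB h e x s.
Proof.
rewrite /chB mulr_sumr; apply: sumr_ge0 => j _.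
have /ltW a0 := aa_gt0 h_gt0 ge j s; have b0 := vv_bb_ge0 h_gt0 ge j s.
by rewrite mulrCA; apply: mulr_ge0 => //; apply: mulr_ge0 => //; exact: sqr_ge0.
Qed.

Lemma vv_cont s : {for s, continuous (vv h e)}.
Proof. exact: isd_cont (is_derive_vv h_gt0 e s). Qed.

Lemma chA_cont x s : {for s, continuous (chA h e x)}.
Proof. exact: isd_cont (is_derive_chA_s x s). Qed.

End FixedParameter.
End EllipsoidalCoordinates.

(** * Construction of the two charts *)

Lemma ltr_div_sqr (R : realFieldType) (a b c : R) : 0 < a -> a < b -> 0 < c ->
  c / b ^+ 2 < c / a ^+ 2.
Proof.
move=> a0 ab c0; have b0 := lt_trans a0 ab.
rewrite (ltr_pM2l c0) ltf_pV2 ?posrE ?exprn_gt0//.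
by rewrite ltr_pXn2r ?nnegrE ?(ltW a0) ?(ltW b0).
Qed.

Section OuterChart.
Context {R : realType} {m : nat}.
Variable h : 'I_m -> R.
Hypothesis h_gt0 : forall k, 0 < h k.
Local Notation V := 'rV[R]_m.+1.
Implicit Types (e s r : R) (x y v : V) (j : 'I_m) (z : V * R).

Section FixedParameter.
Variable e : R.
Hypothesis ge : good h e.

(* The confocal family: [Hout e x s = 1] is the ellipsoid of parameter [s]. *)
Definition Hout x s : R := chA h e x s + xn x ^+ 2 / vv h e s ^+ 2.

Lemma outer_xj x : outer_chart h x -> xn x = 0 -> exists j, xj x j != 0.
Proof.
move=> ox xn0; apply: (@chA_neq0 _ _ h e x 0); rewrite chA0; apply/eqP => E.
by apply: ox; split => //; rewrite E.
Qed.

(** Both summands decrease in s. The last one does so strictly if x_n != 0; otherwise x is off the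
    disc, some x_j is nonzero and the sum of the others is strict. *)
Lemma Hout_decr x s1 s2 : outer_chart h x -> 0 < s1 -> s1 < s2 ->
  Hout x s2 < Hout x s1.
Proof.
move=> /outer_xj oxj s10 s12; have v1 := vv_gt0 h_gt0 ge s10.
have v12 := vv_incr h_gt0 ge s12.
have [xn0|xn0] := eqVneq (xn x) 0.
  rewrite /Hout xn0 expr0n mul0r mul0r addr0 addr0.
  exact: (chA_sdecr h_gt0 ge (oxj xn0) (ltW s10) s12).
apply: ler_ltD; first exact: (chA_decr h_gt0 ge x (ltW s10) (ltW s12)).
have x2 : 0 < xn x ^+ 2 by rewrite lt_neqAle sqr_ge0 eq_sym sqrf_eq0 xn0.
exact: (ltr_div_sqr v1 v12 x2).
Qed.

Lemma Hout_cont x s : 0 < s -> {for s, continuous (Hout x)}.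
Proof.
move=> s0; have v0 := vv_gt0 h_gt0 ge s0.
apply: cvgD; first exact: (chA_cont h_gt0 ge).
apply: cvgM; first exact: cvg_cst.
apply: cvgV; first by rewrite expf_neq0// gt_eqF.
have vc : vv h e t @[t --> s] --> vv h e s by exact: vv_cont.
exact: (cvgM vc vc).
Qed.

(** As s -> 0+, Hout is unbounded if x_n != 0 and tends to equatorial x > 1 otherwise; the disc is
    excluded for this limit. *)
Lemma Hout_gt1 x : outer_chart h x -> exists2 s, 0 < s & 1 < Hout x s.
Proof.
move=> ox; have [xn0|xn0] := eqVneq (xn x) 0.
  have A1 : 1 < chA h e x 0.
    rewrite chA0 ltNge; apply/negP => le1; apply: ox; split => //.
  have /nbhs_ballP[d /= d0 dH] : \forall s \near 0, 1 < chA h e x s.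
    exact: (@cvgr_gt R R (nbhs (0 : R)) _ (chA h e x) _ (@chA_cont _ _ _ h_gt0 _ ge x 0) 1 A1).
  exists (d / 2); first by rewrite divr_gt0.
  rewrite /Hout xn0 expr0n !mul0r addr0; apply: dH.
  rewrite /ball /= sub0r normrN gtr0_norm ?divr_gt0//.
  by rewrite ltr_pdivrMr// ltr_pMr// ltr1n.
have x0 : 0 < `|xn x| by rewrite normr_gt0.
have vc : vv h e t @[t --> (0 : R)] --> (0 : R).
  by rewrite -[X in _ --> X](vv0 h e); exact: vv_cont.
have /nbhs_ballP[d /= d0 dH] : \forall s \near 0, vv h e s < `|xn x|.
  exact: (@cvgr_lt R R (nbhs (0 : R)) _ (vv h e) _ vc _ x0).
have d20 : 0 < d / 2 by rewrite divr_gt0.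
exists (d / 2) => //.
have v0 := vv_gt0 h_gt0 ge d20.
have vx : vv h e (d / 2) < `|xn x|.
  apply: dH; rewrite /ball /= sub0r normrN gtr0_norm//.
  by rewrite ltr_pdivrMr// ltr_pMr// ltr1n.
apply: lt_le_trans (_ : xn x ^+ 2 / vv h e (d / 2) ^+ 2 <= _).
  rewrite ltr_pdivlMr ?exprn_gt0// mul1r -(real_normK (num_real (xn x))).
  by rewrite ltr_pXn2r ?nnegrE ?ltW.
by rewrite /Hout lerDr (chA_ge0 h_gt0 ge).
Qed.

Lemma Hout_lt1 x s0 : 0 < s0 -> exists2 s, s0 < s & Hout x s < 1.
Proof.
move=> s00; have cc := @cos1_gt0 R; have cv := cvv_gt0 (R := R).
(* By [aa_le] and [vv_ge], Hout x s <= K / s^2, which is below 1 once s >= K + 1. *)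
pose K := \sum_j xj x j ^+ 2 * cos 1 ^- 2 + xn x ^+ 2 * cvv ^- 2.
have K0 : 0 <= K.
  by rewrite addr_ge0 ?sumr_ge0// => [j _|]; rewrite mulr_ge0 ?sqr_ge0// invr_ge0 sqr_ge0.
exists (s0 + K + 1); first by move: s00 (K0); lra.
set s := _ + 1; have s1 : K + 1 <= s by rewrite /s; move: s00; lra.
have sp : 0 < s by apply: lt_le_trans s1; rewrite ltr_wpDl.
apply: le_lt_trans (_ : K / s ^+ 2 < 1); last first.
  rewrite ltr_pdivrMr ?exprn_gt0// mul1r.
  have sK : K < s by apply: lt_le_trans s1; rewrite ltrDl.
  apply: lt_le_trans sK _; rewrite expr2 ler_peMl ?(ltW sp)//.
  by apply: le_trans s1; rewrite lerDr.
rewrite /K mulrDl mulr_suml; apply: lerD.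
  apply: ler_sum => j _; rewrite -mulrA ler_wpM2l ?sqr_ge0//.
  by rewrite -invfM -exprMn aa_le.
rewrite -mulrA ler_wpM2l ?sqr_ge0//.
have v0 := vv_gt0 h_gt0 ge sp.
have cs0 : 0 < cvv * s by apply: mulr_gt0.
rewrite -invfM -exprMn lef_pV2 ?posrE ?(exprn_gt0 2 v0) ?(exprn_gt0 2 cs0)//.
rewrite ler_pXn2r ?nnegrE ?(ltW v0) ?(ltW cs0)//.
exact: (vv_ge h_gt0 ge (ltW sp)).
Qed.

Lemma Hout_exists x : outer_chart h x -> exists s, 0 < s /\ Hout x s = 1.
Proof.
move=> ox; have [a a0 Ha] := Hout_gt1 ox; have [b ab Hb] := Hout_lt1 x a0.
have [||c /= cab Hc] := @IVT R (Hout x) a b 1 (ltW ab).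
- apply: continuous_in_subspaceT => s /set_mem /=; rewrite in_itv /= => /andP[sa _].
  by apply: Hout_cont; exact: lt_le_trans sa.
- by rewrite ge_min le_max (ltW Ha) (ltW Hb) orbT.
- exists c; split => //; move: cab; rewrite in_itv /= => /andP[ca _].
  exact: lt_le_trans ca.
Qed.

Lemma Hout_uniq x s t : outer_chart h x -> 0 < s -> 0 < t ->
  Hout x s = Hout x t -> s = t.
Proof.
move=> ox s0 t0 E; have [st|ts|//] := ltgtP s t.
  by have := Hout_decr ox s0 st; rewrite E ltxx.
by have := Hout_decr ox t0 ts; rewrite E ltxx.
Qed.

End FixedParameter.
End OuterChart.

Section OuterChart2.
Context {R : realType} {m : nat}.
Variable h : 'I_m -> R.
Hypothesis h_gt0 : forall k, 0 < h k.
Local Notation V := 'rV[R]_m.+1.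
Implicit Types (e s r : R) (x y v : V) (j : 'I_m) (z : V * R).

Lemma cvg_coord {T : Type} {F : set_system T} {FF : Filter F} (X : T -> V) x i :
  X @ F --> x -> X t 0 i @[t --> F] --> x 0 i.
Proof.
move=> Xx; apply: (@continuous_cvg _ _ _ _ _ X (fun y : V => y 0 i) x) => //.
exact: coord_continuous.
Qed.

Lemma cvg_sqr {T : Type} {F : set_system T} {FF : Filter F} (f : T -> R) (a : R) :
  f @ F --> a -> f t ^+ 2 @[t --> F] --> a ^+ 2.
Proof. by move=> fa; exact: (cvgM fa fa). Qed.

Lemma equatorial_cvg {T : Type} {F : set_system T} {FF : Filter F} (X : T -> V) x :
  X @ F --> x -> equatorial h (X t) @[t --> F] --> equatorial h x.
Proof.
move=> Xx; apply: cvg_sumr => j; apply: cvgM; last exact: cvg_cst.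
by apply: cvg_sqr; exact: cvg_coord.
Qed.

Lemma equatorial_continuous : continuous (equatorial h).
Proof. by move=> x; apply: (@equatorial_cvg _ (nbhs x) _ id x). Qed.

Lemma closed_disc : closed (disc h).
Proof.
rewrite (_ : disc h = equatorial h @^-1` [set r | r <= 1] `&`
  (fun x : V => x 0 ord_max) @^-1` [set r | r = 0]); last by [].
apply: closedI; apply: closed_comp.
- by move=> x _; exact: equatorial_continuous.
- exact: closed_le.
- by move=> x _; exact: coord_continuous.
- exact: closed_eq.
Qed.

Lemma open_outer_chart : open (outer_chart h).
Proof. exact: closed_openC closed_disc. Qed.

Definition Sout e x : R := xget 0 [set s | 0 < s /\ Hout h e x s = 1].
Definition Wout e x : R := xn x / vv h e (Sout e x).

Lemma SoutP e x : good h e -> outer_chart h x ->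
  0 < Sout e x /\ Hout h e x (Sout e x) = 1.
Proof. by move=> ge ox; apply: (@xgetPex _ 0 [set s | 0 < s /\ _]); exact: Hout_exists. Qed.

Lemma Sout_uniq e x s : good h e -> outer_chart h x -> 0 < s ->
  Hout h e x s = 1 -> Sout e x = s.
Proof.
move=> ge ox s0 Hs; have [S0 HS] := SoutP ge ox.
by apply: (Hout_uniq h_gt0 ge ox S0 s0); rewrite HS.
Qed.

(** The general filter serves two purposes: E constant gives continuity in x at a fixed parameter,
    and E -> 0 gives continuity in (e, x) at e = 0. The function 1 - Hout increases in s, as
    [implicit_cvg] expects. *)
Lemma Sout_cvg {T : Type} {F : set_system T} {FF : Filter F} (E : T -> R)
    (X : T -> V) e x :
  good h e -> outer_chart h x ->
  (\forall t \near F, good h (E t) /\ outer_chart h (X t)) ->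
  (forall j s, aa h j (E t) s @[t --> F] --> aa h j e s) ->
  (forall s, vv h (E t) s @[t --> F] --> vv h e s) ->
  X @ F --> x -> Sout (E t) (X t) @[t --> F] --> Sout e x.
Proof.
move=> ge ox near_ok cA cV Xx; have [S0 HS] := SoutP ge ox.
apply: (@implicit_cvg _ _ _ _ (fun t s => 1 - Hout h (E t) (X t) s)
  (fun s => 1 - Hout h e x s) _ _ [set s | 0 < s]).
- exact: lt_nbhsr.
- move=> s /= s0; apply: cvgB; first exact: cvg_cst.
  have v0 := vv_gt0 h_gt0 ge s0.
  apply: cvgD.
    apply: cvg_sumr => j; apply: cvgM (cA j s).
    by apply: cvg_sqr; exact: cvg_coord.
  apply: cvgM.
    by apply: cvg_sqr; exact: cvg_coord.
  apply: cvgV; first by rewrite expf_neq0// gt_eqF.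
  exact: cvg_sqr (cV s).
- move=> s /= s0 sS; rewrite subr_lt0 -HS.
  exact: (Hout_decr h_gt0 ge ox).
- move=> s /= s0 sS; rewrite subr_gt0 -HS.
  exact: (Hout_decr h_gt0 ge ox).
- apply: filterS near_ok => t [gt oXt] s /= s0.
  have [St0 HSt] := SoutP gt oXt; rewrite subr_lt0 subr_gt0 -HSt.
  split=> H; rewrite leNgt; apply/negP => lt.
    by have := Hout_decr h_gt0 gt oXt St0 lt => /(lt_trans H); rewrite ltxx.
  by have := Hout_decr h_gt0 gt oXt s0 lt => /(lt_trans H); rewrite ltxx.
Qed.

Section FixedParameter.
Variables (e : R) (x : V).
Hypotheses (ge : good h e) (ox : outer_chart h x).

Let s := Sout e x.
Let s0 : 0 < s := (SoutP ge ox).1.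
Let v0 : 0 < vv h e s := vv_gt0 h_gt0 ge s0.
Let w := Wout e x.

Lemma Wout_xn : vv h e s * w = xn x.
Proof. by rewrite /w /Wout mulrC divfK// gt_eqF. Qed.

Lemma Wout_eq : chA h e x s + w ^+ 2 = 1.
Proof. by rewrite /w /Wout expr_div_n; exact: (SoutP ge ox).2. Qed.

(** If w != 0 the first term is positive. If w = 0 then x_n = 0, so x is outside the closed disc and
    v chB > 0. *)
Lemma chD_out_gt0 : 0 < chD h e x s w.
Proof.
have d0 := dvv_gt0 ge s; rewrite /chD.
have [w0|w0] := eqVneq w 0; last first.
  apply: ltr_pwDl; last exact: (vv_chB_ge0 h_gt0 ge).
  by rewrite mulr_gt0// lt_neqAle sqr_ge0 eq_sym sqrf_eq0 w0.
rewrite w0 expr0n mulr0 add0r mulr_gt0//.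
apply: (chB_gt0 h_gt0 ge) => //; apply: (outer_xj e ox).
by rewrite -Wout_xn w0 mulr0.
Qed.

Lemma Sout_continuous : {for x, continuous (Sout e)}.
Proof.
apply: (@Sout_cvg _ (nbhs x) _ (fun=> e) id) => //.
- apply: filterS (open_nbhs_nbhs (conj open_outer_chart ox)) => y oy.
  by split.
- by move=> j t; exact: cvg_cst.
- by move=> t; exact: cvg_cst.
Qed.

Lemma is_derive_Hout z v r : 0 < z.2 ->
  differentiable (fun z => Hout h e z.1 z.2) z /\
  is_derive z (v, r) (fun z => Hout h e z.1 z.2)
    (2 * (chL h e z.1 z.2 v + xn z.1 * xn v / vv h e z.2 ^+ 2)
     - 2 * r * (chB h e z.1 z.2 + CC h e z.2 * kap h e z.2
         * (xn z.1 / vv h e z.2) ^+ 2 / vv h e z.2)).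
Proof.
move=> z0; have vz := vv_gt0 h_gt0 ge z0; have vz0 : vv h e z.2 != 0 by rewrite gt_eqF.
have vz20 : vv h e z.2 ^+ 2 != 0 by rewrite expf_neq0.
have Dv := is_derive_vv h_gt0 e z.2.
have dv : differentiable (fun z : V * R => vv h e z.2) z := differentiable_comp_snd Dv.
have dx := differentiable_fst_coord z ord_max.
split.
  apply: differentiableD; first exact: (differentiable_chA h_gt0 ge).
  apply: differentiableM; first exact: (differentiableM dx dx).
  by apply: differentiableV => //; exact: (differentiableM dv dv).
have D := isdD (is_derive_chA h_gt0 ge z v r)
  (isdM (isdX 2 (is_derive_fst_coord z v r ord_max))
        (isdV (isdX 2 (is_derive_comp_snd v r Dv)) vz20)).
apply: (isd_eq D); rewrite -/(xn v) -/(xn z.1) /=.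
by field.
Qed.

Lemma is_derive_Sout : differentiable (Sout e) x /\
  forall v, is_derive x v (Sout e) ((vv h e s * chL h e x s v + w * xn v) / chD h e x s w).
Proof.
have d (v : V) (r : R) := @is_derive_Hout (x, s) v r s0.
have dH := (d 0 0).1.
have dE v r : 'd (fun z => Hout h e z.1 z.2) (x, s) (v, r) =
  2 * (chL h e x s v + xn x * xn v / vv h e s ^+ 2)
     - 2 * r * (chB h e x s + CC h e s * kap h e s * (xn x / vv h e s) ^+ 2 / vv h e s).
  by case: (d v r).2 => _ <-; rewrite deriveE.
have v00 : vv h e s != 0 by rewrite gt_eqF.
have D0 : chD h e x s w != 0 by rewrite gt_eqF// chD_out_gt0.
have bE : 'd (fun z => Hout h e z.1 z.2) (x, s) (0, 1) = - 2 * chD h e x s w / vv h e s.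
  rewrite dE /chL big1 => [|j _]; last by rewrite /xj mxE mulr0.
  by rewrite {2}/xn mxE mulr0 mul0r addr0 mulr0 sub0r /chD -/w; rewrite -[xn x / _]/w; field.
have b0 : - 2 * chD h e x s w / vv h e s != 0.
  by rewrite mulf_neq0 ?invr_eq0// mulf_neq0// oppr_eq0 pnatr_eq0.
have near1 : \forall y \near x, Hout h e y (Sout e y) = Hout h e x s.
  rewrite (SoutP ge ox).2; apply: filterS (open_nbhs_nbhs (conj open_outer_chart ox)) => y oy.
  exact: (SoutP ge oy).2.
have [dS DS] := @implicit_differentiable R V _ (Sout e) x _ dH (esym bE) b0 Sout_continuous near1.
split => // v; apply: (isd_eq (DS v)); rewrite dE mulr0 mul0r subr0.
rewrite -Wout_xn; field.
by rewrite D0 v00.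
Qed.

Lemma is_derive_Wout : differentiable (Wout e) x /\
  forall v, is_derive x v (Wout e) ((chB h e x s * xn v
      - CC h e s * kap h e s * w * chL h e x s v) / chD h e x s w).
Proof.
have [dS DS] := is_derive_Sout.
have v00 : vv h e s != 0 by rewrite gt_eqF.
have D0 : chD h e x s w != 0 by rewrite gt_eqF// chD_out_gt0.
have dv : differentiable (fun y => vv h e (Sout e y)) x.
  apply: (@differentiable_comp _ _ _ _ (Sout e) (vv h e)) => //.
  by apply/derivable1_diffP; case: (is_derive_vv h_gt0 e s).
have Dv v := isd_comp dS (DS v) (is_derive_vv h_gt0 e s).
split.
  apply: differentiableM; first exact: differentiable_coord.
  exact: differentiableV.
move=> v; apply: (isd_eq (isdM (is_derive_coord x v ord_max) (isdV (Dv v) v00))).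
rewrite -/(xn v) -/(xn x) -/s -Wout_xn; move: D0; rewrite /chD.
set L := chL _ _ _ _ _; set B := chB _ _ _ _ => D0.
by field; rewrite v00 D0.
Qed.

End FixedParameter.

Variable P : set R.
Hypotheses (P0 : nbhs 0 P) (Pgood : forall e, P e -> good h e).

Lemma pcont_Sout : pcont (outer_chart h) Sout.
Proof.
move=> x ox; apply: (@Sout_cvg (R * V)%type (nbhs ((0 : R), x)) _ (fun p => p.1) (fun p => p.2) 0 x) => //.
- exact: good0.
- apply: filterS (nbhs_PU P0 open_outer_chart ox) => p [Pz oz].
  by split => //; exact: Pgood.
- move=> j t; apply: (@jcvg_aa _ _ _ h_gt0 j _ _ _ (fun p : R * V => p.1) (fun=> t)).
    exact: cvg_fst.
  exact: cvg_cst.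
- move=> t; apply: (@jcvg_vv _ _ _ h_gt0 _ _ _ (fun p : R * V => p.1) (fun=> t)).
    exact: cvg_fst.
  exact: cvg_cst.
- exact: cvg_snd.
Qed.

Lemma pcont_Wout : pcont (outer_chart h) Wout.
Proof.
move=> x ox; have [s0 _] := SoutP (good0 h) ox.
apply: cvgM.
  by apply: (@cvg_coord _ _ _ (fun p : R * V => p.2)); exact: cvg_snd.
apply: cvgV; first by rewrite gt_eqF// (vv_gt0 h_gt0 (good0 h)).
apply: (@jcvg_vv _ _ _ h_gt0 _ _ _ (fun p : R * V => p.1) (fun p : R * V => Sout p.1 p.2)).
  exact: cvg_fst.
exact: pcont_Sout.
Qed.

Lemma chart_out : chart h P (outer_chart h) Sout Wout.
Proof.
split.
- exact: pcont_Sout.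
- exact: pcont_Wout.
- by move=> e x Pe ox; rewrite gt_eqF// chD_out_gt0//; exact: Pgood.
- by move=> e x Pe ox; apply: Wout_xn => //; exact: Pgood.
- by move=> e x Pe ox; apply: Wout_eq => //; exact: Pgood.
- by move=> e x Pe ox; apply: (is_derive_Sout _ _).1 => //; exact: Pgood.
- by move=> e x Pe ox; apply: (is_derive_Wout _ _).1 => //; exact: Pgood.
- by move=> e x v Pe ox; exact: (is_derive_Sout (Pgood Pe) ox).2.
- by move=> e x v Pe ox; exact: (is_derive_Wout (Pgood Pe) ox).2.
Qed.

End OuterChart2.

Section CylinderChart.
Context {R : realType} {m : nat}.
Variable h : 'I_m -> R.
Hypothesis h_gt0 : forall k, 0 < h k.
Local Notation V := 'rV[R]_m.+1.
Implicit Types (e s r : R) (x y v : V) (j : 'I_m) (z : V * R).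

Definition cyl : set V := [set x | equatorial h x < 1].

Lemma open_cyl : open cyl.
Proof.
rewrite (_ : cyl = equatorial h @^-1` [set r | r < 1]); last by [].
apply: open_comp; last exact: open_lt.
by move=> x _; exact: equatorial_continuous.
Qed.

Definition Wc e x s : R := Num.sqrt (1 - chA h e x s).
(** Over the cylinder chA <= equatorial < 1, so that w > 0 is solved first from chA + w^2 = 1. The
    remaining equation v(s) w = x_n involves no division by v and passes through s = 0 on the
    disc. *)
Definition Hcyl e x s : R := vv h e s * Wc e x s.
Definition Scyl e x : R := xget 0 [set s | Hcyl e x s = xn x].
Definition Wcyl e x : R := Wc e x (Scyl e x).

Section FixedParameter.
Variable e : R.
Hypothesis ge : good h e.

Lemma oneBchA_gt0 x s : cyl x -> 0 < 1 - chA h e x s.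
Proof.
by move=> cx; rewrite subr_gt0; apply: le_lt_trans (chA_le_equatorial h_gt0 ge x s) cx.
Qed.

Lemma Wc_gt0 x s : cyl x -> 0 < Wc e x s.
Proof. by move=> cx; rewrite sqrtr_gt0 oneBchA_gt0. Qed.

Lemma Wc2 x s : cyl x -> Wc e x s ^+ 2 = 1 - chA h e x s.
Proof. by move=> cx; rewrite sqr_sqrtr// ltW// oneBchA_gt0. Qed.

Lemma is_derive_Wc x s : cyl x -> is_derive s 1 (Wc e x) (chB h e x s / Wc e x s).
Proof.
move=> cx; have w0 := Wc_gt0 s cx; have w1 := oneBchA_gt0 s cx.
have D := isdB (isdC (1 : R) s 1) (is_derive_chA_s h_gt0 ge x s).
apply: (isd_eq (isd_comp1 D (is_derive1_sqrt w1))).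
by rewrite -/(Wc e x s); field; rewrite gt_eqF.
Qed.

Lemma is_derive_Hcyl x s : cyl x ->
  is_derive s 1 (Hcyl e x) (chD h e x s (Wc e x s) / Wc e x s).
Proof.
move=> cx; have w0 := Wc_gt0 s cx.
apply: (isd_eq (isdM (is_derive_vv h_gt0 e s) (is_derive_Wc s cx))).
by rewrite /chD; field; rewrite gt_eqF.
Qed.

Lemma chD_cyl_gt0 x s w : 0 < w -> 0 < chD h e x s w.
Proof.
move=> w0; apply: ltr_pwDl; last exact: (vv_chB_ge0 h_gt0 ge).
by rewrite mulr_gt0 ?(dvv_gt0 ge)// exprn_gt0.
Qed.

Lemma Hcyl_incr x s t : cyl x -> s < t -> Hcyl e x s < Hcyl e x t.
Proof.
move=> cx st; apply: (isd_lt st (fun u _ => is_derive_Hcyl u cx)) => u _.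
by rewrite divr_gt0 ?Wc_gt0// chD_cyl_gt0 ?Wc_gt0.
Qed.

Lemma HcylN x s : Hcyl e x (- s) = - Hcyl e x s.
Proof.
rewrite /Hcyl vvN// mulNr /Wc; congr (- (_ * Num.sqrt (1 - _))).
by apply: eq_bigr => j _; rewrite aaN.
Qed.

Lemma Hcyl_exists x : cyl x -> exists s, Hcyl e x s = xn x.
Proof.
move=> cx; have q0 : 0 < 1 - equatorial h x by rewrite subr_gt0.
have sq0 : 0 < Num.sqrt (1 - equatorial h x) by rewrite sqrtr_gt0.
(* For s >= 0, v(s) >= cvv s and w >= sqrt (1 - equatorial x), so that Hcyl reaches |x_n| at |x_n| /
   k; oddness handles the other end. *)
pose k := cvv * Num.sqrt (1 - equatorial h x).
have k0 : 0 < k by apply: mulr_gt0 => //; exact: cvv_gt0.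
pose a := `|xn x| / k; have a0 : 0 <= a by rewrite divr_ge0// ltW.
have Ha : `|xn x| <= Hcyl e x a.
  have <- : k * a = `|xn x| by rewrite mulrC divfK// gt_eqF.
  rewrite /k mulrAC; apply: ler_pM.
  - by apply: mulr_ge0 => //; rewrite ltW// cvv_gt0.
  - exact: ltW.
  - exact: (vv_ge h_gt0 ge).
  - by rewrite ler_wsqrtr// lerD2l lerN2 (chA_le_equatorial h_gt0 ge).
have := Ha; rewrite ler_norml => /andP[Ha1 Ha2].
have [|||c _ Hc] := @IVT R (Hcyl e x) (- a) a (xn x).
- by rewrite ge0_cp.
- apply: continuous_in_subspaceT => s _; exact: isd_cont (is_derive_Hcyl s cx).
- by rewrite ge_min le_max HcylN Ha2 lerNl; move: Ha1; rewrite lerNl => ->; rewrite orbT.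
- by exists c.
Qed.

Lemma ScylP x : cyl x -> Hcyl e x (Scyl e x) = xn x.
Proof. by move=> cx; apply: (@xgetPex _ 0 [set s | Hcyl e x s = xn x]); exact: Hcyl_exists. Qed.

Lemma Scyl_uniq x s : cyl x -> Hcyl e x s = xn x -> Scyl e x = s.
Proof.
move=> cx Hs; have := ScylP cx; rewrite -Hs => E.
have [lt|lt|//] := ltgtP (Scyl e x) s; have := Hcyl_incr cx lt;
  by rewrite E ltxx.
Qed.

End FixedParameter.

Lemma Scyl_cvg {T : Type} {F : set_system T} {FF : Filter F} (E : T -> R)
    (X : T -> V) e x :
  good h e -> cyl x ->
  (\forall t \near F, good h (E t) /\ cyl (X t)) ->
  (forall j s, aa h j (E t) s @[t --> F] --> aa h j e s) ->
  (forall s, vv h (E t) s @[t --> F] --> vv h e s) ->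
  X @ F --> x -> Scyl (E t) (X t) @[t --> F] --> Scyl e x.
Proof.
move=> ge cx near_ok cA cV Xx; have HS := ScylP ge cx.
apply: (@implicit_cvg _ _ _ _ (fun t s => Hcyl (E t) (X t) s - xn (X t))
  (fun s => Hcyl e x s - xn x) _ _ setT).
- exact: filterT.
- move=> s _; apply: cvgB; last exact: cvg_coord.
  apply: cvgM; first exact: cV.
  apply: (@continuous_cvg _ _ _ _ _ (fun t => 1 - chA h (E t) (X t) s) Num.sqrt).
    exact: sqrt_continuous.
  apply: cvgB; first exact: cvg_cst.
  apply: cvg_sumr => j; apply: cvgM (cA j s).
  by apply: cvg_sqr; exact: cvg_coord.
- by move=> s _ sS; rewrite subr_lt0 -HS; exact: Hcyl_incr.
- by move=> s _ sS; rewrite subr_gt0 -HS; exact: Hcyl_incr.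
- apply: filterS near_ok => t [gt cXt] s _.
  rewrite subr_lt0 subr_gt0 -(ScylP gt cXt).
  split=> H; rewrite leNgt; apply/negP => lt.
    by have := Hcyl_incr gt cXt lt => /(lt_trans H); rewrite ltxx.
  by have := Hcyl_incr gt cXt lt => /(lt_trans H); rewrite ltxx.
Qed.

Section FixedPoint.
Variables (e : R) (x : V).
Hypotheses (ge : good h e) (cx : cyl x).

Let s := Scyl e x.
Let w := Wcyl e x.
Let w0 : 0 < w := Wc_gt0 ge s cx.

Lemma Wcyl_xn : vv h e s * w = xn x. Proof. exact: ScylP. Qed.

Lemma Wcyl_eq : chA h e x s + w ^+ 2 = 1.
Proof. by rewrite Wc2// addrC subrK. Qed.

Lemma Scyl_continuous : {for x, continuous (Scyl e)}.
Proof.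
apply: (@Scyl_cvg _ (nbhs x) _ (fun=> e) id) => //.
- apply: filterS (open_nbhs_nbhs (conj open_cyl cx)) => y oy.
  by split.
- by move=> j t; exact: cvg_cst.
- by move=> t; exact: cvg_cst.
Qed.

Lemma is_derive_Hcyl_joint z v r : cyl z.1 ->
  let w := Wc e z.1 z.2 in
  [/\ differentiable (fun z => Wc e z.1 z.2) z,
      is_derive z (v, r) (fun z => Wc e z.1 z.2)
        ((r * chB h e z.1 z.2 - chL h e z.1 z.2 v) / w) &
      differentiable (fun z => Hcyl e z.1 z.2 - xn z.1) z /\
      is_derive z (v, r) (fun z => Hcyl e z.1 z.2 - xn z.1)
    (r * (chD h e z.1 z.2 w / w) - (vv h e z.2 * chL h e z.1 z.2 v / w + xn v))].
Proof.
move=> cz w1; have wz : 0 < w1 := Wc_gt0 ge z.2 cz.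
have q0 := oneBchA_gt0 ge z.2 cz; have wz0 : w1 != 0 by rewrite gt_eqF.
have Dv := is_derive_vv h_gt0 e z.2.
have dv : differentiable (fun z : V * R => vv h e z.2) z := differentiable_comp_snd Dv.
have dx := differentiable_fst_coord z ord_max.
have dA : differentiable (fun z => 1 - chA h e z.1 z.2) z.
  by apply: differentiableB => //; exact: (differentiable_chA h_gt0 ge).
have dW : differentiable (fun z => Wc e z.1 z.2) z.
  apply: (@differentiable_comp _ _ _ _ (fun z => 1 - chA h e z.1 z.2) Num.sqrt) => //.
  by apply/derivable1_diffP; case: (is_derive1_sqrt q0).
have DW : is_derive z (v, r) (fun z => Wc e z.1 z.2)
        ((r * chB h e z.1 z.2 - chL h e z.1 z.2 v) / w1).
  have D1 := isdB (isdC (1 : R) z (v, r)) (is_derive_chA h_gt0 ge z v r).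
  apply: (isd_eq (isd_comp dA D1 (is_derive1_sqrt q0))).
  by rewrite -/(Wc e z.1 z.2) -/w1; field.
split => //; split.
  by apply: differentiableB => //; exact: differentiableM.
apply: (isd_eq (isdB (isdM (is_derive_comp_snd v r Dv) DW)
  (is_derive_fst_coord z v r ord_max))).
by rewrite -/(xn v) -/w1 /chD; field.
Qed.

Lemma is_derive_Scyl : differentiable (Scyl e) x /\
  forall v, is_derive x v (Scyl e) ((vv h e s * chL h e x s v + w * xn v) / chD h e x s w).
Proof.
have d (v : V) (r : R) : differentiable (fun z => Hcyl e z.1 z.2 - xn z.1) (x, s) /\
    is_derive (x, s) (v, r) (fun z => Hcyl e z.1 z.2 - xn z.1)
    (r * (chD h e x s w / w) - (vv h e s * chL h e x s v / w + xn v)).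
  by have [_ _] := @is_derive_Hcyl_joint (x, s) v r cx.
have dH := (d 0 0).1.
have dE v r : 'd (fun z => Hcyl e z.1 z.2 - xn z.1) (x, s) (v, r) =
    r * (chD h e x s w / w) - (vv h e s * chL h e x s v / w + xn v).
  by case: (d v r).2 => _ <-; rewrite deriveE.
have w00 : w != 0 by rewrite gt_eqF.
have D0 : chD h e x s w != 0 by rewrite gt_eqF// chD_cyl_gt0.
have bE : 'd (fun z => Hcyl e z.1 z.2 - xn z.1) (x, s) (0, 1) = chD h e x s w / w.
  rewrite dE /chL big1 => [|j _]; last by rewrite /xj mxE mulr0.
  by rewrite /xn mxE mulr0 mul0r addr0 subr0 mul1r.
have b0 : chD h e x s w / w != 0 by rewrite mulf_neq0 ?invr_eq0.
have near1 : \forall y \near x, Hcyl e y (Scyl e y) - xn y = Hcyl e x s - xn x.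
  rewrite ScylP// subrr; apply: filterS (open_nbhs_nbhs (conj open_cyl cx)) => y cy.
  by rewrite ScylP// subrr.
have [dS DS] := @implicit_differentiable R V _ (Scyl e) x _ dH (esym bE) b0 Scyl_continuous near1.
split => // v; apply: (isd_eq (DS v)); rewrite dE mul0r sub0r opprK.
by field; rewrite D0 w00.
Qed.

Lemma is_derive_Wcyl : differentiable (Wcyl e) x /\
  forall v, is_derive x v (Wcyl e) ((chB h e x s * xn v
      - CC h e s * kap h e s * w * chL h e x s v) / chD h e x s w).
Proof.
have [dS DS] := is_derive_Scyl.
have w00 : w != 0 by rewrite gt_eqF.
have D0 : chD h e x s w != 0 by rewrite gt_eqF// chD_cyl_gt0.
have dA : differentiable (fun y => chA h e y (Scyl e y)) x.
  apply: (@differentiable_comp _ _ _ _ (fun y => (y, Scyl e y))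
    (fun z => chA h e z.1 z.2)).
    by apply: differentiable_pair.
  exact: (differentiable_chA h_gt0 ge).
have DA v : is_derive x v (fun y => chA h e y (Scyl e y))
    (2 * chL h e x s v - 2 * ((vv h e s * chL h e x s v + w * xn v) / chD h e x s w)
      * chB h e x s).
  have D := @isdS R V m (fun j y => xj y j ^+ 2 * aa h j e (Scyl e y)) x v _ (fun j =>
    isdM (isdX 2 (is_derive_coord x v (lift ord_max j)))
    (isd_comp dS (DS v) (is_derive_aa h_gt0 (ckk_neq0 h_gt0 ge j s)))).
  apply: (isd_eq D); set ds := _ / _.
  rewrite /chL /chB !mulr_sumr -sumrB; apply: eq_bigr => j _.
  by rewrite -/(xj x j) -/(xj v j) -/s /=; ring.
have q0 := oneBchA_gt0 ge s cx.
have dA1 : differentiable (fun y => 1 - chA h e y (Scyl e y)) x.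
  exact: differentiableB.
split.
  apply: (@differentiable_comp _ _ _ _ (fun y => 1 - chA h e y (Scyl e y)) Num.sqrt) => //.
  by apply/derivable1_diffP; case: (is_derive1_sqrt q0).
move=> v; have D1 := isdB (isdC (1 : R) x v) (DA v).
apply: (isd_eq (isd_comp dA1 D1 (is_derive1_sqrt q0))).
rewrite -/s -/(Wc e x s) -/(Wcyl e x) -/w; move: D0; rewrite /chD.
set L := chL _ _ _ _ _; set B := chB _ _ _ _ => D0.
by field; rewrite w00 D0.
Qed.

End FixedPoint.

Variable P : set R.
Hypotheses (P0 : nbhs 0 P) (Pgood : forall e, P e -> good h e).

Lemma pcont_Scyl : pcont cyl Scyl.
Proof.
move=> x cx; apply: (@Scyl_cvg (R * V)%type (nbhs ((0 : R), x)) _ (fun p => p.1) (fun p => p.2) 0 x) => //.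
- exact: good0.
- apply: filterS (nbhs_PU P0 open_cyl cx) => p [Pz oz].
  by split => //; exact: Pgood.
- move=> j t; apply: (@jcvg_aa _ _ _ h_gt0 j _ _ _ (fun p : R * V => p.1) (fun=> t)).
    exact: cvg_fst.
  exact: cvg_cst.
- move=> t; apply: (@jcvg_vv _ _ _ h_gt0 _ _ _ (fun p : R * V => p.1) (fun=> t)).
    exact: cvg_fst.
  exact: cvg_cst.
- exact: cvg_snd.
Qed.

Lemma pcont_Wcyl : pcont cyl Wcyl.
Proof.
move=> x cx.
apply: (@continuous_cvg _ _ _ _ _ (fun p : R * V => 1 - chA h p.1 p.2 (Scyl p.1 p.2)) Num.sqrt).
  exact: sqrt_continuous.
apply: cvgB; first exact: cvg_cst.
apply: cvg_sumr => j; apply: cvgM.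
  apply: cvg_sqr; apply: (@cvg_coord _ _ _ _ _ (fun p : R * V => p.2)).
  exact: cvg_snd.
apply: (@jcvg_aa _ _ _ h_gt0 j _ _ _ (fun p : R * V => p.1) (fun p : R * V => Scyl p.1 p.2)).
  exact: cvg_fst.
exact: pcont_Scyl.
Qed.

Lemma chart_cyl : chart h P cyl Scyl Wcyl.
Proof.
split.
- exact: pcont_Scyl.
- exact: pcont_Wcyl.
- move=> e x Pe cx; rewrite gt_eqF// chD_cyl_gt0 ?Wc_gt0//; exact: Pgood.
- by move=> e x Pe cx; apply: Wcyl_xn => //; exact: Pgood.
- by move=> e x Pe cx; apply: Wcyl_eq => //; exact: Pgood.
- by move=> e x Pe cx; exact: (is_derive_Scyl (Pgood Pe) cx).1.
- by move=> e x Pe cx; exact: (is_derive_Wcyl (Pgood Pe) cx).1.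
- by move=> e x v Pe cx; exact: (is_derive_Scyl (Pgood Pe) cx).2.
- by move=> e x v Pe cx; exact: (is_derive_Wcyl (Pgood Pe) cx).2.
Qed.

End CylinderChart.

(** * The Z2-function of a neck *)

Lemma sgr_cases (R : realDomainType) (a : R) : a != 0 ->
  Num.sg a = 1 \/ Num.sg a = -1.
Proof.
by rewrite neq_lt => /orP[a0|a0]; [right; exact: ltr0_sg|left; exact: gtr0_sg].
Qed.

Section LocalSmoothness.
Context {R : realType} {n : nat}.
Local Notation V := 'rV[R]_n.
Implicit Types (f g : V -> R) (U : set V) (x : V).

Lemma iter_partial_eq U f g (s : seq 'I_n) x : open U ->
  (forall y, U y -> f y = g y) -> U x -> iter_partial s f x = iter_partial s g x.
Proof.
move=> oU fg; elim: s x => [|i s IH] x Ux /=; first exact: fg.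
by apply: near_eq_derive; apply: (near_U oU Ux).
Qed.

Lemma smooth_on_local U f :
  (forall x, U x -> exists W g, [/\ open W, W x, smooth_on W g &
    forall y, W y -> f y = g y]) -> smooth_on U f.
Proof.
move=> H s x Ux; have [W [g [oW Wx sg fg]]] := H x Ux.
apply: near_eq_differentiable (sg s x Wx).
by apply: (near_U oW Wx) => y Wy; rewrite (iter_partial_eq s oW fg Wy).
Qed.

Lemma smooth_onS U W f : W `<=` U -> smooth_on U f -> smooth_on W f.
Proof. by move=> WU sf s x /WU; exact: sf. Qed.

Lemma iter_partialZ U f (c : R) (s : seq 'I_n) x : open U -> smooth_on U f ->
  U x -> iter_partial s (fun y => c * f y) x = c * iter_partial s f x.
Proof.
move=> oU sf; elim: s x => [//|i s IH] x Ux /=.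
rewrite (@near_eq_derive _ _ _ _ (fun y => c * iter_partial s f y)); last exact: (near_U oU Ux).
have D := diff_is_derive (ebase i) (sf s x Ux).
by case: (isdZ c D) => _ ->; case: D => _ ->.
Qed.

Lemma smooth_onZ U f (c : R) : open U -> smooth_on U f ->
  smooth_on U (fun y => c * f y).
Proof.
move=> oU sf s x Ux.
apply: (@near_eq_differentiable _ _ (fun y => c * iter_partial s f y)).
  by apply: (near_U oU Ux) => y Uy; rewrite (iter_partialZ c s oU sf Uy).
by apply: differentiableM; [exact: differentiable_cst|exact: sf].
Qed.

End LocalSmoothness.

Section LawlorPotential.
Context {R : realType} {m : nat}.
Variable h : 'I_m -> R.
Hypothesis h_gt0 : forall k, 0 < h k.
Local Notation V := 'rV[R]_m.+1.
Implicit Types (e s r : R) (x y v : V) (j : 'I_m).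

Definition Fout e x : R := Phi h e x (Sout h e x) (Wout h e x).
Definition Fcyl e x : R := Phi h e x (Scyl h e x) (Wcyl h e x).

(** The covering involution reverses both s and w, so this oddness is what makes [Phi] a section of
    L. *)
Lemma PhiN e x s w : Phi h e x (- s) (- w) = - Phi h e x s w.
Proof.
rewrite /Phi JJN// uuN// vvN//.
rewrite (eq_bigr (fun j => - (tau h j e s * xj x j ^+ 2))); last first.
  by move=> j _; rewrite tauN// mulNr.
by rewrite sumrN; ring.
Qed.

Lemma Phi0 e x w : Phi h e x 0 w = 0.
Proof.
rewrite /Phi JJ0 vv0 big1 => [|j _]; first by rewrite oppr0 add0r mulr0 mul0r subrr mulr0.
by rewrite /tau II0 snz0 !mul0r.
Qed.

Lemma chAN e x s : chA h e x (- s) = chA h e x s.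
Proof. by apply: eq_bigr => j _; rewrite aaN. Qed.

Lemma xn_outer x : xn x != 0 -> outer_chart h x.
Proof. by move=> x0 [_ E]; rewrite /xn E eqxx in x0. Qed.

Lemma cyl_inner x : cyl h x -> inner_chart h x.
Proof. by move=> cx [le1 _]; move: cx; rewrite /cyl /= ltNge le1. Qed.

Section FixedParameter.
Variable e : R.
Hypothesis ge : good h e.

(** The outer chart normalizes s > 0 and the cylinder w > 0. They select the same sheet above {x_n >
    0} and opposite sheets below, as in the cocycle of L. *)
Lemma Scyl_sg x : cyl h x -> xn x != 0 ->
  Sout h e x = Num.sg (xn x) * Scyl h e x /\
  Wout h e x = Num.sg (xn x) * Wcyl h e x.
Proof.
move=> cx x0; have ox := xn_outer x0.
have w0 : 0 < Wcyl h e x by exact: (Wc_gt0 h_gt0 ge).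
have E := Wcyl_xn h_gt0 ge cx; have A := Wcyl_eq h_gt0 ge cx.
set s := Scyl h e x in E A *; set w := Wcyl h e x in E A w0 *.
have sgc := sgr_cases x0.
have sgs : 0 < Num.sg (xn x) * s.
  have [s0|s0|s0] := ltgtP s 0.
  - have v0 := vv_lt0 h_gt0 ge s0.
    by rewrite -E ltr0_sg ?mulN1r ?oppr_gt0// nmulr_rlt0.
  - have v0 := vv_gt0 h_gt0 ge s0.
    by rewrite -E gtr0_sg ?mul1r// mulr_gt0.
  - by move: x0; rewrite -E s0 vv0 mul0r eqxx.
have vE : vv h e (Num.sg (xn x) * s) = Num.sg (xn x) * vv h e s.
  by case: sgc => ->; [rewrite !mul1r|rewrite !mulN1r vvN].
have sg2 : Num.sg (xn x) ^+ 2 = 1 by rewrite sqr_sg x0.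
have v00 : vv h e s != 0 by apply: contraNneq x0 => v0; rewrite -E v0 mul0r.
have sg0 : Num.sg (xn x) != 0 by rewrite sgr_eq0.
have HS : Sout h e x = Num.sg (xn x) * s.
  apply: (Sout_uniq h_gt0 ge ox sgs).
  have xE : xn x ^+ 2 = vv h e s ^+ 2 * w ^+ 2 by rewrite -E exprMn.
  rewrite /Hout vE exprMn sg2 mul1r xE mulrAC divff ?expf_neq0// mul1r -A.
  by congr (_ + _); case: sgc => ->; [rewrite mul1r|rewrite mulN1r chAN].
split => //; rewrite /Wout HS vE.
have sgV : (Num.sg (xn x))^-1 = Num.sg (xn x).
  by apply: (mulfI sg0); rewrite divff// -expr2.
rewrite invfM sgV -[X in X * _ = _]E mulrCA; congr (_ * _).
by rewrite mulrAC divff// mul1r.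
Qed.

Lemma Fcyl_sg x : cyl h x -> Fcyl e x = Num.sg (xn x) * Fout e x.
Proof.
move=> cx; have [x0|x0] := eqVneq (xn x) 0.
  (* On x_n = 0 the solution is s = 0, where [Phi] vanishes; this agrees with the value 0 of the
     sign. *)
  rewrite x0 sgr0 mul0r /Fcyl (_ : Scyl h e x = 0) ?Phi0//.
  by apply: (Scyl_uniq h_gt0 ge cx); rewrite x0 /Hcyl vv0 mul0r.
have [Ss Ws] := Scyl_sg cx x0.
rewrite /Fout Ss Ws /Fcyl; case: (sgr_cases x0) => ->; first by rewrite !mul1r.
by rewrite !mulN1r PhiN opprK.
Qed.

End FixedParameter.
End LawlorPotential.

(** * The graph is Lawlor's neck *)

Section PrimitiveExtensionality.
Context {R : realType}.
Local Notation mu := (@lebesgue_measure R).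
Implicit Types (g : R -> R) (s : R).

(* [lawlor_P] has a junk value at [0]. *)
Lemma eq_prim g1 g2 s : continuous g2 -> (forall y, y != 0 -> g1 y = g2 y) ->
  prim g1 s = prim g2 s.
Proof.
move=> c2 g12; rewrite /prim; case: ifPn => [s0|_].
- have E : {in `]0, s]%classic, g2 =1 g1}.
    move=> y /set_mem /=; rewrite in_itv /= => /andP[y0 _].
    by rewrite g12// gt_eqF.
  have I2 : mu.-integrable `]0, s]%classic (EFin \o g2).
    apply: integrableS (continuous_integrable_itv 0 s c2) => //.
    exact: subset_itv_oc_cc.
  have I1 : mu.-integrable `]0, s]%classic (EFin \o g1).
    by apply: eq_integrable I2 => // y yD /=; rewrite E.
  by rewrite -Rintegral_itv_obnd_cbnd// -[RHS]Rintegral_itv_obnd_cbnd//;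
    apply: eq_Rintegral => y yD; rewrite E.
- have E : {in `[s, 0[%classic, g2 =1 g1}.
    move=> y /set_mem /=; rewrite in_itv /= => /andP[_ y0].
    by rewrite g12// lt_eqF.
  have I2 : mu.-integrable `[s, 0[%classic (EFin \o g2).
    apply: integrableS (continuous_integrable_itv s 0 c2) => //.
    exact: subset_itv_co_cc.
  have I1 : mu.-integrable `[s, 0[%classic (EFin \o g1).
    by apply: eq_integrable I2 => // y yD /=; rewrite E.
  by congr (- _); rewrite -Rintegral_itv_bndo_bndc// -[RHS]Rintegral_itv_bndo_bndc//;
    apply: eq_Rintegral => y yD; rewrite E.
Qed.

Lemma primZ g (c s : R) : continuous g -> prim (fun u => c * g u) s = c * prim g s.
Proof.
move=> cg; have cg' : continuous (fun u => c * g u).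
  by move=> u; apply: cvgM; [exact: cvg_cst|exact: cg].
have H (x : R) : is_derive x 1 (fun x => prim (fun u => c * g u) x - c * prim g x) 0.
  apply: (isd_eq (isdB (is_derive_prim x cg') (isdZ c (is_derive_prim x cg)))).
  by rewrite subrr.
by have := isd_cst s H; rewrite !prim0 mulr0 subr0 => /eqP; rewrite subr_eq0 => /eqP.
Qed.

End PrimitiveExtensionality.

Section LawlorNeck.
Context {R : realType} {m : nat}.
Variable h : 'I_m -> R.
Hypothesis h_gt0 : forall k, 0 < h k.
Variable e : R.
Hypotheses (e0 : 0 < e) (ge : good h e).
Implicit Types (s y : R) (j : 'I_m).
Let e_neq0 : e != 0. Proof. by rewrite gt_eqF. Qed.

Definition cc (k : 'I_m.+1) : R :=
  if unlift ord_max k is Some j then (h j)^-1 else e^-1.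

Lemma cc_lift j : cc (lift ord_max j) = (h j)^-1.
Proof. by rewrite /cc liftK. Qed.

Lemma cc_max : cc ord_max = e^-1.
Proof. by rewrite /cc unlift_none. Qed.

Lemma cc_gt0 k : 0 < cc k.
Proof. by rewrite /cc; case: unlift => [j|]; rewrite invr_gt0. Qed.

Lemma lawlor_PE y : y != 0 -> lawlor_P cc (y ^+ 2) = MM h e y / e ^+ 2.
Proof.
move=> y0; rewrite /lawlor_P (bigD1_ord ord_max)//= cc_max.
under eq_bigr do rewrite cc_lift.
rewrite -/(qq h y) /MM [in RHS]qqE qqE.
by field; rewrite y0 e_neq0.
Qed.

Lemma sqrt_lawlor_P y : y != 0 -> (Num.sqrt (lawlor_P cc (y ^+ 2)))^-1 = e * rho h e y.
Proof.
move=> y0; rewrite lawlor_PE// sqrtrM; last exact: ltW (MM_gt0 h e y).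
rewrite -exprVn sqrtr_sqr ger0_norm ?invr_ge0 ?ltW//.
by rewrite invfM invrK mulrC.
Qed.

Lemma lawlor_psi_lift j s : lawlor_psi cc (lift ord_max j) s = e * II h j e s.
Proof.
rewrite /II -primZ; last exact: continuous_rholam.
apply: eq_prim => [u|y y0].
  by apply: cvgM; [exact: cvg_cst|exact: continuous_rholam].
rewrite invfM sqrt_lawlor_P// cc_lift /lam.
have hj : h j != 0 by rewrite gt_eqF.
have n2 : h j ^+ 2 + y ^+ 2 != 0 by rewrite gt_eqF// -invr_gt0 (lam_gt0 h_gt0 j y).
by field; rewrite hj n2.
Qed.

(** The angle psi_n. Its integrand has a peak of height about 1 / e and width about e at 0, hence
    its elimination through [uu_vv_polar]. *)
Definition psin s : R := prim (fun u => e * rho h e u / (e ^+ 2 + u ^+ 2)) s.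

Let e2s_gt0 s : 0 < e ^+ 2 + s ^+ 2.
Proof. by rewrite ltr_pwDl ?sqr_ge0// exprn_gt0. Qed.

Lemma continuous_psin_integrand : continuous (fun u => e * rho h e u / (e ^+ 2 + u ^+ 2)).
Proof.
move=> s; have n2 : e ^+ 2 + s ^+ 2 != 0 by rewrite gt_eqF.
have D := isdM (isdZ e (is_derive_rho h_gt0 e s))
  (isdV (isdD (isdC (e ^+ 2) s 1) (is_derive_sq s)) n2).
exact: isd_cont D.
Qed.

Lemma lawlor_psi_max s : lawlor_psi cc ord_max s = psin s.
Proof.
apply: eq_prim => [|y y0]; first exact: continuous_psin_integrand.
rewrite invfM sqrt_lawlor_P// cc_max.
have n2 : e ^+ 2 + y ^+ 2 != 0 by rewrite gt_eqF.
by field; rewrite e_neq0 n2.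
Qed.

Definition rn s : R := Num.sqrt (e ^+ 2 + s ^+ 2).

Lemma rn_gt0 s : 0 < rn s. Proof. by rewrite sqrtr_gt0. Qed.

Lemma rn2 s : rn s ^+ 2 = e ^+ 2 + s ^+ 2. Proof. by rewrite sqr_sqrtr ?ltW. Qed.

Lemma is_derive_rnV s : is_derive s 1 (fun x => (rn x)^-1) (- s * (rn s)^-1 ^+ 3).
Proof.
have D := isdD (isdC (e ^+ 2) s 1) (is_derive_sq s).
apply: (isd_eq (@is_derive_rsqrt R (fun x => e ^+ 2 + x ^+ 2) s _ (e2s_gt0 s) D)).
by rewrite -/(rn s) add0r; congr (_ * _); field.
Qed.

Lemma is_derive_psin s : is_derive s 1 psin (e * rho h e s / (e ^+ 2 + s ^+ 2)).
Proof. exact: is_derive_prim continuous_psin_integrand. Qed.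

Lemma uu_vv_ode s :
  (s * vv h e s + e ^+ 2 * rho h e s * uu h e s = CC h e s * kap h e s * (e ^+ 2 + s ^+ 2)) /\
  (s * uu h e s - rho h e s * vv h e s = SS h e s * kap h e s * (e ^+ 2 + s ^+ 2)).
Proof.
have r2 := rho2 h e s; have q1 := qqE h s.
have E : s ^+ 2 * MM h e s + e ^+ 2 = qq h s * (e ^+ 2 + s ^+ 2).
  have pE : s ^+ 2 * (pp h).[s] = qq h s - 1 by rewrite q1 addrC addKr.
  transitivity (s ^+ 2 * qq h s + e ^+ 2 * (s ^+ 2 * (pp h).[s]) + e ^+ 2).
    by rewrite /MM; ring.
  by rewrite pE; ring.
rewrite /uu /vv /kap; split.
  transitivity (etaq h s * rho h e s * CC h e s * (s ^+ 2 * MM h e s + e ^+ 2)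
    + etaq h s * s * e ^+ 2 * SS h e s * (rho h e s ^+ 2 * MM h e s - 1)); first by ring.
  by rewrite E r2; ring.
transitivity (etaq h s * rho h e s * SS h e s * (s ^+ 2 * MM h e s + e ^+ 2)
  - etaq h s * s * CC h e s * (rho h e s ^+ 2 * MM h e s - 1)); first by ring.
by rewrite E r2; ring.
Qed.

Lemma uu0 : uu h e 0 = 1.
Proof.
rewrite /uu /CC /SS IS0 csz0 !mul0r add0r mulr1 /etaq qqE expr0n mul0r addr0.
by rewrite sqrtr1 invr1.
Qed.

Lemma rn0 : rn 0 = e.
Proof. by rewrite /rn expr0n addr0 sqrtr_sqr ger0_norm// ltW. Qed.

(* (e u + i v) exp (- i psi_n) / r_n is constant. *)
Lemma uu_vv_polar s :
  vv h e s = rn s * sin (psin s) /\ e * uu h e s = rn s * cos (psin s).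
Proof.
pose g1 x := (e * uu h e x * cos (psin x) + vv h e x * sin (psin x)) * (rn x)^-1.
pose g2 x := (vv h e x * cos (psin x) - e * uu h e x * sin (psin x)) * (rn x)^-1.
have Dco (x : R) := isd_comp1 (is_derive_psin x) (is_derive_cos (psin x)).
have Ds (x : R) := isd_comp1 (is_derive_psin x) (is_derive_sin (psin x)).
have Du (x : R) := isdZ e (is_derive_uu h_gt0 e x).
have Dv (x : R) := is_derive_vv h_gt0 e x.
have r0 (x : R) : rn x != 0 by rewrite gt_eqF// rn_gt0.
have D1 (x : R) : is_derive x 1 g1 0.
  apply: (isd_eq (isdM (isdD (isdM (Du x) (Dco x)) (isdM (Dv x) (Ds x))) (is_derive_rnV x))).
  have [k1 k2] := uu_vv_ode x; rewrite -rn2 in k1 k2 *; have rx := r0 x.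
  set k := kap h e x in k1 k2 *; set u := uu h e x in k1 k2 *.
  set v := vv h e x in k1 k2 *; set C := CC h e x in k1 *; set S := SS h e x in k2 *.
  set rr := rn x in k1 k2 rx *; set rh := rho h e x in k1 k2 *.
  transitivity (- e * cos (psin x) / rr ^+ 3 * (x * u - rh * v - S * k * rr ^+ 2)
    - sin (psin x) / rr ^+ 3 * (x * v + e ^+ 2 * rh * u - C * k * rr ^+ 2)).
    by field.
  by rewrite k1 k2 !subrr !mulr0 subrr.
have D2 (x : R) : is_derive x 1 g2 0.
  apply: (isd_eq (isdM (isdB (isdM (Dv x) (Dco x)) (isdM (Du x) (Ds x))) (is_derive_rnV x))).
  have [k1 k2] := uu_vv_ode x; rewrite -rn2 in k1 k2 *; have rx := r0 x.
  set k := kap h e x in k1 k2 *; set u := uu h e x in k1 k2 *.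
  set v := vv h e x in k1 k2 *; set C := CC h e x in k1 *; set S := SS h e x in k2 *.
  set rr := rn x in k1 k2 rx *; set rh := rho h e x in k1 k2 *.
  transitivity (e * sin (psin x) / rr ^+ 3 * (x * u - rh * v - S * k * rr ^+ 2)
    - cos (psin x) / rr ^+ 3 * (x * v + e ^+ 2 * rh * u - C * k * rr ^+ 2)).
    by field.
  by rewrite k1 k2 !subrr !mulr0 subrr.
have G1 : g1 s = 1.
  rewrite (isd_cst s D1) /g1 uu0 vv0 /psin prim0 cos0 sin0 rn0.
  by rewrite mulr0 addr0 !mulr1 divff.
have G2 : g2 s = 0.
  rewrite (isd_cst s D2) /g2 uu0 vv0 /psin prim0 sin0.
  by rewrite !mulr0 mul0r subrr mul0r.
have H1 : e * uu h e s * cos (psin s) + vv h e s * sin (psin s) = rn s.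
  by move/(congr1 ( *%R^~ (rn s))): G1; rewrite /g1 /= mulfVK// mul1r.
have H2 : vv h e s * cos (psin s) - e * uu h e s * sin (psin s) = 0.
  by move/(congr1 ( *%R^~ (rn s))): G2; rewrite /g2 /= mulfVK// mul0r.
have cs := cos2Dsin2 (psin s).
set c := cos _ in H1 H2 cs *; set d := sin _ in H1 H2 cs *.
set u := uu h e s in H1 H2 *; set v := vv h e s in H1 H2 *.
split.
  transitivity (v * (c ^+ 2 + d ^+ 2)); first by rewrite cs mulr1.
  by transitivity ((e * u * c + v * d) * d + c * (v * c - e * u * d));
    [ring|rewrite H1 H2 mulr0 addr0].
transitivity (e * u * (c ^+ 2 + d ^+ 2)); first by rewrite cs mulr1.
by transitivity ((e * u * c + v * d) * c - d * (v * c - e * u * d));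
  [ring|rewrite H1 H2 mulr0 subr0].
Qed.

Definition al j s : R := ckk h j e s * Num.sqrt (h j ^+ 2 + s ^+ 2).

Lemma lawlor_z_lift j s : lawlor_z cc (lift ord_max j) s =
  Complex (al j s) (e * (tau h j e s * al j s)).
Proof.
rewrite /lawlor_z eq_sym (negbTE (neq_lift _ _)) add0r lawlor_psi_lift cc_lift.
rewrite exprVn invrK; apply/eqP; rewrite eq_complex /= !mulr0 subr0 add0r.
rewrite /al /tau /ckk /cs eqxx /= -sn_e.
have c0 := ckk_neq0 h_gt0 ge j s; rewrite /ckk /cs in c0.
by apply/eqP; field.
Qed.

Lemma lawlor_z_max s : lawlor_z cc ord_max s = Complex (- vv h e s) (e * uu h e s).
Proof.
rewrite /lawlor_z eqxx lawlor_psi_max cc_max exprVn invrK.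
have [-> ->] := uu_vv_polar s.
apply/eqP; rewrite eq_complex /= !mulr0 subr0 add0r addrC cosDpihalf sinDpihalf.
by rewrite mulNr mulrC eqxx mulrC eqxx.
Qed.

Lemma al_gt0 j s : 0 < al j s.
Proof.
rewrite mulr_gt0 ?(ckk_gt0 h_gt0 ge)// sqrtr_gt0 ltr_pwDl ?sqr_ge0//.
by rewrite exprn_gt0.
Qed.

Lemma al2_aa j s : al j s ^+ 2 * aa h j e s = 1.
Proof.
have c0 := ckk_neq0 h_gt0 ge j s.
rewrite /al /aa exprMn sqr_sqrtr ?addr_ge0 ?sqr_ge0//.
transitivity (lam h j s * (h j ^+ 2 + s ^+ 2)); first by field.
exact: lamV.
Qed.

Lemma al_norm2 j s : al j s ^+ 2 + (e * (tau h j e s * al j s)) ^+ 2 = h j ^+ 2 + s ^+ 2.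
Proof.
have c0 := ckk_neq0 h_gt0 ge j s.
rewrite /al /tau.
transitivity ((ckk h j e s ^+ 2 + e ^+ 2 * sn e (II h j e s) ^+ 2) *
  Num.sqrt (h j ^+ 2 + s ^+ 2) ^+ 2); first by field.
by rewrite cs2sn2 mul1r sqr_sqrtr ?addr_ge0 ?sqr_ge0.
Qed.

Lemma max_norm2 s : (- vv h e s) ^+ 2 + (e * uu h e s) ^+ 2 = e ^+ 2 + s ^+ 2.
Proof.
have [-> ->] := uu_vv_polar s.
by rewrite sqrrN !exprMn -mulrDr addrC cos2Dsin2 mulr1 rn2.
Qed.

Lemma alN j s : al j (- s) = al j s.
Proof. by rewrite /al ckkN// sqrrN. Qed.

End LawlorNeck.

Section LawlorGraph.
Context {R : realType} {m : nat}.
Variable h : 'I_m -> R.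
Hypothesis h_gt0 : forall k, 0 < h k.
Local Notation V := 'rV[R]_m.+1.
Implicit Types (e s r : R) (x y v : V) (j : 'I_m).

Lemma nbhs_good : nbhs 0 [set e | good h e].
Proof.
have [e0 e00 He] := good_small h_gt0; apply/nbhs_ballP; exists e0 => //= e.
by rewrite /ball /= sub0r normrN; exact: He.
Qed.

Let Pgood e : [set e | good h e] e -> good h e. Proof. by []. Qed.

Definition chart_outer := chart_out h_gt0 nbhs_good Pgood.
Definition chart_cylinder := chart_cyl h_gt0 nbhs_good Pgood.

Lemma smooth_Fout e (c : R) : good h e ->
  smooth_on (outer_chart h) (fun x => c * Fout h e x).
Proof.
move=> ge; apply: smooth_onZ; first exact: open_outer_chart.
apply: (@Ck_smooth _ _ _ _ (open_outer_chart (h := h)) (Fout h) e _ ge) => k.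
exact: (Ck_Phi h_gt0 nbhs_good (open_outer_chart (h := h)) Pgood chart_outer).
Qed.

Lemma smooth_Fcyl e (c : R) : good h e ->
  smooth_on (cyl h) (fun x => c * Fcyl h e x).
Proof.
move=> ge; apply: smooth_onZ; first exact: open_cyl.
apply: (@Ck_smooth _ _ _ _ (open_cyl (h := h)) (Fcyl h) e _ ge) => k.
exact: (Ck_Phi h_gt0 nbhs_good (open_cyl (h := h)) Pgood chart_cylinder).
Qed.

Lemma glueF (F : V -> R) x : outer_chart h x -> inner_chart h x ->
  Num.sg (x 0 ord_max) * F x = Num.sg (x 0 ord_max) * F x.
Proof. by []. Qed.

(* [Fcyl_sg] makes [inner] equal to [c * Fcyl], hence smooth, across the disc. *)
Definition LZ2 (c e : R) : Z2fun h :=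
  MkZ2fun (@glueF (fun x => c * Fout h e x)).

Lemma inner_cases x : inner_chart h x -> cyl h x \/ xn x != 0.
Proof.
move=> ix; have [x0|x0] := eqVneq (xn x) 0; last by right.
by left; rewrite /cyl /= ltNge; apply/negP => le1; apply: ix.
Qed.

Lemma inner_LZ2 c e x : good h e -> cyl h x -> inner (LZ2 c e) x = c * Fcyl h e x.
Proof. by move=> ge cx; rewrite /= Fcyl_sg// mulrCA. Qed.

Definition half (a : R) : set V := [set x | 0 < a * xn x].

Lemma open_half a : open (half a).
Proof.
rewrite (_ : half a = (fun x => a * xn x) @^-1` [set r | 0 < r]); last by [].
apply: open_comp; last exact: open_gt.
move=> x _; apply: differentiable_continuous; apply: differentiableM.
  exact: differentiable_cst.
exact: differentiable_coord.
Qed.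

Lemma half_xn a x : half a x -> xn x != 0.
Proof. by rewrite /half /=; apply: contraTneq => ->; rewrite mulr0 ltxx. Qed.

Lemma half_sg x y : half (xn x) y -> Num.sg (xn y) = Num.sg (xn x).
Proof.
rewrite /half /= => xy; have [x0|x0|x0] := ltgtP (xn x) 0.
- by rewrite nmulr_rgt0// in xy; rewrite !ltr0_sg.
- by rewrite pmulr_rgt0// in xy; rewrite !gtr0_sg.
- by rewrite x0 mul0r ltxx in xy.
Qed.

Lemma smooth_LZ2 c e : good h e -> Z2smooth (LZ2 c e).
Proof.
move=> ge; split; first exact: smooth_Fout.
apply: smooth_on_local => x ix; have [cx|x0] := inner_cases ix.
  exists (cyl h), (fun y => c * Fcyl h e y); split => //; first exact: open_cyl.
    exact: smooth_Fcyl.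
  by move=> y cy; exact: inner_LZ2.
(* Off the cylinder x_n != 0, and on the half space containing x the sign in [inner] is constant. *)
exists (half (xn x)), (fun y => (Num.sg (xn x) * c) * Fout h e y); split.
- exact: open_half.
- by rewrite /half /= -expr2 lt_neqAle sqr_ge0 eq_sym sqrf_eq0 x0.
- apply: smooth_onS (smooth_Fout _ ge) => y hy.
  exact: xn_outer (half_xn hy).
- by move=> y hy /=; rewrite -/(xn y) (half_sg hy) mulrA.
Qed.

Lemma xj_ebase j j' : xj (ebase (lift ord_max j) : V) j' = (j' == j)%:R.
Proof. by rewrite /xj mxE eqxx /= (inj_eq lift_inj). Qed.

Lemma xn_ebase j : xn (ebase (lift ord_max j) : V) = 0.
Proof. by rewrite /xn mxE eqxx /= (negbTE (neq_lift _ _)). Qed.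

Lemma xj_ebase_max j : xj (ebase ord_max : V) j = 0.
Proof. by rewrite /xj mxE eqxx /= eq_sym (negbTE (neq_lift _ _)). Qed.

Lemma xn_ebase_max : xn (ebase ord_max : V) = 1.
Proof. by rewrite /xn mxE !eqxx. Qed.

Section FixedParameter.
Variable e : R.
Hypotheses (ge : good h e).

Lemma grad_Phi U S W c x : open U -> U x -> chart h [set e | good h e] U S W ->
  let g := grad (fun y => c * Phi h e y (S e y) (W e y)) x in
  (forall j, xj g j = c * (tau h j e (S e x) * xj x j)) /\
  xn g = - (c * (uu h e (S e x) * W e x)).
Proof.
move=> oU Ux ch g.
have D v := isdZ c (is_derive_Phi h_gt0 Pgood ch v ge Ux).
split => [j|]; rewrite /g /xj /xn mxE.
  case: (D (ebase (lift ord_max j))) => _ ->.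
  rewrite xn_ebase mulr0 subr0 (bigD1 j)//= big1 => [|j' j'j].
    by rewrite xj_ebase eqxx mulr1 addr0.
  by rewrite xj_ebase (negbTE j'j) mulr0.
case: (D (ebase ord_max)) => _ ->.
rewrite big1 => [|j _]; last by rewrite xj_ebase_max mulr0.
by rewrite xn_ebase_max mulr1 sub0r mulrN.
Qed.

Lemma branch_outer (F : Z2fun h) x : ~ disc h x -> branch F x = outer F.
Proof. by move=> nd; rewrite /branch memNset. Qed.

Lemma branch_inner (F : Z2fun h) x : disc h x -> branch F x = inner F.
Proof. by move=> nd; rewrite /branch mem_set. Qed.

Lemma disc_cyl x : disc h x -> ~ ellipsoid h x -> cyl h x.
Proof.
move=> [le1 xn0] nE; rewrite /cyl /= lt_neqAle le1 andbT; apply/eqP => E.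
exact: nE.
Qed.

Lemma grad_near_eq (f g : V -> R) x : (\near x, f x = g x) -> grad f x = grad g x.
Proof. by move=> fg; apply/rowP => i; rewrite !mxE; exact: near_eq_derive. Qed.

Lemma grad_outer c x : ~ disc h x ->
  let g := grad (branch (LZ2 c e) x) x in
  (forall j, xj g j = c * (tau h j e (Sout h e x) * xj x j)) /\
  xn g = - (c * (uu h e (Sout h e x) * Wout h e x)).
Proof.
move=> nd; rewrite branch_outer//.
exact: grad_Phi (open_outer_chart (h := h)) _ chart_outer.
Qed.

Lemma grad_inner c x : disc h x -> ~ ellipsoid h x ->
  let g := grad (branch (LZ2 c e) x) x in
  (forall j, xj g j = c * (tau h j e (Scyl h e x) * xj x j)) /\
  xn g = - (c * (uu h e (Scyl h e x) * Wcyl h e x)).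
Proof.
move=> dx nE; have cx := disc_cyl dx nE; rewrite branch_inner//.
rewrite (@grad_near_eq _ (fun y => c * Fcyl h e y)); last first.
  by apply: (near_U (open_cyl (h := h)) cx) => y cy; exact: inner_LZ2.
exact: grad_Phi (open_cyl (h := h)) cx chart_cylinder.
Qed.

Lemma rV_ext x y : (forall j, xj x j = xj y j) -> xn x = xn y -> x = y.
Proof.
move=> Ej En; apply/rowP => i; case: (unliftP ord_max i) => [j ->|->] //.
exact: Ej.
Qed.

Lemma sum_xj x : \sum_i x 0 i ^+ 2 = \sum_j xj x j ^+ 2 + xn x ^+ 2.
Proof. by rewrite (bigD1_ord ord_max)//= addrC. Qed.

End FixedParameter.
End LawlorGraph.

(** * The neck as the closure of the graph *)

Section NeckClosure.
Context {R : realType} {m : nat}.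
Variable h : 'I_m -> R.
Hypothesis h_gt0 : forall k, 0 < h k.
Local Notation V := 'rV[R]_m.+1.
Variable e : R.
Hypotheses (e0 : 0 < e) (ge : good h e).
Implicit Types (s r : R) (x y v w : V) (j : 'I_m).

Local Notation al := (al h e).
Local Notation neck := (@cotangent_to_C R m @^-1` lawlor_neck (cc h e)).

Definition npt w s : V * V :=
  (\row_k (if unlift ord_max k is Some j then al j s * xj w j else - vv h e s * xn w),
   \row_k (if unlift ord_max k is Some j then e * (tau h j e s * al j s) * xj w j
           else e * uu h e s * xn w)).

Lemma xj1 w s j : xj (npt w s).1 j = al j s * xj w j.
Proof. by rewrite /xj mxE liftK. Qed.
Lemma xn1 w s : xn (npt w s).1 = - vv h e s * xn w.
Proof. by rewrite /xn mxE unlift_none. Qed.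
Lemma xj2 w s j : xj (npt w s).2 j = e * (tau h j e s * al j s) * xj w j.
Proof. by rewrite /xj mxE liftK. Qed.
Lemma xn2 w s : xn (npt w s).2 = e * uu h e s * xn w.
Proof. by rewrite /xn mxE unlift_none. Qed.

Definition sphere : set V := [set w | \sum_i w 0 i ^+ 2 = 1].

Lemma neckP (p : V * V) : neck p <-> exists w s, sphere w /\ p = npt w s.
Proof.
have E w s k : lawlor_z (cc h e) k s * (w 0 k)%:C%C =
    Complex ((npt w s).1 0 k) ((npt w s).2 0 k).
  case: (unliftP ord_max k) => [j ->|->]; apply/eqP.
    rewrite lawlor_z_lift// eq_complex /= -/(xj (npt w s).1 j) -/(xj (npt w s).2 j) xj1 xj2.
    by rewrite -/(xj w j) !mulr0 subr0 add0r !eqxx.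
  rewrite lawlor_z_max// eq_complex /= -/(xn (npt w s).1) -/(xn (npt w s).2) xn1 xn2.
  by rewrite -/(xn w) !mulr0 subr0 add0r !eqxx.
split=> [[w [s [w1 /rowP Hz]]]|[w [s [w1 ->]]]]; exists w, s; split => //.
  case: p Hz => p1 p2 Hz; congr (_, _); apply/rowP => k;
    by have := Hz k; rewrite [LHS]mxE [RHS]mxE E => -[].
by apply/rowP => k; rewrite [LHS]mxE [RHS]mxE E.
Qed.

Lemma sphereE w : sphere w <-> \sum_j xj w j ^+ 2 + xn w ^+ 2 = 1.
Proof. by rewrite /sphere /= sum_xj. Qed.

(* The deck transformation of the double cover. *)
Definition flip w : V := \row_k (if k == ord_max then - w 0 k else w 0 k).

Lemma xj_flip w j : xj (flip w) j = xj w j.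
Proof. by rewrite /xj mxE eq_sym (negbTE (neq_lift _ _)). Qed.

Lemma xn_flip w : xn (flip w) = - xn w.
Proof. by rewrite /xn mxE eqxx. Qed.

Lemma sphere_flip w : sphere w -> sphere (flip w).
Proof.
move/sphereE => E; apply/sphereE; rewrite xn_flip sqrrN -E; congr (_ + _).
by apply: eq_bigr => j _; rewrite xj_flip.
Qed.

Lemma npt_flip w s : npt (flip w) (- s) = ((npt w s).1, - (npt w s).2).
Proof.
have Nj x j : xj (- x) j = - xj x j by rewrite /xj mxE.
have Nn x : xn (- x) = - xn x by rewrite /xn mxE.
congr (_, _); apply: rV_ext => [j|]; rewrite ?Nj ?Nn ?(xj1, xj2, xn1, xn2).
- by rewrite alN// xj_flip.
- by rewrite vvN// xn_flip; ring.
- by rewrite tauN// alN// xj_flip; ring.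
- by rewrite uuN// xn_flip; ring.
Qed.

Lemma chA_npt w s : chA h e (npt w s).1 s = \sum_j xj w j ^+ 2.
Proof.
apply: eq_bigr => j _; rewrite xj1 exprMn mulrAC.
by rewrite al2_aa// mul1r.
Qed.

Lemma graph_pm (F : Z2fun h) x y : two_valued_graph F (x, y) ->
  two_valued_graph F (x, - y).
Proof.
by move=> [nE [/= ->|/= ->]]; split => //=; [right|left; rewrite opprK].
Qed.

Lemma ellipsoid_disc x : ellipsoid h x -> disc h x.
Proof. by case=> E x0; split => //; rewrite E. Qed.

Lemma npt_pos_graph w s : sphere w -> 0 < s -> two_valued_graph (LZ2 h e e) (npt w s).
Proof.
move=> /sphereE sw s0; have v0 := vv_gt0 h_gt0 ge s0.
(* A point over the disc would have w_n = 0, hence chA = 1 at s > 0; but chA is strictly decreasing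
   from equatorial <= 1 at s = 0. *)
have nd : outer_chart h (npt w s).1.
  move=> [le1]; rewrite -/(xn _) xn1 => /eqP; rewrite mulf_eq0 oppr_eq0 (gt_eqF v0) /=.
  move=> /eqP wn0; rewrite wn0 expr0n addr0 in sw.
  have A1 : chA h e (npt w s).1 s = 1 by rewrite chA_npt.
  have [j xj0] : exists j, xj (npt w s).1 j != 0.
    by apply: (@chA_neq0 _ _ h e _ s); rewrite A1 oner_neq0.
  have : chA h e (npt w s).1 s < chA h e (npt w s).1 0.
    by apply: (chA_sdecr h_gt0 ge) => //; exists j.
  by rewrite A1 chA0 ltNge le1.
have HS : Sout h e (npt w s).1 = s.
  apply: (Sout_uniq h_gt0 ge nd s0).
  rewrite /Hout chA_npt xn1 mulNr sqrrN exprMn mulrAC divff ?mul1r//.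
  by rewrite expf_neq0// gt_eqF.
have HW : Wout h e (npt w s).1 = - xn w.
  by rewrite /Wout HS xn1 mulNr mulNr mulrAC divff ?mul1r// gt_eqF.
have [gj gn] := grad_outer h_gt0 ge e nd.
split; first by move/ellipsoid_disc.
left; apply: rV_ext => [j|].
  by rewrite gj HS xj2 xj1; ring.
by rewrite gn HS HW xn2; ring.
Qed.

Lemma npt_neq0_graph w s : sphere w -> s != 0 -> two_valued_graph (LZ2 h e e) (npt w s).
Proof.
move=> sw; rewrite neq_lt => /orP[s0|s0]; last exact: npt_pos_graph.
have := @npt_pos_graph (flip w) (- s) (sphere_flip sw).
rewrite oppr_gt0 npt_flip => /(_ s0) /graph_pm; rewrite opprK.
by case: (npt w s).
Qed.

Lemma graph_neck : two_valued_graph (LZ2 h e e) `<=` neck.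
Proof.
move=> [x y] [nE yE]; apply/neckP.
suff [w [s [sw E]]] : exists w s, sphere w /\ npt w s = (x, grad (branch (LZ2 h e e) x) x).
  case: yE => /= ->; first by exists w, s.
  exists (flip w), (- s); split; first exact: sphere_flip.
  by rewrite npt_flip E.
have [s [u [A Exn gj gn]]] : exists s u, [/\ chA h e x s + u ^+ 2 = 1,
    vv h e s * u = xn x,
    forall j, xj (grad (branch (LZ2 h e e) x) x) j = e * (tau h j e s * xj x j) &
    xn (grad (branch (LZ2 h e e) x) x) = - (e * (uu h e s * u))].
  have [dx|nd] := pselect (disc h x).
    have cx := disc_cyl dx nE; have [gj gn] := grad_inner h_gt0 ge e dx nE.
    exists (Scyl h e x), (Wcyl h e x); split => //; first exact: Wcyl_eq.
    exact: Wcyl_xn.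
  have [gj gn] := grad_outer h_gt0 ge e nd.
  exists (Sout h e x), (Wout h e x); split => //; first exact: Wout_eq.
  exact: Wout_xn.
pose w : V := \row_k (if unlift ord_max k is Some j then xj x j / al j s else - u).
have wj j : xj w j = xj x j / al j s by rewrite /xj mxE liftK.
have wn : xn w = - u by rewrite /xn mxE unlift_none.
have a0 j : al j s != 0 by rewrite gt_eqF// al_gt0.
exists w, s; split.
  apply/sphereE; rewrite wn sqrrN -A; congr (_ + _); apply: eq_bigr => j _.
  have a1 := al2_aa h_gt0 ge j s; have aj := a0 j; rewrite wj.
  rewrite expr_div_n; congr (_ * _).
  by apply: (mulfI (expf_neq0 2 aj)); rewrite a1 divff// expf_neq0.
have Ex : (npt w s).1 = x.
  apply: rV_ext => [j|]; first by rewrite xj1 wj mulrC divfK.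
  by rewrite xn1 wn mulrNN.
rewrite [LHS]surjective_pairing Ex; congr (_, _); apply: rV_ext => [j|].
  by rewrite xj2 wj gj; have aj := a0 j; field.
by rewrite xn2 wn gn; ring.
Qed.

Lemma cvg_rV {T : Type} {F : set_system T} {FF : Filter F} n (X : T -> 'rV[R]_n) (x : 'rV[R]_n) :
  (forall i, X t 0 i @[t --> F] --> x 0 i) -> X @ F --> x.
Proof.
move=> H A [Q HQ QA].
have HN : \forall t \near F, forall i : 'I_n, Q 0 i (X t 0 i).
  by apply: filter_forall => i; exact: H.
by apply: filterS HN => t Ht; apply: QA => i j; rewrite ord1; exact: Ht.
Qed.

Lemma npt_cvg {T : Type} {F : set_system T} {FF : Filter F} (w' : T -> V)
    (s' : T -> R) w s :
  w' @ F --> w -> s' @ F --> s -> npt (w' t) (s' t) @[t --> F] --> npt w s.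
Proof.
move=> ww ss.
have cal j : al j (s' t) @[t --> F] --> al j s.
  apply: cvgM.
    by apply: (continuous_cvg _ (isd_cont (is_derive_ckk h_gt0 j e s))).
  apply: (@continuous_cvg _ _ _ _ _ (fun t => h j ^+ 2 + s' t ^+ 2) Num.sqrt).
    exact: sqrt_continuous.
  by apply: cvgD; [exact: cvg_cst|exact: cvg_sqr].
have ctau j : tau h j e (s' t) @[t --> F] --> tau h j e s.
  by apply: (continuous_cvg _ (isd_cont (is_derive_tau h_gt0 (ckk_neq0 h_gt0 ge j s)))).
have cvv : vv h e (s' t) @[t --> F] --> vv h e s.
  by apply: (continuous_cvg _ (isd_cont (is_derive_vv h_gt0 e s))).
have cuu : uu h e (s' t) @[t --> F] --> uu h e s.
  by apply: (continuous_cvg _ (isd_cont (is_derive_uu h_gt0 e s))).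
have cw i : w' t 0 i @[t --> F] --> w 0 i by exact: cvg_coord.
have c1 : (npt (w' t) (s' t)).1 @[t --> F] --> (npt w s).1.
  apply: cvg_rV => i; under eq_fun do rewrite mxE; rewrite mxE.
  case: (unlift ord_max i) => [j|].
    by apply: cvgM; [exact: cal|exact: cw].
  by apply: cvgM; [exact: cvgN|exact: cw].
suff c2 : (npt (w' t) (s' t)).2 @[t --> F] --> (npt w s).2 by exact: (cvg_pair c1 c2).
apply: cvg_rV => i; under eq_fun do rewrite mxE; rewrite mxE.
case: (unlift ord_max i) => [j|].
- apply: cvgM; last exact: cw.
  by apply: cvgM; [exact: cvg_cst|apply: cvgM; [exact: ctau|exact: cal]].
- by apply: cvgM; [apply: cvgM; [exact: cvg_cst|exact: cuu]|exact: cw].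
Qed.

Lemma sum_sqr_ge0 (x : V) : 0 <= \sum_i x 0 i ^+ 2.
Proof. by apply: sumr_ge0 => i _; exact: sqr_ge0. Qed.

Definition nrm2 (p : V * V) : R := \sum_i p.1 0 i ^+ 2 + \sum_i p.2 0 i ^+ 2.

(** The squared modulus of the k-th coordinate is (c_k^-2 + s^2) w_k^2. So s is bounded on bounded
    parts of the neck, which makes the parametrization proper and the neck closed. *)
Lemma nrm2_npt w s : sphere w -> s ^+ 2 <= nrm2 (npt w s).
Proof.
move=> /sphereE sw; rewrite /nrm2 !sum_xj addrACA -big_split /=.
rewrite xn1 xn2 !exprMn -mulrDl -!exprMn.
have -> : \sum_j (xj (npt w s).1 j ^+ 2 + xj (npt w s).2 j ^+ 2) =
    \sum_j (h j ^+ 2 + s ^+ 2) * xj w j ^+ 2.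
  by apply: eq_bigr => j _; rewrite xj1 xj2 [X in X + _]exprMn [X in _ + X]exprMn
    -mulrDl al_norm2.
rewrite max_norm2// -[leLHS]mulr1 -sw mulrDr mulr_sumr lerD//.
  by apply: ler_sum => j _; rewrite ler_wpM2r ?sqr_ge0// lerDr sqr_ge0.
by rewrite ler_wpM2r ?sqr_ge0// lerDr sqr_ge0.
Qed.

Lemma nrm2_continuous : continuous nrm2.
Proof.
move=> p; apply: cvgD; apply: cvg_sumr => i; apply: cvg_sqr; apply: cvg_coord.
  exact: cvg_fst.
exact: cvg_snd.
Qed.

Lemma compact_sphere : compact sphere.
Proof.
apply: bounded_closed_compact.
  exists 1; split => // M M1 w /= sw.
  rewrite -[`|w|]/(mx_norm w) mx_normrE; apply/bigmax_leP; split; first by rewrite ltW// (lt_trans _ M1).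
  move=> [i j] _ /=; rewrite ord1; apply: le_trans (ltW M1).
  rewrite -(@ler_pXn2r _ 2) ?nnegrE// expr1n -normrX ger0_norm ?sqr_ge0// -sw.
  by rewrite (bigD1 j)//= lerDl sumr_ge0// => k _; exact: sqr_ge0.
rewrite (_ : sphere = (fun w : V => \sum_i w 0 i ^+ 2) @^-1` [set r | r = 1]); last by [].
apply: closed_comp; last exact: closed_eq.
move=> w _; apply: (@cvg_sumr R V (nbhs w) _ _ _ (fun i w => w 0 i ^+ 2)) => i.
by apply: (@cvg_sqr R V (nbhs w) _ (fun w => w 0 i)); exact: coord_continuous.
Qed.

Lemma closed_neck : closed neck.
Proof.
move=> p clp.
(* Near p one has s^2 <= nrm2 < M <= M^2, the last because M >= 1, so only parameters in [-M, M]
   matter. *)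
pose M := nrm2 p + 1.
have M1 : 1 <= M by rewrite lerDr addr_ge0 ?sum_sqr_ge0.
pose K := (fun z : V * R => npt z.1 z.2) @` (sphere `*` `[- M, M]%classic).
have cK : closed K.
  apply: compact_closed; first exact: norm_hausdorff.
  apply: continuous_compact.
    apply: continuous_subspaceT => z; apply: npt_cvg; [exact: cvg_fst|exact: cvg_snd].
  by apply: compact_setX; [exact: compact_sphere|exact: segment_compact].
have pK : K p.
  apply: cK => B Bp.
  have Nn : \forall q \near p, nrm2 q < M.
    by apply: (cvgr_lt _ (@nrm2_continuous p)); rewrite ltrDl.
  have [q [/neckP[w [s [sw ->]]] [Bq qM]]] := clp _ (filterI Bp Nn).
  exists (npt w s); split => //; exists (w, s) => //; split => //=.
  have s2 : s ^+ 2 < M ^+ 2.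
    apply: le_lt_trans (nrm2_npt s sw) (lt_le_trans qM _).
    by rewrite expr2 ler_peMl// (le_trans ler01).
  have M0 : 0 <= M := le_trans ler01 M1.
  rewrite in_itv /= -ler_norml -(@ler_pXn2r _ 2) ?nnegrE//.
  by rewrite real_normK ?num_real// ltW.
case: pK => -[w s] [/= sw _] <-; apply/neckP; by exists w, s.
Qed.

(** The points with s = 0 lie over the closed disc, and those with w_n = 0 over the ellipsoid
    itself, where the graph has no point. All of them are limits of points with s > 0. *)
Lemma npt_closure w s : sphere w -> closure (two_valued_graph (LZ2 h e e)) (npt w s).
Proof.
move=> sw; have [->|s0] := eqVneq s 0; last first.
  exact: subset_closure (npt_neq0_graph sw s0).
move=> B Bn.
have c : npt w s' @[s' --> (0 : R)] --> npt w 0.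
  by apply: npt_cvg; [exact: cvg_cst|exact: cvg_id].
have /nbhs_ballP[d /= d0 dB] := c _ Bn.
have d20 : 0 < d / 2 by rewrite divr_gt0.
exists (npt w (d / 2)); split; first exact: npt_pos_graph.
apply: dB; rewrite /ball /= sub0r normrN gtr0_norm//.
by rewrite ltr_pdivrMr// ltr_pMr// ltr1n.
Qed.

Lemma closure_graph : defines_lawlor_neck (LZ2 h e e) (cc h e).
Proof.
apply/seteqP; split.
  by rewrite closureE; apply: smallest_sub; [exact: closed_neck|exact: graph_neck].
by move=> p /neckP[w [s [sw ->]]]; exact: npt_closure.
Qed.

End NeckClosure.

(** * The limit potential: harmonicity and asymptotics *)

Section Harmonic.
Context {R : realType} {m : nat}.
Variable h : 'I_m -> R.
Hypothesis h_gt0 : forall k, 0 < h k.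
Local Notation V := 'rV[R]_m.+1.
Implicit Types (s r : R) (x y v w : V) (j : 'I_m).

Lemma CC0 s : CC h 0 s = 1. Proof. exact: cs0. Qed.
Lemma SS0 s : SS h 0 s = IS h 0 s. Proof. exact: sn0. Qed.
Lemma tau0 j s : tau h j 0 s = II h j 0 s.
Proof. by rewrite /tau ckk0 sn0 divr1. Qed.
Lemma aa_lam j s : aa h j 0 s = lam h j s.
Proof. by rewrite /aa ckk0 expr1n divr1. Qed.
Lemma bb_lam j s : bb h j 0 s = lam h j s * s.
Proof. by rewrite /bb expr0n !mul0r subr0. Qed.
Lemma MM0 s : MM h 0 s = qq h s.
Proof. by rewrite /MM expr0n mul0r addr0. Qed.
Lemma rho_eta s : rho h 0 s = etaq h s.
Proof. by rewrite /rho MM0. Qed.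
Lemma kap0 s : kap h 0 s = 1.
Proof. by rewrite /kap rho_eta mulrC mulrA mulrAC -expr2 eta2. Qed.
Lemma vv_id s : vv h 0 s = s.
Proof.
rewrite /vv CC0 expr0n mul0r subr0 mulr1 MM0 rho_eta.
by transitivity (s * (etaq h s ^+ 2 * qq h s)); [ring|rewrite eta2 mulr1].
Qed.
Lemma uu0E s : uu h 0 s = s * IS h 0 s + etaq h s.
Proof.
rewrite /uu CC0 SS0 MM0 rho_eta.
by transitivity (s * (etaq h s ^+ 2 * qq h s) * IS h 0 s + etaq h s);
  [ring|rewrite eta2 mulr1].
Qed.
Lemma chB0E x s : chB h 0 x s = s * \sum_j xj x j ^+ 2 * lam h j s ^+ 2.
Proof.
rewrite mulr_sumr; apply: eq_bigr => j _; rewrite aa_lam bb_lam; ring.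
Qed.

Let Pgood e : [set e | good h e] e -> good h e. Proof. by []. Qed.

(** At e = 0 the gradient is (II_j x_j, - u w) with u = s IS + etaq, and D = w^2 + s B. In the
    divergence the terms in IS give IS (1 - (w^2 + s B) / D) = 0, and those in etaq are etaq B / D
    from the first coordinates and its opposite from the last. *)
Lemma laplacian_Phi U S W x : open U -> U x -> chart h [set e | good h e] U S W ->
  laplacian (fun y => Phi h 0 y (S 0 y) (W 0 y)) x = 0.
Proof.
move=> oU Ux ch; have g0 := good0 h.
have DPhi v y : U y -> is_derive y v (fun y => Phi h 0 y (S 0 y) (W 0 y))
    (\sum_j tau h j 0 (S 0 y) * xj y j * xj v j - uu h 0 (S 0 y) * W 0 y * xn v).
  by move=> Uy; exact: (is_derive_Phi h_gt0 Pgood ch v g0 Uy).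
have Dj j y : U y -> 'D_(ebase (lift ord_max j)) (fun y => Phi h 0 y (S 0 y) (W 0 y)) y
    = tau h j 0 (S 0 y) * xj y j.
  move=> Uy; case: (DPhi (ebase (lift ord_max j)) y Uy) => _ ->.
  rewrite xn_ebase mulr0 subr0 (bigD1 j)//= big1 => [|j' j'j].
    by rewrite xj_ebase eqxx mulr1 addr0.
  by rewrite xj_ebase (negbTE j'j) mulr0.
have Dn y : U y -> 'D_(ebase ord_max) (fun y => Phi h 0 y (S 0 y) (W 0 y)) y
    = - (uu h 0 (S 0 y) * W 0 y).
  move=> Uy; case: (DPhi (ebase ord_max) y Uy) => _ ->.
  rewrite big1 => [|j _]; last by rewrite xj_ebase_max mulr0.
  by rewrite xn_ebase_max mulr1 sub0r.
have dS := chart_dS ch g0 Ux; have DS v := chart_DS ch v g0 Ux.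
have DW v := chart_DW ch v g0 Ux; have D0 := chart_D ch g0 Ux.
set s := S 0 x in DS DW D0; set w := W 0 x in DS DW D0.
have DE : chD h 0 x s w = w ^+ 2 + s * chB h 0 x s.
  by rewrite /chD CC0 kap0 vv_id !mul1r.
rewrite /laplacian (bigD1_ord ord_max)//=.
rewrite (near_eq_derive _ (near_U oU Ux Dn)).
case: (isdN (isdM (isd_comp dS (DS (ebase ord_max)) (is_derive_uu h_gt0 0 s))
  (DW (ebase ord_max)))) => _ ->.
have Lmax : chL h 0 x s (ebase ord_max) = 0.
  by apply: big1 => j _; rewrite xj_ebase_max mulr0.
have Lj j : chL h 0 x s (ebase (lift ord_max j)) = lam h j s * xj x j.
  rewrite /chL (bigD1 j)//= big1 => [|j' j'j].
    by rewrite xj_ebase eqxx mulr1 addr0 aa_lam.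
  by rewrite xj_ebase (negbTE j'j) mulr0.
rewrite (eq_bigr (fun j => II h j 0 s + etaq h s / chD h 0 x s w * s
   * (xj x j ^+ 2 * lam h j s ^+ 2))); last first.
  move=> j _; rewrite (near_eq_derive _ (near_U oU Ux (Dj j))).
  case: (isdM (isd_comp dS (DS (ebase (lift ord_max j)))
    (is_derive_tau h_gt0 (ckk_neq0 h_gt0 g0 j s)))
    (is_derive_coord x (ebase (lift ord_max j)) (lift ord_max j))) => _ ->.
  rewrite xn_ebase mulr0 addr0 Lj -/(xj (ebase (lift ord_max j) : V) j) xj_ebase eqxx.
  by rewrite -/(xj x j) -/s vv_id rho_eta aa_lam tau0 mulr1; field.
rewrite big_split /= -mulr_sumr -/(IS h 0 s) Lmax xn_ebase_max.
rewrite kap0 uu0E SS0 !mulr0 subr0 add0r !mulr1.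
have -> : etaq h s / chD h 0 x s w * s * \sum_j xj x j ^+ 2 * lam h j s ^+ 2 =
  etaq h s / chD h 0 x s w * chB h 0 x s by rewrite chB0E; ring.
rewrite -/s -/w; rewrite DE in D0 *.
by field.
Qed.

End Harmonic.

(** * Improper integrals and the coefficients of the expansion *)

Section ImproperIntegral.
Context {R : realType}.
Local Notation mu := (@lebesgue_measure R).
Variables (g : R -> R) (K1 : R).
Hypotheses (cg : continuous g) (g0 : forall u, 0 <= g u).

Lemma prim_tail (K s t : R) : 0 < s -> (forall u, s <= u -> g u <= K / u ^+ 2) ->
  prim g t <= prim g s + K / s.
Proof.
move=> s0 gK.
have K0 : 0 <= K.
  have := le_trans (g0 s) (gK s (lexx s)).
  by rewrite pmulr_lge0// invr_gt0 exprn_gt0.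
have [/ltW ts|st] := ltrP t s.
  apply: (@le_trans _ _ (prim g s)); last by rewrite lerDl divr_ge0// ltW.
  by apply: (isd_le ts (fun x _ => is_derive_prim x cg)) => x _.
have D (x : R) : s <= x <= t -> is_derive x 1 (fun x => - (K * x^-1) - prim g x)
    (K / x ^+ 2 - g x).
  move=> /andP[sx _]; have x0 : x != 0 by rewrite gt_eqF// (lt_le_trans s0).
  apply: (isd_eq (isdB (isdN (isdZ K (isdV (is_derive_id x 1) x0))) (is_derive_prim x cg))).
  by rewrite mulNr mulrN opprK mul1r.
have H x : s <= x <= t -> 0 <= K / x ^+ 2 - g x.
  by move=> /andP[sx _]; rewrite subr_ge0 gK.
have {}H := isd_le st D H.
have : 0 <= K * t^-1 by rewrite mulr_ge0// invr_ge0 (le_trans (ltW s0)).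
by lra.
Qed.

Hypothesis gK1 : forall u, 1 <= u -> g u <= K1 / u ^+ 2.

(** The primitive of g >= 0 is monotone, so the supremum is its limit; [Rintegral_prim] identifies
    it with the Lebesgue integral over the half line. *)
Definition prim_oo : R := sup (range (prim g)).

Lemma prim_ubound : has_ubound (range (prim g)).
Proof.
exists (prim g 1 + K1 / 1) => _ [t _ <-].
by apply: prim_tail => //; exact: ltr01.
Qed.

Lemma prim_le_oo s : prim g s <= prim_oo.
Proof. by apply: ub_le_sup; [exact: prim_ubound|exists s]. Qed.

Lemma prim_oo_tail (K s : R) : 0 < s -> (forall u, s <= u -> g u <= K / u ^+ 2) ->
  `|prim g s - prim_oo| <= K / s.
Proof.
move=> s0 gK; rewrite distrC ger0_norm ?subr_ge0 ?prim_le_oo// lerBlDl.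
apply: ge_sup; first by exists (prim g 0), 0.
by move=> _ [t _ <-]; exact: prim_tail.
Qed.

Lemma prim_cvg_oo : prim g s @[s --> +oo] --> prim_oo.
Proof.
apply: nondecreasing_cvgr; last exact: prim_ubound.
move=> s t st; apply: (isd_le st (fun x _ => is_derive_prim x cg)) => x _.
exact: g0.
Qed.

Lemma Rintegral_prim (c : R) : 0 <= c ->
  (\int[mu]_(u in `[0%R, +oo[) (c * g u))%R = c * prim_oo.
Proof.
move=> c0.
have D (x : R) : is_derive x 1 (fun x => c * prim g x) (c * g x).
  exact: isdZ (is_derive_prim x cg).
rewrite (@Rintegral_ge0_continuous_FTC2y R (fun u => c * g u) (fun x => c * prim g x) 0 (c * prim_oo)).
- by rewrite prim0 mulr0 subr0.
- by move=> x _; rewrite mulr_ge0.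
- apply: continuous_subspaceT => x; apply: cvgM; [exact: cvg_cst|exact: cg].
- by apply: cvgM; [exact: cvg_cst|exact: prim_cvg_oo].
- by move=> x _; case: (D x).
- by apply: cvg_at_right_filter; exact: isd_cont (D 0).
- by move=> x _; rewrite derive1E; case: (D x) => _ ->.
Qed.

End ImproperIntegral.

Section Asymptotics.
Context {R : realType} {m : nat}.
Variable h : 'I_m -> R.
Hypothesis h_gt0 : forall k, 0 < h k.
Hypothesis m2 : (2 <= m)%N.
Local Notation V := 'rV[R]_m.+1.
Implicit Types (s r u : R) (x y v w : V) (j : 'I_m).

(** Two factors of [qq] already give u^4 / (h_0 h_1)^2; for these two factors n must be at least 3.
    The decay makes the integral of etaq converge. *)
Lemma etaq_decay : exists2 C : R, 0 < C & forall u, 0 < u -> etaq h u <= C / u ^+ 2.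
Proof.
pose i0 : 'I_m := Ordinal (ltnW m2); pose i1 : 'I_m := Ordinal m2.
exists (h i0 * h i1) => [|u u0]; first exact: mulr_gt0.
have f1 j : 1 <= 1 + (h j)^-1 ^+ 2 * u ^+ 2 by rewrite lerDl mulr_ge0// sqr_ge0.
have q4 : (u ^+ 2 / (h i0 * h i1)) ^+ 2 <= qq h u.
  rewrite /qq (bigD1 i0)//= (bigD1 i1)//=.
  have -> : (u ^+ 2 / (h i0 * h i1)) ^+ 2 =
     (h i0)^-1 ^+ 2 * u ^+ 2 * ((h i1)^-1 ^+ 2 * u ^+ 2 * 1).
    by field; rewrite !gt_eqF.
  have p1 : 1 <= \prod_(i < m | (i != i0) && (i != i1)) (1 + (h i)^-1 ^+ 2 * u ^+ 2).
    by elim/big_ind: _ => // a b a1 b1; rewrite -[1]mulr1 ler_pM.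
  have sq0 j : 0 <= (h j)^-1 ^+ 2 * u ^+ 2 by rewrite mulr_ge0// sqr_ge0.
  apply: ler_pM => //; first by rewrite mulr_ge0// mulr_ge0 ?ler01.
    by rewrite lerDr ler01.
  by apply: ler_pM => //; rewrite ?lerDr ler01.
have a0 : 0 < u ^+ 2 / (h i0 * h i1) by rewrite divr_gt0 ?exprn_gt0 ?mulr_gt0.
rewrite -invf_div /etaq lef_pV2 ?posrE ?sqrtr_gt0 ?qq_gt0//.
have <- : Num.sqrt ((u ^+ 2 / (h i0 * h i1)) ^+ 2) = u ^+ 2 / (h i0 * h i1).
  by rewrite sqrtr_sqr ger0_norm// ltW.
exact: ler_wsqrtr.
Qed.

Let gJ u : R := rho h 0 u.
Let gI j u : R := rho h 0 u * lam h j u.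

Lemma gJ_ge0 u : 0 <= gJ u. Proof. by rewrite ltW// rho_gt0. Qed.

Lemma lam_le_sq j u : u != 0 -> lam h j u <= (u ^+ 2)^-1.
Proof.
move=> u0; have u2 : 0 < u ^+ 2 by rewrite lt_neqAle sqr_ge0 eq_sym sqrf_eq0 u0.
by rewrite lef_pV2 ?posrE// ?lerDr ?sqr_ge0// addr_gt0// exprn_gt0.
Qed.

Lemma rho_decay : exists2 C : R, 0 < C & forall u, 0 < u ->
  gJ u <= C / u ^+ 2 /\ forall j s, 0 < s -> s <= u -> gI j u <= C / s ^+ 2 / u ^+ 2.
Proof.
have [C C0 HC] := etaq_decay; exists C => // u u0.
have J : gJ u <= C / u ^+ 2 by rewrite /gJ rho_eta HC.
split => // j s s0 su; rewrite /gI mulrAC; apply: ler_pM => //.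
- exact: gJ_ge0.
- by rewrite ltW// lam_gt0.
apply: (le_trans (lam_le_sq j _)); first by rewrite gt_eqF.
by rewrite lef_pV2 ?posrE ?exprn_gt0// ler_pXn2r ?nnegrE ?(ltW s0) ?(ltW u0).
Qed.

Definition Joo : R := prim_oo gJ.
Definition Ioo j : R := prim_oo (gI j).

(** On [s, oo) the factor lam <= s^-2 gains two powers of s over the tail of [JJ]. They compensate
    the factor x_j^2 = O(s^2) that multiplies II_j in the potential. *)
Lemma tails : exists2 C : R, 0 < C & forall s, 0 < s ->
  `|JJ h 0 s - Joo| <= C / s /\ forall j, `|II h j 0 s - Ioo j| <= C / s ^+ 3.
Proof.
have [C C0 HC] := rho_decay; exists C => // s s0; split.
  apply: (@prim_oo_tail _ gJ C) => //; first exact: continuous_rho.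
  - exact: gJ_ge0.
  - by move=> u u1; exact: (HC u (lt_le_trans ltr01 u1)).1.
  - by move=> u su; exact: (HC u (lt_le_trans s0 su)).1.
move=> j; rewrite exprS invfM mulrA mulrAC.
apply: (@prim_oo_tail _ (gI j) C) => //; first exact: continuous_rholam.
- by move=> u; exact: rho_lam_ge0.
- move=> u u1; have := (HC u (lt_le_trans ltr01 u1)).2 j 1 ltr01 u1.
  by rewrite expr1n divr1.
- by move=> u su; exact: (HC u (lt_le_trans s0 su)).2.
Qed.

(** The product of the h_k in front of the integrals cancels this factor, so a_0 and the a_j are
    half the total integrals of rho and rho lam_j at e = 0. *)
Lemma sqrt_Spoly u : Num.sqrt (Spoly h (u ^+ 2)) = (\prod_k h k) * Num.sqrt (qq h u).
Proof.
have p0 : 0 < \prod_k h k by apply: prodr_gt0 => k _.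
rewrite -[X in X * _](gtr0_norm p0) -sqrtr_sqr -sqrtrM ?sqr_ge0//.
congr Num.sqrt; rewrite /Spoly /qq -prodrXl -big_split /=; apply: eq_bigr => k _.
by field; rewrite gt_eqF.
Qed.

Lemma coef_a0E : coef_a0 h = Joo / 2.
Proof.
have p0 : 0 < \prod_k h k by apply: prodr_gt0 => k _.
have [C C0 HC] := rho_decay; rewrite /coef_a0.
set I := Rintegral _ _ _.
have -> : I = (\int[@lebesgue_measure R]_(u in `[0%R, +oo[) ((\prod_k h k)^-1 * gJ u))%R.
  apply: eq_Rintegral.
  by move=> u _; rewrite sqrt_Spoly invfM /gJ rho_eta.
rewrite (@Rintegral_prim _ gJ C) ?invr_ge0 ?ltW//.
- by rewrite /Joo; field; rewrite gt_eqF.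
- exact: continuous_rho.
- exact: gJ_ge0.
- by move=> u u1; exact: (HC u (lt_le_trans ltr01 u1)).1.
Qed.

Lemma coef_aE j : coef_a h j = Ioo j / 2.
Proof.
have p0 : 0 < \prod_k h k by apply: prodr_gt0 => k _.
have [C C0 HC] := rho_decay; rewrite /coef_a.
set I := Rintegral _ _ _.
have -> : I = (\int[@lebesgue_measure R]_(u in `[0%R, +oo[) ((\prod_k h k)^-1 * gI j u))%R.
  apply: eq_Rintegral.
  move=> u _; rewrite sqrt_Spoly /gI rho_eta /lam invfM [X in _ * X]invfM /etaq.
  by rewrite addrC; ring.
rewrite (@Rintegral_prim _ (gI j) C) ?invr_ge0 ?ltW//.
- by rewrite /Ioo; field; rewrite gt_eqF.
- exact: continuous_rholam.
- by move=> u; exact: rho_lam_ge0.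
- move=> u u1; have := (HC u (lt_le_trans ltr01 u1)).2 j 1 ltr01 u1.
  by rewrite expr1n divr1.
Qed.

End Asymptotics.

Section Decay.
Context {R : realType} {m : nat}.
Variable h : 'I_m -> R.
Hypothesis h_gt0 : forall k, 0 < h k.
Hypothesis m2 : (2 <= m)%N.
Local Notation V := 'rV[R]_m.+1.
Implicit Types (s r u : R) (x y v w : V) (j : 'I_m).

Lemma sqr_enorm x : enorm x ^+ 2 = \sum_j xj x j ^+ 2 + xn x ^+ 2.
Proof. by rewrite sqr_sqrtr ?sumr_ge0// => [|i _]; rewrite ?sum_xj// sqr_ge0. Qed.

Section OuterPoint.
Variable x : V.
Hypothesis ox : outer_chart h x.
Let s := Sout h 0 x.

Lemma Sout_gt0 : 0 < s. Proof. by case: (SoutP h_gt0 (good0 h) ox). Qed.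

Lemma Sout0_eq : \sum_j xj x j ^+ 2 * lam h j s + xn x ^+ 2 / s ^+ 2 = 1.
Proof.
have [_ ] := SoutP h_gt0 (good0 h) ox; rewrite -/s /Hout vv_id// => <-.
by congr (_ + _); apply: eq_bigr => j _; rewrite aa_lam.
Qed.

Lemma xj_le_Sout j : xj x j ^+ 2 <= h j ^+ 2 + s ^+ 2.
Proof.
have l0 := lam_gt0 h_gt0 j s; have s0 := Sout_gt0.
rewrite -[leRHS]mul1r -ler_pdivrMr ?addr_gt0 ?exprn_gt0//; rewrite -/(lam h j s) -Sout0_eq.
rewrite (bigD1 j)//= -addrA lerDl addr_ge0//.
  by apply: sumr_ge0 => k _; rewrite mulr_ge0 ?sqr_ge0// ltW// lam_gt0.
by rewrite divr_ge0// sqr_ge0.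
Qed.

Lemma xn_le_Sout : xn x ^+ 2 <= s ^+ 2.
Proof.
have s0 := Sout_gt0; rewrite -[leRHS]mul1r -ler_pdivrMr ?exprn_gt0// -Sout0_eq lerDr.
by apply: sumr_ge0 => k _; rewrite mulr_ge0 ?sqr_ge0// ltW// lam_gt0.
Qed.

Lemma Fout0E : Fout h 0 x = 1 / 2 * (- JJ h 0 s + \sum_j II h j 0 s * xj x j ^+ 2
  - (IS h 0 s + etaq h s / s) * xn x ^+ 2).
Proof.
have s0 : s != 0 by rewrite gt_eqF// Sout_gt0.
rewrite /Fout /Phi /Wout vv_id// uu0E// -/s.
rewrite (eq_bigr (fun j => II h j 0 s * xj x j ^+ 2)) => [|j _]; last by rewrite tau0.
by field.
Qed.

(** Because a_n = - sum a_j, and uu contains s IS, every tail of II_j is multiplied by x_j^2 -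
    x_n^2. The sum, not the difference, is small: the limit potential tends to minus the
    polynomial. *)
Lemma Fout0_asymptotic : Fout h 0 x + asymptotic_poly h x =
  1 / 2 * ((Joo h - JJ h 0 s) + \sum_j (II h j 0 s - Ioo h j) * (xj x j ^+ 2 - xn x ^+ 2)
    - etaq h s / s * xn x ^+ 2).
Proof.
have -> : asymptotic_poly h x = Joo h / 2 - (\sum_j Ioo h j / 2 * xj x j ^+ 2
   - (\sum_j Ioo h j / 2) * xn x ^+ 2).
  have E j : coef_a h j = Ioo h j / 2 by rewrite coef_aE.
  rewrite /asymptotic_poly coef_a0E// /coef_an mulNr.
  by congr (_ - (_ - _ * _)); apply: eq_bigr => j _; rewrite E.
rewrite Fout0E.
have -> : \sum_j (II h j 0 s - Ioo h j) * (xj x j ^+ 2 - xn x ^+ 2) =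
  \sum_j II h j 0 s * xj x j ^+ 2 - 2 * (\sum_j Ioo h j / 2 * xj x j ^+ 2)
   - (IS h 0 s - 2 * \sum_j Ioo h j / 2) * xn x ^+ 2.
  rewrite /IS !mulr_sumr -!sumrB mulr_suml -sumrB; apply: eq_bigr => j _.
  by field.
by field; rewrite gt_eqF// Sout_gt0.
Qed.

End OuterPoint.

Lemma Fout0_decay : exists2 K : R, 0 < K & forall x, outer_chart h x ->
  1 <= Sout h 0 x -> `|Fout h 0 x + asymptotic_poly h x| <= K / Sout h 0 x.
Proof.
have [C C0 HC] := tails h_gt0 m2; have [D D0 HD] := etaq_decay h_gt0 m2.
(* One summand for each term of [Fout0_asymptotic]; the middle one uses |x_j^2 - x_n^2| <= (h_j^2 +
   2) s^2 for s >= 1. *)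
pose K := C + \sum_(j < m) C * (h j ^+ 2 + 2) + D.
have Kj j : 0 <= C * (h j ^+ 2 + 2) by rewrite mulr_ge0 ?(ltW C0)// addr_ge0// sqr_ge0.
have K0 : 0 < K.
  by rewrite /K ltr_wpDl// addr_ge0 ?(ltW C0)// sumr_ge0.
exists K => // x ox s1; have s0 := lt_le_trans ltr01 s1.
rewrite Fout0_asymptotic//; have [HJ HI] := HC _ s0; have He := HD _ s0.
have xjs := xj_le_Sout ox; have xns := xn_le_Sout ox.
set s := Sout h 0 x in s1 s0 HJ HI He xjs xns *.
have sV0 : 0 <= s^-1 by rewrite invr_ge0 ltW.
rewrite normrM ger0_norm; last by rewrite divr_ge0.
apply: (@le_trans _ _ (K / s * 1)); last by rewrite mulr1.
rewrite mulrC; apply: ler_pM => //; last by lra.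
apply: le_trans (ler_normB _ _) _; rewrite /K 2!mulrDl; apply: lerD.
  apply: le_trans (ler_normD _ _) _; apply: lerD; first by rewrite distrC.
  apply: le_trans (ler_norm_sum _ _ _) _; rewrite mulr_suml; apply: ler_sum => j _.
  rewrite normrM.
  apply: (@le_trans _ _ (C / s ^+ 3 * ((h j ^+ 2 + 2) * s ^+ 2))).
    apply: ler_pM => //; have := xjs j; have := sqr_ge0 (h j); have := sqr_ge0 (xj x j).
    have := sqr_ge0 (xn x); have s21 : 1 <= s ^+ 2 by rewrite expr_ge1// ltW.
    have : 0 <= h j ^+ 2 * (s ^+ 2 - 1) by rewrite mulr_ge0 ?sqr_ge0// subr_ge0.
    by rewrite ler_norml; nra.
  by rewrite le_eqVlt; apply/orP; left; apply/eqP; field; rewrite gt_eqF.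
have e0 := ltW (eta_gt0 h s).
rewrite ger0_norm; last by rewrite mulr_ge0 ?sqr_ge0// mulr_ge0.
apply: (@le_trans _ _ (D / s ^+ 2 / s * s ^+ 2)).
  by apply: ler_pM => //; rewrite ?sqr_ge0 ?mulr_ge0// ler_wpM2r.
by rewrite le_eqVlt; apply/orP; left; apply/eqP; field; rewrite gt_eqF.
Qed.

(** The point x lies on an ellipsoid of squared semi-axes h_j^2 + s^2 and s^2, so |x|^2 is at most
    their sum and s is large when |x| is. *)
Lemma far_outer (N : R) : exists2 rho : R, 0 < rho & forall x, rho <= enorm x ->
  outer_chart h x /\ N <= Sout h 0 x.
Proof.
pose N1 := `|N| + 1; pose Q := (\sum_j (h j ^+ 2 + N1 ^+ 2)) + N1 ^+ 2.
have N10 : 0 < N1 by rewrite ltr_wpDl.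
have Q0 : 0 < Q.
  by rewrite ltr_wpDl ?exprn_gt0// sumr_ge0// => j _; rewrite addr_ge0 ?sqr_ge0.
exists (Num.sqrt Q + 1) => [|x rx]; first by rewrite ltr_wpDl// sqrtr_ge0.
have xQ : Q < enorm x ^+ 2.
  rewrite -[ltLHS]sqr_sqrtr ?(ltW Q0)// ltr_pXn2r// ?nnegrE ?sqrtr_ge0//.
  by apply: lt_le_trans rx; rewrite ltrDl.
have ox : outer_chart h x.
  move=> [eq1 xn0]; move: xQ; rewrite ltNge => /negP; apply.
  rewrite sqr_enorm /xn xn0 expr0n addr0 /Q -[leLHS]addr0; apply: lerD; last exact: sqr_ge0.
  apply: ler_sum => j _; apply: (@le_trans _ _ (h j ^+ 2)); last by rewrite lerDl sqr_ge0.
  rewrite -[leRHS]mul1r -ler_pdivrMr ?exprn_gt0//; apply: le_trans eq1.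
  rewrite /equatorial (bigD1 j)//= lerDl sumr_ge0// => k _.
  by rewrite divr_ge0 ?sqr_ge0.
split => //; rewrite leNgt; apply/negP => sN.
have s0 := Sout_gt0 ox.
have sN1 : Sout h 0 x ^+ 2 <= N1 ^+ 2.
  rewrite ler_pXn2r ?nnegrE ?(ltW s0) ?(ltW N10)//.
  by apply: le_trans (ltW sN) _; apply: le_trans (ler_norm N) _; rewrite lerDl.
move: xQ; rewrite ltNge => /negP; apply; rewrite sqr_enorm; apply: lerD.
  apply: ler_sum => j _; apply: le_trans (xj_le_Sout ox j) _.
  by rewrite lerD2l.
exact: le_trans (xn_le_Sout ox) sN1.
Qed.

Lemma Fout0_cvg_oo (d : R) : 0 < d -> exists2 rho : R, 0 < rho & forall x,
  rho <= enorm x -> outer_chart h x /\ `|Fout h 0 x + asymptotic_poly h x| <= d.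
Proof.
move=> d0; have [K K0 HK] := Fout0_decay.
have [rho r0 Hr] := far_outer (1 + K / d); exists rho => // x /Hr[ox Ns].
have Kd : 0 < K / d by rewrite divr_gt0.
have s1 : 1 <= Sout h 0 x by apply: le_trans Ns; rewrite lerDl ltW.
have s0 := lt_le_trans ltr01 s1.
split => //; apply: le_trans (HK x ox s1) _.
rewrite ler_pdivrMr// mulrC -ler_pdivrMr//; apply: le_trans Ns.
by rewrite lerDr.
Qed.

End Decay.

(** * The limit potential vanishes along the ellipsoid *)

Section NearEllipsoid.
Context {R : realType} {m : nat}.
Variable h : 'I_m -> R.
Hypothesis h_gt0 : forall k, 0 < h k.
Local Notation V := 'rV[R]_m.+1.
Implicit Types (e s r u : R) (x y v w p : V) (j : 'I_m).

Lemma Hout_cvg {T : Type} {F : set_system T} {FF : Filter F} (X : T -> V) x e s :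
  X @ F --> x -> Hout h e (X t) s @[t --> F] --> Hout h e x s.
Proof.
move=> Xx; have cX i : X t 0 i @[t --> F] --> x 0 i by exact: cvg_coord.
apply: cvgD; last by apply: cvgM (cvg_sqr (cX ord_max)) _; exact: cvg_cst.
by apply: cvg_sumr => j; apply: cvgM (cvg_sqr (cX _)) _; exact: cvg_cst.
Qed.

(** At p one has Hout < 1 for every s > 0. For a given s this persists near p, and by monotonicity
    the root lies below s. *)
Lemma Sout_near_ellipsoid p s : ellipsoid h p -> 0 < s ->
  nbhs p [set x | outer_chart h x -> Sout h 0 x < s].
Proof.
move=> [Ep pn] s0.
have Hp : Hout h 0 p s < 1.
  rewrite /Hout /xn pn expr0n mul0r addr0 -Ep -(chA0 h 0 p).
  apply: (chA_sdecr h_gt0 (good0 h)) => //.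
  by apply: (@chA_neq0 _ _ h 0 p 0); rewrite chA0 Ep oner_eq0.
have cH := @Hout_cvg _ (nbhs p) (nbhs_filter p) id p 0 s cvg_id.
have H : nbhs p [set x | Hout h 0 x s < 1].
  exact: (@cvgr_lt R V (nbhs p) _ (fun x => Hout h 0 x s) _ cH 1 Hp).
apply: (@filterS V (nbhs p) _ _ _ _ H) => x Hx ox; have [S0 HS] := SoutP h_gt0 (good0 h) ox.
rewrite ltNge; apply/negP; rewrite le_eqVlt => /orP[/eqP E|lt].
  by move: Hx; rewrite /= E HS ltxx.
have := Hout_decr h_gt0 (good0 h) ox s0 lt; rewrite HS => /lt_trans/(_ Hx).
by rewrite ltxx.
Qed.

(** [JJ] and [II] are O(s), and the one term with a pole, etaq x_n^2 / s, is at most s because x_n^2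
    <= s^2. *)
Lemma Fout0_le_Sout : exists2 K : R, 0 < K & forall x, outer_chart h x ->
  Sout h 0 x <= 1 -> `|Fout h 0 x| <= K * Sout h 0 x.
Proof.
pose c j := (h j)^-1 ^+ 2.
pose K := 1 + \sum_j c j * (h j ^+ 2 + 1) + (\sum_j c j + 1).
have c0 j : 0 <= c j by exact: sqr_ge0.
have K0 : 0 < K.
  rewrite /K addrA ltr_wpDl// addr_ge0//; last exact: sumr_ge0.
  by rewrite addr_ge0// sumr_ge0// => j _; rewrite mulr_ge0// addr_ge0 ?sqr_ge0.
exists K => // x ox s1; rewrite Fout0E//.
have xjs := xj_le_Sout h_gt0 ox; have xns := xn_le_Sout h_gt0 ox.
have s0 := Sout_gt0 h_gt0 ox.
set s := Sout h 0 x in s1 s0 xjs xns *.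
have s2 : s ^+ 2 <= 1 by rewrite expr_le1// ltW.
have HI j : `|II h j 0 s| <= c j * s.
  by apply: le_trans (norm_II h_gt0 j 0 s) _; rewrite (gtr0_norm s0).
rewrite normrM ger0_norm; last by rewrite divr_ge0.
apply: (@le_trans _ _ (1 * (K * s))); last by rewrite mul1r.
apply: ler_pM => //; first by lra.
apply: le_trans (ler_normB _ _) _; rewrite /K [leRHS]mulrDl; apply: lerD.
  apply: le_trans (ler_normD _ _) _; rewrite [leRHS]mulrDl mul1r; apply: lerD.
    by rewrite normrN -{2}(gtr0_norm s0) norm_JJ.
  apply: le_trans (ler_norm_sum _ _ _) _; rewrite mulr_suml; apply: ler_sum => j _.
  rewrite normrM mulrAC; apply: ler_pM => //.
  rewrite ger0_norm ?sqr_ge0//; apply: le_trans (xjs j) _.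
  by rewrite lerD2l.
rewrite normrM [X in _ * X]ger0_norm ?sqr_ge0//.
have e1 : etaq h s <= 1 by rewrite -rho_eta; exact: rho_le1.
have e0 := ltW (eta_gt0 h s).
apply: (@le_trans _ _ ((\sum_j c j * s + s^-1) * s ^+ 2)).
  apply: ler_pM => //; first exact: sqr_ge0.
  apply: le_trans (ler_normD _ _) _; apply: lerD.
    by apply: le_trans (ler_norm_sum _ _ _) _; apply: ler_sum => j _.
  rewrite ger0_norm ?mulr_ge0 ?invr_ge0 ?(ltW s0)//.
  by rewrite ler_piMl// invr_ge0 ltW.
rewrite -mulr_suml !mulrDl mul1r; apply: lerD.
  by rewrite -mulrA ler_wpM2l ?sumr_ge0// ler_piMr// ltW.
by rewrite expr2 mulKf// gt_eqF.
Qed.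

Lemma Fout0_near_ellipsoid p (d : R) : ellipsoid h p -> 0 < d ->
  nbhs p [set x | outer_chart h x -> `|Fout h 0 x| <= d].
Proof.
move=> Ep d0; have [K K0 HK] := Fout0_le_Sout.
have Kd : 0 < d / K by rewrite divr_gt0.
apply: (@filterS2 V (nbhs p) _ _ _ _ _ (Sout_near_ellipsoid Ep ltr01)
  (Sout_near_ellipsoid Ep Kd)) => x S1 S2 ox.
apply: le_trans (HK x ox (ltW (S1 ox))) _.
by rewrite mulrC -ler_pdivlMr// ltW// S2.
Qed.

Lemma Fcyl0_le x d : cyl h x -> 0 <= d -> (outer_chart h x -> `|Fout h 0 x| <= d) ->
  `|Fcyl h 0 x| <= d.
Proof.
move=> cx d0 H; rewrite Fcyl_sg//; last exact: good0.
have [x0|x0] := eqVneq (xn x) 0; first by rewrite x0 sgr0 mul0r normr0.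
by rewrite normrM normr_sg x0 mul1r H//; exact: xn_outer.
Qed.

End NearEllipsoid.

(** * The maximum principle and uniqueness *)

Section SecondDerivativeTest.
Context {R : realType} {V : normedModType R}.
Implicit Types (g : V -> R) (x v : V).

Lemma is_derive_line g x v (t d : R) : is_derive (x + t *: v) v g d ->
  is_derive t 1 (fun t => g (x + t *: v)) d.
Proof.
have E : (fun k : R => k^-1 *: (((fun t => g (x + t *: v)) \o shift t) (k *: 1) - g (x + t *: v)))
   = (fun k : R => k^-1 *: ((g \o shift (x + t *: v)) (k *: v) - g (x + t *: v))).
  by apply/funext => k /=; rewrite [k *: 1]mulr1 scalerDl addrCA.
by move=> [H1 H2]; split; rewrite /derivable /derive E.
Qed.

(** Symmetrizing in t cancels the first derivative, so its vanishing at the maximum is not a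
    separate step. *)
Lemma second_derivative_test g x v (dg : V -> R) (c : R) :
  (\forall y \near x, is_derive y v g (dg y)) -> is_derive x v dg c ->
  (\forall y \near x, g y <= g x) -> c <= 0.
Proof.
move=> Dg D2 Mg; rewrite leNgt; apply/negP => c0.
have D2t : is_derive (0 : R) 1 (fun t => dg (x + t *: v)) c.
  by apply: is_derive_line; rewrite scale0r addr0.
have lc : (x + t *: v) @[t --> (0 : R)] --> x.
  rewrite -[X in _ --> X]addr0 -(scale0r v); apply: cvgD; first exact: cvg_cst.
  by apply: cvgZ; [exact: cvg_id|exact: cvg_cst].
have /nbhs_ballP[d1 /= d10 H1] : \forall t \near (0 : R),
    is_derive (x + t *: v) v g (dg (x + t *: v)) /\ g (x + t *: v) <= g x.
  exact: (lc _ (filterI Dg Mg)).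
have dd : differentiable (fun t : R => dg (x + t *: v)) (0 : R).
  by apply/derivable1_diffP; case: D2t.
have c20 : 0 < c / 2 by rewrite divr_gt0.
have /nbhs_ballP[d2 /= d20 H2] := diff_eps dd c20.
pose d := Num.min d1 d2 / 2.
have d0 : 0 < d by rewrite divr_gt0// lt_min d10 d20.
have dlt : d < d1 /\ d < d2.
  have : d < Num.min d1 d2 by rewrite ltr_pdivrMr// ltr_pMr ?lt_min ?d10 ?d20// ltr1n.
  by rewrite lt_min => /andP.
have ball1 (t : R) : `|t| <= d -> ball (0 : R) d1 t /\ ball (0 : R) d2 t.
  by move=> td; rewrite /ball /= sub0r normrN !(le_lt_trans td) ?dlt.1 ?dlt.2.
have B t : 0 <= t <= d -> is_derive t 1 (fun t => g (x + t *: v) + g (x + (- t) *: v))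
    (dg (x + t *: v) - dg (x + (- t) *: v)).
  move=> /andP[t0 td].
  have [|b1 _] := ball1 t; first by rewrite ger0_norm.
  have [|b2 _] := ball1 (- t); first by rewrite normrN ger0_norm.
  have D1 := is_derive_line (H1 _ b1).1; have Dm := is_derive_line (H1 _ b2).1.
  have Dn := isd_comp1 (isdN (is_derive_id t 1)) Dm.
  by apply: (isd_eq (isdD D1 Dn)); rewrite mulN1r.
(* If [c > 0] then [t -> g (x + t v) + g (x - t v)] increases near [0]. *)
have pos t : 0 < t < d -> 0 < dg (x + t *: v) - dg (x + (- t) *: v).
  move=> /andP[t0 td].
  have [|_ b1] := ball1 t; first by rewrite ger0_norm ?ltW.
  have [|_ b2] := ball1 (- t); first by rewrite normrN ger0_norm ltW.
  have := H2 _ b1; have := H2 _ b2.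
  have dE u : 'd (fun t => dg (x + t *: v)) (0 : R) u = u * c.
    rewrite -[in LHS](mulr1 u) -[u * 1]/(u *: 1) linearZ /=; congr (_ * _).
    by case: D2t => _ <-; rewrite deriveE.
  rewrite !subr0 !dE normrN (gtr0_norm t0) !ler_norml.
  move=> /andP[_ A1] /andP[A2 _].
  have : 0 < t * c by exact: mulr_gt0.
  by move: A1 A2; lra.
have lt := isd_lt d0 B pos.
have := lt; rewrite ltNge => /negP; apply.
have [|b1 _] := ball1 d; first by rewrite gtr0_norm.
have [|b2 _] := ball1 (- d); first by rewrite normrN gtr0_norm.
rewrite !scale0r oppr0 scale0r !addr0.
by apply: lerD; [exact: (H1 _ b1).2|exact: (H1 _ b2).2].
Qed.

End SecondDerivativeTest.

Section MaximumPrinciple.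
Context {R : realType} {n : nat}.
Local Notation V := 'rV[R]_n.
Implicit Types (x y : V) (M : V -> R).

Definition sqn x : R := \sum_i x 0 i ^+ 2.

Lemma sqn_ge0 x : 0 <= sqn x. Proof. by apply: sumr_ge0 => i _; exact: sqr_ge0. Qed.

Lemma sqn_continuous : continuous sqn.
Proof.
move=> x; apply: (@cvg_sumr R V (nbhs x) _ _ _ (fun i w => w 0 i ^+ 2)) => i.
by apply: (@cvg_sqr R V (nbhs x) _ (fun w => w 0 i)); exact: coord_continuous.
Qed.

Lemma compact_sqn_ball (r : R) : 0 <= r -> compact [set x : V | sqn x <= r ^+ 2].
Proof.
move=> r0; apply: bounded_closed_compact.
  exists r; split; first exact: num_real.
  move=> M rM w /= sw; have M0 := le_lt_trans r0 rM.
  rewrite -[`|w|]/(mx_norm w) mx_normrE; apply/bigmax_leP; split; first exact: ltW.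
  move=> [i j] _ /=; rewrite ord1; apply: le_trans (ltW rM).
  rewrite -(@ler_pXn2r _ 2) ?nnegrE// -normrX ger0_norm ?sqr_ge0//; apply: le_trans sw.
  by rewrite /sqn (bigD1 j)//= lerDl sumr_ge0// => k _; exact: sqr_ge0.
rewrite (_ : [set x | _] = sqn @^-1` [set u | u <= r ^+ 2]); last by [].
apply: closed_comp; last exact: closed_le.
by move=> w _; exact: sqn_continuous.
Qed.

Lemma is_derive_sqn x i : is_derive x (ebase i) sqn (2 * x 0 i).
Proof.
have D j := isdX 2 (is_derive_coord x (ebase i) j).
apply: (isd_eq (isdS D)); rewrite (bigD1 i)//= big1 => [|j ji].
  by rewrite /ebase mxE !eqxx mulr1 addr0 expr1.
by rewrite /ebase mxE (negbTE ji) andbF mulr0.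
Qed.

Lemma local_max_laplacian (U : set V) (phi : V -> R) (c d : R) x : (0 < n)%N ->
  open U -> U x -> smooth_on U phi -> laplacian phi x = 0 -> 0 < d ->
  (\forall y \near x, c * phi y + d * sqn y <= c * phi x + d * sqn x) -> False.
Proof.
move=> n0 oU Ux sf lap d0 H.
have D2 i : c * 'D_(ebase i) ('D_(ebase i) phi) x + d * 2 <= 0.
  apply: (second_derivative_test
    (dg := fun y => c * 'D_(ebase i) phi y + d * (2 * y 0 i)) _ _ H).
    apply: filterS (open_nbhs_nbhs (conj oU Ux)) => y Uy.
    have Dphi := diff_is_derive (ebase i) (sf [::] y Uy).
    apply: (isdD (isdZ c (isd_eq Dphi _)) (isdZ d (is_derive_sqn y i))).
    by case: Dphi => _ ->.
  have Dphi := diff_is_derive (ebase i) (sf [:: i] x Ux).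
  have Dc := isdZ d (isdZ 2 (is_derive_coord x (ebase i) i)).
  apply: (isd_eq (isdD (isdZ c Dphi) Dc)).
  by case: Dphi => _ <-; rewrite /ebase mxE !eqxx mulr1.
have : \sum_i (c * 'D_(ebase i) ('D_(ebase i) phi) x + d * 2) <= 0 by exact: sumr_le0.
rewrite big_split /= -mulr_sumr -/(laplacian phi x) lap mulr0 add0r sumr_const card_ord.
by rewrite leNgt pmulrn_lgt0// mulr_gt0.
Qed.

(** M stands for the absolute value of a Z2-function: it is single-valued, while a harmonic phi with
    |phi| = M exists only locally, where M > 0. After adding d |x|^2, a maximum of M + d |x|^2 is
    one of sg(phi) phi + d |x|^2, against [local_max_laplacian]. *)
Lemma maximum_principle M : (0 < n)%N -> continuous M ->
  (forall x, 0 < M x -> exists U phi, [/\ open U, U x, smooth_on U phi,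
     laplacian phi x = 0 & forall y, U y -> `|phi y| = M y]) ->
  (forall d : R, 0 < d -> exists2 rho : R, 0 < rho &
     forall x, rho <= enorm x -> M x <= d) ->
  forall x, M x <= 0.
Proof.
move=> n0 cM loc dec x0; rewrite leNgt; apply/negP => M0.
have M20 : 0 < M x0 / 2 by rewrite divr_gt0.
have [rho r0 Hrho] := dec _ M20.
pose r := rho + enorm x0; have e0 : 0 <= enorm x0 by exact: sqrtr_ge0.
have r_gt0 : 0 < r by rewrite ltr_wpDr.
(* On the ball of radius r the perturbation is at most M x0 / 4. Beyond rho the sum is then at most
   3/4 of M x0, so the maximum is attained inside rho, at a point where M > 0. *)
pose d := M x0 / 4 / r ^+ 2.
have d0 : 0 < d by rewrite divr_gt0 ?exprn_gt0// divr_gt0.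
have dr : d * r ^+ 2 = M x0 / 4 by rewrite /d divfK// gt_eqF// exprn_gt0.
have enormE x : enorm x ^+ 2 = sqn x by rewrite sqr_sqrtr// sqn_ge0.
pose N x := M x + d * sqn x.
have cN : continuous N.
  move=> x; apply: (@continuousD R R V M (fun x => d * sqn x) x); first exact: cM.
  apply: (@continuousM R V (fun=> d) sqn x); first exact: cst_continuous.
  exact: sqn_continuous.
have Bx0 : sqn x0 <= r ^+ 2.
  by rewrite -enormE ler_pXn2r ?nnegrE ?(ltW r_gt0)// lerDr ltW.
have [x1 /set_mem /= B1 max1] := EVT_max_rV (ex_intro _ x0 Bx0)
  (compact_sqn_ball (ltW r_gt0)) (continuous_subspaceT cN).
have N01 : M x0 <= N x1.
  apply: le_trans (max1 x0 _); last exact/mem_set.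
  by rewrite /N lerDl mulr_ge0 ?sqn_ge0// ltW.
have q1 : d * sqn x1 <= M x0 / 4 by rewrite -dr ler_pM2l.
have int1 : enorm x1 < rho.
  rewrite ltNge; apply/negP => /Hrho H1; move: N01; rewrite /N; move: H1 q1 M0; lra.
have int1r : sqn x1 < r ^+ 2.
  rewrite -enormE ltr_pXn2r ?nnegrE ?(ltW r_gt0) ?sqrtr_ge0//.
  by apply: lt_le_trans int1 _; rewrite lerDl.
have M1 : 0 < M x1 by move: N01 q1 M0; rewrite /N; lra.
have [U [phi [oU Ux1 sphi lap phiM]]] := loc x1 M1.
have phi0 : phi x1 != 0 by rewrite -normr_gt0 phiM.
apply: (@local_max_laplacian U phi (Num.sg (phi x1)) d x1 n0 oU Ux1 sphi lap d0).
have oB : open [set y : V | sqn y < r ^+ 2].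
  rewrite (_ : [set y | _] = sqn @^-1` [set u | u < r ^+ 2]); last by [].
  by apply: open_comp; [move=> y _; exact: sqn_continuous|exact: open_lt].
apply: (@filterS2 V (nbhs x1) _ _ _ _ _ (open_nbhs_nbhs (conj oU Ux1))
  (open_nbhs_nbhs (conj oB int1r))) => y Uy /= By.
rewrite -normrEsg phiM//.
apply: le_trans (max1 y _); last by apply/mem_set; exact: ltW.
rewrite /N -phiM// lerD2r; apply: le_trans (ler_norm _) _.
by rewrite normrM normr_sg phi0 mul1r.
Qed.

End MaximumPrinciple.

Lemma polar_form (R : realType) (a b : R) : (a != 0) || (b != 0) ->
  exists2 t : R, - pi < t <= pi &
    a = Num.sqrt (a ^+ 2 + b ^+ 2) * cos t /\ b = Num.sqrt (a ^+ 2 + b ^+ 2) * sin t.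
Proof.
move=> ab0; have q0 : 0 < a ^+ 2 + b ^+ 2.
  rewrite lt_neqAle addr_ge0 ?sqr_ge0// andbT eq_sym paddr_eq0 ?sqr_ge0//.
  by rewrite !sqrf_eq0 negb_and.
set r := Num.sqrt _; have r0 : 0 < r by rewrite sqrtr_gt0.
have r2 : r ^+ 2 = a ^+ 2 + b ^+ 2 by rewrite sqr_sqrtr// ltW.
have rn0 : r != 0 by rewrite gt_eqF.
have u1 : (a / r) ^+ 2 + (b / r) ^+ 2 = 1.
  by rewrite !expr_div_n -mulrDl -r2 divff// expf_neq0.
have a1 : -1 <= a / r <= 1.
  by rewrite -ler_norml -(@ler_pXn2r _ 2) ?nnegrE// expr1n real_normK ?num_real// -u1 lerDl sqr_ge0.
have ca : cos (acos (a / r)) = a / r by exact: acosK.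
have sa : sin (acos (a / r)) = `|b / r|.
  by rewrite sin_acos// -sqrtr_sqr; congr Num.sqrt; rewrite -u1; ring.
have aE : a = r * (a / r) by rewrite mulrC divfK.
have bE : b = r * (b / r) by rewrite mulrC divfK.
have [b0|b0] := leP 0 (b / r).
  exists (acos (a / r)); last by rewrite ca sa ger0_norm.
  rewrite acos_lepi// andbT; apply: lt_le_trans (acos_ge0 a1).
  by rewrite oppr_lt0 pi_gt0.
exists (- acos (a / r)); last by rewrite cosN sinN ca sa ltr0_norm// opprK.
rewrite ltrN2; apply/andP; split.
  rewrite lt_neqAle acos_lepi// andbT; apply/eqP => E.
  by move: sa; rewrite E sinpi => /esym/eqP; rewrite normr_eq0 lt_eqF.
by apply: le_trans (pi_ge0 R); rewrite oppr_le0 acos_ge0.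
Qed.

(** * Normal coordinates along the ellipsoid *)

Section NormalCoordinates.
Context {R : realType} {m : nat}.
Variable h : 'I_m -> R.
Hypothesis h_gt0 : forall k, 0 < h k.
Local Notation V := 'rV[R]_m.+1.
Implicit Types (l r u : R) (x y p : V) (j : 'I_m).

(* The point [p j = x j * h j ^ 2 / (h j ^ 2 + l)] is on the ellipsoid when
   [foot x l = 1], and then [x - p] is normal to it. *)
Definition foot x l : R := \sum_j xj x j ^+ 2 * (h j ^+ 2 / (h j ^+ 2 + l) ^+ 2).

Lemma foot_decr x l1 l2 : (exists j, xj x j != 0) -> (forall j, 0 < h j ^+ 2 + l1) ->
  l1 < l2 -> foot x l2 < foot x l1.
Proof.
move=> [j0 xj0] l10 l12.
have lt j : h j ^+ 2 / (h j ^+ 2 + l2) ^+ 2 < h j ^+ 2 / (h j ^+ 2 + l1) ^+ 2.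
  by apply: ltr_div_sqr => //; rewrite ?ltrD2l ?exprn_gt0.
rewrite /foot (bigD1 j0)//= [ltRHS](bigD1 j0)//=; apply: ltr_leD.
  by rewrite ltr_pM2l// lt_neqAle sqr_ge0 eq_sym sqrf_eq0 xj0.
by apply: ler_sum => j _; rewrite ler_wpM2l ?sqr_ge0// ltW.
Qed.

Lemma foot_cvg {T : Type} {F : set_system T} {FF : Filter F} (X : T -> V) x l :
  X @ F --> x -> foot (X t) l @[t --> F] --> foot x l.
Proof.
move=> Xx; have cX i : X t 0 i @[t --> F] --> x 0 i by exact: cvg_coord.
by apply: cvg_sumr => j; apply: cvgM (cvg_sqr (cX _)) _; exact: cvg_cst.
Qed.

Lemma foot_cont x l : (forall j, 0 < h j ^+ 2 + l) -> {for l, continuous (foot x)}.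
Proof.
move=> l0; apply: (@cvg_sumr R R (nbhs l)) => j.
apply: cvgM; first exact: cvg_cst.
apply: cvgM; first exact: cvg_cst.
apply: cvgV; first by rewrite expf_neq0// gt_eqF.
apply: (@cvg_sqr R R (nbhs l) _ (fun t => h j ^+ 2 + t)).
by apply: cvgD; [exact: cvg_cst|exact: cvg_id].
Qed.

Definition footpt x l : V :=
  \row_k (if unlift ord_max k is Some j then xj x j * h j ^+ 2 / (h j ^+ 2 + l) else 0).

Lemma xj_footpt x l j : xj (footpt x l) j = xj x j * h j ^+ 2 / (h j ^+ 2 + l).
Proof. by rewrite /xj mxE liftK. Qed.

Lemma xn_footpt x l : xn (footpt x l) = 0.
Proof. by rewrite /xn mxE unlift_none. Qed.

Lemma footpt_ellipsoid x l : (forall j, 0 < h j ^+ 2 + l) -> foot x l = 1 ->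
  ellipsoid h (footpt x l).
Proof.
move=> l0 f1; split; last exact: xn_footpt.
rewrite -f1; apply: eq_bigr => j _; rewrite -/(xj _ j) xj_footpt.
by field; rewrite !gt_eqF.
Qed.

(** Half the gradient of [equatorial] at points with x_n = 0, the vector that [outer_normal]
    normalizes. *)
Definition conormal p : V :=
  \row_k (if unlift ord_max k is Some j then p 0 k / h j ^+ 2 else 0).

Lemma enorm_conormal p : ellipsoid h p ->
  0 < enorm (conormal p) /\ enorm (conormal p) ^+ 2 <= Khh h.
Proof.
move=> [p1 pn]; have gj j : xj (conormal p) j = xj p j / h j ^+ 2.
  by rewrite /xj mxE liftK.
have gn : xn (conormal p) = 0 by rewrite /xn mxE unlift_none.
have le : enorm (conormal p) ^+ 2 <= Khh h.
  rewrite sqr_enorm gn expr0n addr0; apply: ler_sum => j _; rewrite gj.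
  rewrite -[leRHS]mul1r expr_div_n [X in _ / X]exprS expr1 invfM mulrA exprVn.
  apply: ler_wpM2r; first by rewrite invr_ge0 sqr_ge0.
  rewrite -p1 /equatorial (bigD1 j)//= lerDl sumr_ge0// => k _.
  by rewrite divr_ge0 ?sqr_ge0.
split => //; rewrite lt_neqAle sqrtr_ge0 andbT; apply/eqP => E.
have : enorm (conormal p) ^+ 2 = 0 by rewrite -E expr0n.
rewrite sqr_enorm gn expr0n addr0 => /eqP; rewrite psumr_eq0; last by move=> j _; exact: sqr_ge0.
move=> /allP H; move: p1; rewrite /equatorial big1 => [/esym/eqP|j _]; first by rewrite oner_eq0.
have := H j (mem_index_enum j); rewrite /= gj sqrf_eq0 mulf_eq0 invr_eq0 sqrf_eq0.
by rewrite (gt_eqF (h_gt0 j)) orbF => /eqP; rewrite /xj => ->; rewrite expr0n mul0r.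
Qed.

Lemma normal_exp_footpt x l : (forall j, 0 < h j ^+ 2 + l) -> foot x l = 1 ->
  forall z : R[i], complex.Re z = l * enorm (conormal (footpt x l)) ->
  complex.Im z = xn x -> x = normal_exp h (footpt x l) z.
Proof.
move=> l0 f1 z Rz Iz; have [g0 _] := enorm_conormal (footpt_ellipsoid l0 f1).
rewrite /normal_exp Rz Iz /outer_normal -/(conormal (footpt x l)).
rewrite scalerA mulfK ?gt_eqF//; apply: rV_ext => [j|].
  rewrite /xj mxE [X in X + _]mxE -/(xj (footpt x l) j) xj_footpt.
  rewrite mxE [X in l * X]mxE liftK -/(xj (footpt x l) j) xj_footpt.
  rewrite [X in _ + X]mxE -/(xj (ebase ord_max : V) j) xj_ebase_max mulr0 addr0 -/(xj x j).
  by field; rewrite !gt_eqF.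
rewrite /xn mxE [X in X + _]mxE -/(xn (footpt x l)) xn_footpt.
rewrite mxE [X in l * X]mxE unlift_none mulr0 !add0r mxE.
by rewrite -/(xn (ebase ord_max : V)) xn_ebase_max mulr1.
Qed.

(** Surjectivity of the normal exponential map near p0. The foot point is found by the intermediate
    value theorem: foot x is above 1 at - l and below 1 at l for x = p0, hence for x nearby. *)
Lemma normal_coordinates p0 (r1 : R) : ellipsoid h p0 -> 0 < r1 ->
  nbhs p0 [set x | ~ ellipsoid h x -> exists p r t, [/\ ellipsoid h p,
    0 < r < r1, - pi < t <= pi & x = normal_exp h p (r%:C * expi t)%C]].
Proof.
move=> [Ep pn] r10; have K0 := Khh_ge0 h.
(* The bound t <= 1 / 2 gives l < h_j^2 for all j, since 1 <= Khh h_j^2. The bound t <= r1 / 2 makes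
   the horizontal part of zeta at most r1 / 2, as the conormal has norm at most 1 + Khh. *)
pose t := Num.min (1 / 2) (r1 / 2); pose l := t / (1 + Khh h).
have K1 : 0 < 1 + Khh h by rewrite ltr_pwDl.
have t0 : 0 < t by rewrite lt_min !divr_gt0.
have t1 : t <= 1 / 2 by rewrite ge_min lexx.
have tr : t <= r1 / 2 by rewrite ge_min lexx orbT.
have l0 : 0 < l by rewrite divr_gt0.
have lK : l * (1 + Khh h) = t by rewrite divfK// gt_eqF.
have lh j : l < h j ^+ 2.
  have : (h j)^-1 ^+ 2 <= Khh h.
    by rewrite /Khh (bigD1 j)//= lerDl sumr_ge0// => k _; exact: sqr_ge0.
  have hj : 0 < h j ^+ 2 by rewrite exprn_gt0.
  rewrite exprVn -[X in X <= _]mul1r ler_pdivrMr// => H.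
  have : l * 1 <= l * (Khh h * h j ^+ 2) by rewrite ler_pM2l.
  have : h j ^+ 2 * (l * (1 + Khh h)) <= h j ^+ 2 * (1 / 2) by rewrite ler_pM2l// lK.
  have : 0 < h j ^+ 2 * l by rewrite mulr_gt0.
  by lra.
have lpos u : - l <= u -> forall j, 0 < h j ^+ 2 + u.
  by move=> lu j; have := lh j; lra.
have f0 : foot p0 0 = 1.
  by rewrite -Ep; apply: eq_bigr => j _; rewrite addr0 /xj; field; rewrite gt_eqF.
have ex0 : exists j, xj p0 j != 0.
  by apply: (@chA_neq0 _ _ h 0 p0 0); rewrite chA0 Ep oner_eq0.
have Nl : - l < 0 by rewrite oppr_lt0.
have f1 : foot p0 l < 1 by rewrite -f0; apply: foot_decr => // j; rewrite addr0 exprn_gt0.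
have f2 : 1 < foot p0 (- l) by rewrite -f0; apply: foot_decr => //; exact: lpos.
have H1 : nbhs p0 [set x | foot x l < 1].
  exact: (@cvgr_lt R V (nbhs p0) _ (fun x => foot x l) _
    (@foot_cvg _ _ (nbhs_filter p0) id p0 l cvg_id) 1 f1).
have H2 : nbhs p0 [set x | 1 < foot x (- l)].
  exact: (@cvgr_gt R V (nbhs p0) _ (fun x => foot x (- l)) _
    (@foot_cvg _ _ (nbhs_filter p0) id p0 (- l) cvg_id) 1 f2).
have r20 : 0 < r1 ^+ 2 / 2 by rewrite divr_gt0// exprn_gt0.
have H3 : nbhs p0 [set x | xn x ^+ 2 < r1 ^+ 2 / 2].
  have cx : xn x ^+ 2 @[x --> nbhs p0] --> xn p0 ^+ 2.
    by apply: (@cvg_sqr R V (nbhs p0) _ (@xn R m)); exact: coord_continuous.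
  have x0 : xn p0 ^+ 2 < r1 ^+ 2 / 2 by rewrite /xn pn expr0n.
  exact: (@cvgr_lt R V (nbhs p0) _ (fun x => xn x ^+ 2) _ cx (r1 ^+ 2 / 2) x0).
apply: (@filterS3 V (nbhs p0) _ _ _ _ _ _ H1 H2 H3) => x /= x1 x2 x3 nE.
have [|||u /= ] := @IVT R (foot x) (- l) l 1.
- by rewrite ge0_cp// ltW.
- apply: continuous_in_subspaceT => v /set_mem /=; rewrite in_itv /= => /andP[lv _].
  by apply: foot_cont; exact: lpos.
- by rewrite ge_min le_max (ltW x1) (ltW x2) orbT.
rewrite in_itv /= => /andP[lu ul] fu; have up := lpos u lu.
have Ef := footpt_ellipsoid up fu; have [g0 gK] := enorm_conormal Ef.
set g := enorm _ in g0 gK.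
have ne0 : (u * g != 0) || (xn x != 0).
  apply/negPn/negP; rewrite negb_or !negbK mulf_eq0 (gt_eqF g0) orbF => /andP[/eqP u0 /eqP xn0].
  apply: nE; have := @normal_exp_footpt x u up fu 0.
  by rewrite {1}u0 mul0r xn0 /normal_exp !scale0r !addr0 => ->.
have [th thpi [aE bE]] := polar_form ne0.
set r := Num.sqrt _ in aE bE.
exists (footpt x u), r, th; split => //.
- have q0 : 0 < (u * g) ^+ 2 + xn x ^+ 2.
    rewrite lt_neqAle addr_ge0 ?sqr_ge0// andbT eq_sym paddr_eq0 ?sqr_ge0//.
    by rewrite !sqrf_eq0 negb_and.
  apply/andP; split; first by rewrite sqrtr_gt0.
  rewrite -(@ltr_pXn2r _ 2) ?nnegrE ?sqrtr_ge0 ?(ltW r10)// sqr_sqrtr ?(ltW q0)//.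
  have u2 : u ^+ 2 <= l ^+ 2 by rewrite -[u ^+ 2]real_normK ?num_real// ler_pXn2r ?nnegrE ?(ltW l0)// ler_norml lu ul.
  have : (u * g) ^+ 2 <= l ^+ 2 * (1 + Khh h) ^+ 2.
    rewrite exprMn; apply: ler_pM; rewrite ?sqr_ge0//; apply: le_trans gK _.
    by have := sqr_ge0 (Khh h); move: K0; lra.
  rewrite -exprMn lK.
  have : t ^+ 2 <= (r1 / 2) ^+ 2 by rewrite ler_pXn2r ?nnegrE ?(ltW t0) ?divr_ge0 ?(ltW r10).
  have r12 : 0 < r1 ^+ 2 by rewrite exprn_gt0.
  by move: x3 r12; lra.
- apply: normal_exp_footpt => //; rewrite /expi /= mul0r ?subr0 ?addr0.
    by rewrite -/g aE.
  by rewrite [RHS]bE.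
Qed.

End NormalCoordinates.

Lemma near_eq_continuous {T : topologicalType} {R : realType} (f g : T -> R) (x : T) :
  (\near x, f x = g x) -> {for x, continuous g} -> {for x, continuous f}.
Proof.
move=> fg cg; rewrite /prop_for /continuous_at (nbhs_singleton fg).
by apply: cvg_trans cg; apply: near_eq_cvg; apply: filterS fg => y ->.
Qed.

Lemma continuous_at_dist {T : topologicalType} {R : realType} (f : T -> R) (x : T) :
  (forall d : R, 0 < d -> nbhs x [set y | `|f x - f y| <= d]) -> {for x, continuous f}.
Proof. by move=> H; apply/cvgrPdist_le => d /H. Qed.

Section SumsOfSmoothFunctions.
Context {R : realType} {n : nat}.
Local Notation V := 'rV[R]_n.
Implicit Types (f g : V -> R) (U : set V) (x : V).

Lemma iter_partialD U f g (s : seq 'I_n) x : open U -> smooth_on U f ->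
  smooth_on U g -> U x ->
  iter_partial s (fun y => f y + g y) x = iter_partial s f x + iter_partial s g x.
Proof.
move=> oU sf sg; elim: s x => [//|i s IH] x Ux /=.
rewrite (@near_eq_derive _ _ _ _ (fun y => iter_partial s f y + iter_partial s g y));
  last exact: (near_U oU Ux).
have D1 := diff_is_derive (ebase i) (sf s x Ux).
have D2 := diff_is_derive (ebase i) (sg s x Ux).
by case: (isdD D1 D2) => _ ->; case: D1 => _ ->; case: D2 => _ ->.
Qed.

Lemma smooth_onD U f g : open U -> smooth_on U f -> smooth_on U g ->
  smooth_on U (fun y => f y + g y).
Proof.
move=> oU sf sg s x Ux.
apply: (@near_eq_differentiable _ _ (fun y => iter_partial s f y + iter_partial s g y)).
  by apply: (near_U oU Ux) => y Uy; rewrite (iter_partialD s oU sf sg Uy).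
by apply: differentiableD; [exact: sf|exact: sg].
Qed.

Lemma laplacian_lin U (c : R) f g x : open U -> smooth_on U f -> smooth_on U g -> U x ->
  laplacian (fun y => c * f y + g y) x = c * laplacian f x + laplacian g x.
Proof.
move=> oU sf sg Ux; rewrite /laplacian mulr_sumr -big_split; apply: eq_bigr => i _ /=.
have := iter_partialD [:: i; i] oU (smooth_onZ c oU sf) sg Ux => /= ->.
by have := iter_partialZ c [:: i; i] oU sf Ux => /= ->.
Qed.

End SumsOfSmoothFunctions.

(** * Identification of f_h with the limit potential *)

Section Uniqueness.
Context {R : realType} {m : nat}.
Variable h : 'I_m -> R.
Hypothesis h_gt0 : forall k, 0 < h k.
Local Notation V := 'rV[R]_m.+1.
Implicit Types (l r u : R) (x y p : V) (j : 'I_m).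

Lemma compact_ellipsoid : compact (ellipsoid h).
Proof.
pose r := 1 + \sum_j h j ^+ 2.
have r0 : 1 <= r by rewrite lerDl sumr_ge0// => j _; exact: sqr_ge0.
apply: (subclosed_compact _ (compact_sqn_ball (le_trans ler01 r0))).
  rewrite (_ : ellipsoid h = equatorial h @^-1` [set r | r = 1] `&`
    (fun x : V => x 0 ord_max) @^-1` [set r | r = 0]); last by [].
  apply: closedI; apply: closed_comp.
  - by move=> x _; exact: equatorial_continuous.
  - exact: closed_eq.
  - by move=> x _; exact: coord_continuous.
  - exact: closed_eq.
move=> p [p1 pn] /=; apply: (@le_trans _ _ r); last by rewrite -[leLHS]mulr1 expr2 ler_pM2l// (lt_le_trans ltr01).
rewrite /sqn sum_xj /xn pn expr0n addr0; apply: le_trans (_ : \sum_j h j ^+ 2 <= _).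
  apply: ler_sum => j _; rewrite -[leRHS]mul1r -ler_pdivrMr ?exprn_gt0// -p1.
  rewrite /equatorial (bigD1 j)//= lerDl sumr_ge0// => k _.
  by rewrite divr_ge0 ?sqr_ge0.
by rewrite lerDr.
Qed.

(** B is bounded on the compact ellipsoid and both r^(3/2) and r^(5/2) are at most r for r <= 1, so
    |f| = O(r) uniformly along the ellipsoid. *)
Lemma nondegenerate_near_ellipsoid (f : Z2fun h) p0 (d : R) : Z2nondegenerate f ->
  ellipsoid h p0 -> 0 < d ->
  nbhs p0 [set x | ~ ellipsoid h x -> `|branch f x x| <= d].
Proof.
move=> [B [[W [oW EW] [sR sI]] _ [C [r0 [r00 HB]]]]] E0 d0.
have [pm _ Bmax] : exists2 pm : V, pm \in ellipsoid h & forall p, p \in ellipsoid h ->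
    `|complex.Re (B p)| + `|complex.Im (B p)| <= `|complex.Re (B pm)| + `|complex.Im (B pm)|.
  apply: (@EVT_max_rV R m.+1 (fun p => `|complex.Re (B p)| + `|complex.Im (B p)|)).
  - by exists p0.
  - exact: compact_ellipsoid.
  apply: continuous_in_subspaceT => p /set_mem /EW Wp.
  apply: (@continuousD R R V (fun p => `|complex.Re (B p)|) (fun p => `|complex.Im (B p)|)).
    apply: (@continuous_comp V R R (fun p => complex.Re (B p)) Num.norm); last exact: norm_continuous.
    exact: differentiable_continuous (sR [::] p Wp).
  apply: (@continuous_comp V R R (fun p => complex.Im (B p)) Num.norm); last exact: norm_continuous.
  exact: differentiable_continuous (sI [::] p Wp).
set K := `|_| + `|_| in Bmax; have K0 : 0 <= K by rewrite addr_ge0.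
have KC : 0 < K + `|C| + 1 by rewrite ltr_wpDl// addr_ge0.
(* Below r0 the expansion holds, below 1 the powers of r are at most r, and the last bound turns (K
   + |C|) r into at most d. *)
pose r1 := Num.min (Num.min r0 1) (d / (K + `|C| + 1)).
have r10 : 0 < r1 by rewrite !lt_min r00 ltr01 divr_gt0.
apply: (@filterS V (nbhs p0) _ _ _ _ (normal_coordinates h_gt0 E0 r10)) => x /= H /H.
move=> [p [r [t [Ep /andP[rp rr1] tpi xE]]]].
move: rr1; rewrite !lt_min => /andP[/andP[rr0 rle1] rd].
have := HB p r t Ep _ tpi; rewrite rp rr0 /= => /(_ isT).
rewrite -xE.
have r32 : r `^ (3 / 2) <= r by apply: ge1r_powR; [rewrite rp ltW|lra].
have r52 : r `^ (5 / 2) <= r by apply: ge1r_powR; [rewrite rp ltW|lra].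
have p32 := powR_ge0 r (3 / 2); have p52 := powR_ge0 r (5 / 2).
set z := complex.Re (_ * _).
have zr : `|z| <= K * r.
  have -> : z = r `^ (3 / 2) * (complex.Re (B p) * cos (3 / 2 * t)
      - complex.Im (B p) * sin (3 / 2 * t)).
    by rewrite /z; case: (B p) => b1 b2; rewrite /expi /=; ring.
  rewrite normrM (ger0_norm p32) mulrC; apply: ler_pM => //.
  apply: le_trans (ler_normB _ _) _; apply: (le_trans _ (Bmax p (mem_set Ep))).
  by apply: lerD; rewrite normrM ler_piMr ?normr_ge0 ?cos_max ?sin_max.
have C52 : C * r `^ (5 / 2) <= `|C| * r.
  apply: le_trans (ler_norm _) _; rewrite normrM (ger0_norm p52).
  by rewrite ler_wpM2l.
move=> Hx; have : `|branch f x x| <= `|branch f x x - z| + `|z|.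
  by rewrite -{1}(subrK z (branch f x x)) ler_normD.
have : (K + `|C| + 1) * r <= d by rewrite mulrC -ler_pdivlMr// ltW.
by move: Hx zr C52 rp; lra.
Qed.

Section Difference.
Variables (f : Z2fun h) (eps : R).
Hypotheses (m2 : (2 <= m)%N) (hf : Z2harmonic f) (nf : Z2nondegenerate f).
Hypothesis eps1 : eps = 1 \/ eps = -1.

Let go x : R := eps * outer f x + Fout h 0 x.
Let gi x : R := eps * inner f x + Fcyl h 0 x.
(** The absolute value of eps f + Phi_0. The two charts give the same value where they overlap,
    because f and Phi_0 change sign together; 0 is the limit along the ellipsoid. *)
Let M x : R := if x \in ellipsoid h then 0 else if x \in disc h then `|gi x| else `|go x|.

Let norm_eps : `|eps| = 1. Proof. by case: eps1 => ->; rewrite ?normrN normr1. Qed.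

Let M_outer x : outer_chart h x -> M x = `|go x|.
Proof.
move=> ox; rewrite /M memNset => [|Ex]; first by rewrite memNset.
by apply: ox; exact: ellipsoid_disc.
Qed.

Let M_cyl x : cyl h x -> M x = `|gi x|.
Proof.
move=> cx; rewrite /M memNset => [|[E1 _]]; last by move: cx; rewrite /cyl /= E1 ltxx.
have [dx|/negP ndx] := boolP (x \in disc h) => //.
have ox : outer_chart h x by move=> /mem_set.
have xn0 : xn x != 0.
  by apply/eqP => xn0; apply: ox; split => //; exact: ltW.
rewrite /gi (Defs.glue f ox (cyl_inner cx)) Fcyl_sg//; last exact: good0.
rewrite -/(xn x) mulrCA -mulrDr normrM normr_sg xn0 mul1r.
by [].
Qed.

Let M_ge0 x : 0 <= M x.
Proof. by rewrite /M; case: ifP => // _; case: ifP. Qed.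

Let sf : smooth_on (outer_chart h) (outer f) := (let: And4 sf _ _ _ := hf in sf.1).
Let sfi : smooth_on (cyl h) (inner f).
Proof. by case: hf => [[_ si] _ _ _]; apply: smooth_onS si => x; exact: cyl_inner. Qed.

Let s0 : smooth_on (outer_chart h) (Fout h 0).
Proof.
have := smooth_Fout h_gt0 1 (good0 h); congr smooth_on.
by apply/funext => x; rewrite mul1r.
Qed.

Let si0 : smooth_on (cyl h) (Fcyl h 0).
Proof.
have := smooth_Fcyl h_gt0 1 (good0 h); congr smooth_on.
by apply/funext => x; rewrite mul1r.
Qed.

Let oO := open_outer_chart (h := h).
Let oC := open_cyl (h := h).

Let sgo : smooth_on (outer_chart h) go.
Proof. exact: smooth_onD oO (smooth_onZ eps oO sf) s0. Qed.

Let sgi : smooth_on (cyl h) gi.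
Proof. exact: smooth_onD oC (smooth_onZ eps oC sfi) si0. Qed.

Let M_cont : continuous M.
Proof.
have cn U g x : open U -> U x -> smooth_on U g -> (forall y, U y -> M y = `|g y|) ->
    {for x, continuous M}.
  move=> oU Ux sg Mg.
  have cg : {for x, continuous (fun y => `|g y|)}.
    apply: (@continuous_comp V R R g Num.norm); last exact: norm_continuous.
    exact: differentiable_continuous (sg [::] x Ux).
  exact: near_eq_continuous (near_U oU Ux Mg) cg.
move=> x; have [Ex|nEx] := pselect (ellipsoid h x); last first.
  have [dx|ndx] := pselect (disc h x).
    exact: (cn _ _ _ oC (disc_cyl dx nEx) sgi M_cyl).
  exact: (cn _ _ _ oO ndx sgo M_outer).
apply: continuous_at_dist => d d0; have d20 : 0 < d / 2 by rewrite divr_gt0.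
have -> : M x = 0 by rewrite /M mem_set.
apply: (@filterS2 V (nbhs x) _ _ _ _ _ (nondegenerate_near_ellipsoid nf Ex d20)
  (Fout0_near_ellipsoid h_gt0 Ex d20)) => y /= H1 H2.
rewrite sub0r normrN ger0_norm//.
have [Ey|nEy] := pselect (ellipsoid h y); first by rewrite /M mem_set// ltW.
have {}H1 := H1 nEy; have [dy|ndy] := pselect (disc h y).
  have cy := disc_cyl dy nEy; rewrite M_cyl//; apply: le_trans (ler_normD _ _) _.
  rewrite normrM norm_eps mul1r [leRHS]splitr; apply: lerD.
    by move: H1; rewrite branch_inner.
  exact: (Fcyl0_le h_gt0 cy (ltW d20) H2).
rewrite M_outer//; apply: le_trans (ler_normD _ _) _.
rewrite normrM norm_eps mul1r [leRHS]splitr; apply: lerD; last exact: H2.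
by move: H1; rewrite branch_outer.
Qed.

Let M_local x : 0 < M x -> exists U phi, [/\ open U, U x, smooth_on U phi,
     laplacian phi x = 0 & forall y, U y -> `|phi y| = M y].
Proof.
move=> Mx; have nEx : ~ ellipsoid h x.
  by move=> Ex; move: Mx; rewrite /M mem_set// ltxx.
case: hf => _ _ _ /(_ x nEx) lap0.
have [dx|ndx] := pselect (disc h x).
  have cx := disc_cyl dx nEx; exists (cyl h), gi; split; [exact: oC|exact: cx|exact: sgi| |by move=> y /M_cyl].
  rewrite (laplacian_lin eps oC sfi si0 cx) (laplacian_Phi h_gt0 oC cx (chart_cylinder h_gt0)).
  by move: lap0; rewrite branch_inner// => ->; rewrite mulr0 addr0.
exists (outer_chart h), go; split; [exact: oO|exact: ndx|exact: sgo| |by move=> y /M_outer].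
rewrite (laplacian_lin eps oO sf s0 ndx) (laplacian_Phi h_gt0 oO ndx (chart_outer h_gt0)).
by move: lap0; rewrite branch_outer// => ->; rewrite mulr0 addr0.
Qed.

Hypothesis expansion : exists C rho : R, 0 < rho /\ forall x : V, rho <= enorm x ->
    `| eps * outer f x - asymptotic_poly h x | <= C * enorm x ^- m.-1.

Let M_decay (d : R) : 0 < d -> exists2 rho : R, 0 < rho &
     forall x, rho <= enorm x -> M x <= d.
Proof.
move=> d0; have d20 : 0 < d / 2 by rewrite divr_gt0.
have [rho1 r10 H1] := Fout0_cvg_oo h_gt0 m2 d20.
have [C [rho2 [r20 H2]]] := expansion.
pose rho3 := 1 + `|C| / (d / 2).
have C0 : 0 <= `|C| / (d / 2) by rewrite divr_ge0// ltW.
exists (Num.max rho1 (Num.max rho2 rho3)) => [|x]; first by rewrite lt_max r10.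
rewrite !ge_max => /and3P[/H1[ox F1] /H2 F2 x3]; rewrite M_outer//.
have -> : go x = (eps * outer f x - asymptotic_poly h x) +
   (Fout h 0 x + asymptotic_poly h x) by rewrite /go; ring.
apply: le_trans (ler_normD _ _) _; rewrite [leRHS]splitr; apply: lerD => //.
apply: le_trans F2 _.
have x1 : 1 <= enorm x by apply: le_trans x3; rewrite lerDl.
have x0 : 0 < enorm x := lt_le_trans ltr01 x1.
(* Since n >= 3 the exponent m.-1 is positive, so the remainder of the expansion tends to 0. *)
have xm : enorm x <= enorm x ^+ m.-1.
  by rewrite ler_eXnr// -subn1 subn_gt0.
apply: le_trans (_ : `|C| * (enorm x)^-1 <= _).
  apply: le_trans (ler_norm _) _; rewrite normrM ler_wpM2l//.
  rewrite ger0_norm ?invr_ge0 ?exprn_ge0 ?(ltW x0)//.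
  by rewrite lef_pV2 ?posrE ?exprn_gt0.
rewrite ler_pdivrMr// -ler_pdivrMl// mulrC; apply: le_trans x3.
by rewrite lerDr.
Qed.

Lemma difference_eq0 : (forall x, outer_chart h x -> outer f x = - eps * Fout h 0 x) /\
  forall x, cyl h x -> inner f x = - eps * Fcyl h 0 x.
Proof.
have M0 x : M x = 0.
  apply/eqP; rewrite eq_le M_ge0 andbT.
  exact: (maximum_principle (ltn0Sn m) M_cont M_local M_decay).
have solve (a b : R) : `|eps * a + b| = 0 -> a = - eps * b.
  by move=> /eqP; rewrite normr_eq0 => /eqP; case: eps1 => ->; lra.
by split => x Ux; apply: solve; rewrite -?(M_outer Ux) -?(M_cyl Ux).
Qed.

End Difference.

(** The sign is opposite to that of the expansion of f, because Phi_0 is asymptotic to minus the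
    polynomial. *)
Lemma f_h_unique (f : Z2fun h) : (2 <= m)%N -> is_f_h f ->
  exists2 eps : R, eps = 1 \/ eps = -1 &
  (forall x, outer_chart h x -> outer f x = eps * Fout h 0 x) /\
  forall x, cyl h x -> inner f x = eps * Fcyl h 0 x.
Proof.
move=> m2 [hf nf [eps eps1 ef]]; exists (- eps); last exact: difference_eq0 ef.
by case: eps1 => ->; [right|left; rewrite opprK].
Qed.

End Uniqueness.

(** * Convergence *)

(** Continuity at the single point (0, x) compares both G e y and G 0 y with G 0 x, which is already
    uniform in y near x. *)
Lemma pcont_locally_uniform {R : realType} {n : nat} (U : set 'rV[R]_n)
    (G : R -> 'rV[R]_n -> R) (x : 'rV[R]_n) (d : R) : pcont U G -> U x -> 0 < d ->
  exists A B, [/\ nbhs (0 : R) A, nbhs x B &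
    forall e y, A e -> B y -> `|G e y - G 0 y| < d].
Proof.
move=> cG Ux d0; have d20 : 0 < d / 2 by rewrite divr_gt0.
have /= [[A B] /= [nA nB] AB] := @cvgr_dist_lt _ _ _ _ _ _ _ (cG x Ux) _ d20.
exists A, B; split => // e y Ae By.
have /= H1 := AB (e, y) (conj Ae By).
have /= H2 := AB (0, y) (conj (nbhs_singleton nA) By).
rewrite (_ : G e y - G 0 y = (G 0 x - G 0 y) - (G 0 x - G e y)); last by ring.
by apply: le_lt_trans (ler_normB _ _) _; rewrite [ltRHS]splitr ltrD.
Qed.

Lemma near_pinfty_inv {R : realType} (A : set R) : nbhs 0 A -> \forall t \near +oo, A t^-1.
Proof.
move=> /nbhs_ballP[r /= r0 rA].
have rV : 0 < r^-1 by rewrite invr_gt0.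
apply: filterS (nbhs_pinfty_gt (num_real r^-1)) => t rt; apply: rA.
have t0 := lt_trans rV rt.
by rewrite /ball /= sub0r normrN gtr0_norm ?invr_gt0// -[r]invrK ltf_pV2 ?posrE.
Qed.

Section Convergence.
Context {R : realType} {m : nat}.
Variable h : 'I_m -> R.
Hypothesis h_gt0 : forall k, 0 < h k.
Local Notation V := 'rV[R]_m.+1.
Implicit Types (e r u sg : R) (x y : V) (s : seq 'I_m.+1).

Lemma outer_glue (F : Z2fun h) y : cyl h y -> xn y != 0 ->
  outer F y = Num.sg (xn y) * inner F y.
Proof.
move=> cy y0; rewrite (Defs.glue F (xn_outer y0) (cyl_inner cy)) -/(xn y) mulrA -expr2.
by rewrite sqr_sg y0 mul1r.
Qed.

(** Near a disc point [branch] reads [inner] on the disc and [outer] off it. The factor between them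
    is a locally constant sign depending on x alone, hence common to the two sections being
    compared. *)
Lemma iter_partial_branch_cyl (F : Z2fun h) s x : smooth_on (cyl h) (inner F) -> cyl h x ->
  iter_partial s (branch F x) x =
  (if x \in disc h then 1 else Num.sg (xn x)) * iter_partial s (inner F) x.
Proof.
move=> sF cx; rewrite /branch; have [dx|/negP ndx] := boolP (x \in disc h).
  by rewrite mul1r.
have x0 : xn x != 0.
  by apply/eqP => x0; apply: ndx; apply/mem_set; split => //; exact: ltW.
pose W : set V := cyl h `&` half (xn x).
have oW : open W by apply: openI; [exact: open_cyl|exact: open_half].
have Wx : W x by split => //; rewrite /half /= -expr2 lt_neqAle sqr_ge0 eq_sym sqrf_eq0 x0.
rewrite (@iter_partial_eq _ _ W _ (fun y => Num.sg (xn x) * inner F y) s x oW _ Wx).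
  exact: iter_partialZ (open_cyl (h := h)) sF cx.
by move=> y [cy hy]; rewrite outer_glue ?(half_sg hy)//; exact: half_xn hy.
Qed.

Lemma Ck_Fout sg k : Ck [set e | good h e] (outer_chart h) k (fun e x => sg * Fout h e x).
Proof.
apply: CkM; first exact: Ck_c.
exact: (Ck_Phi h_gt0 (nbhs_good h_gt0) (open_outer_chart (h := h)) (fun e ge => ge)
  (chart_outer h_gt0)).
Qed.

Lemma Ck_Fcyl sg k : Ck [set e | good h e] (cyl h) k (fun e x => sg * Fcyl h e x).
Proof.
apply: CkM; first exact: Ck_c.
exact: (Ck_Phi h_gt0 (nbhs_good h_gt0) (open_cyl (h := h)) (fun e ge => ge)
  (chart_cylinder h_gt0)).
Qed.

(** Multiplication by t cancels the factor e = 1 / t of [LZ2], so that t F_t is the potential Phi_e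
    and the claim is its continuity, with all partial derivatives, at e = 0. *)
Lemma cvg_LZ2 (f : Z2fun h) sg : sg = 1 \/ sg = -1 ->
  (forall x, outer_chart h x -> outer f x = sg * Fout h 0 x) ->
  (forall x, cyl h x -> inner f x = sg * Fcyl h 0 x) ->
  cvg_Cinf_loc (fun t => Z2scale t (LZ2 h t^-1 t^-1)) f.
Proof.
move=> sg1 fo fi; exists (fun=> sg) => // K cK KE s d d0.
have ng := nbhs_good h_gt0.
pose L t := Z2scale sg (Z2scale t (LZ2 h t^-1 t^-1)).
have Lo t y : t != 0 -> outer (L t) y = sg * Fout h t^-1 y.
  by move=> t0; rewrite /= [t * _]mulrA divff// mul1r.
have Li t y : t != 0 -> good h t^-1 -> cyl h y -> inner (L t) y = sg * Fcyl h t^-1 y.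
  by move=> t0 gt cy; rewrite [LHS](congr1 (fun u => sg * (t * u)) (inner_LZ2 h_gt0 _ gt cy)) [t * _]mulrA divff// mul1r.
have tpos : \forall t \near +oo, (t : R) != 0.
  by apply: filterS (nbhs_pinfty_gt (num_real (0 : R))) => t t0; rewrite gt_eqF.
have oO := open_outer_chart (h := h); have oC := open_cyl (h := h).
(* Compactness reduces uniformity on K to a neighbourhood of each of its points, which can be taken
   inside one chart. *)
move/compact_near_coveringP : cK => cK.
apply: (cK _ _ (fun t x => `|iter_partial s (branch (L t) x) x
  - iter_partial s (branch f x) x| < d)) => x Kx.
have [dx|ndx] := pselect (disc h x); last first.
  have [A [B [nA nB AB]]] := pcont_locally_uniform
    (Ck_iter_pcont ng oO (s := s) (Ck_Fout sg)) ndx d0.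
  exists (B `&` outer_chart h, [set t | A t^-1 /\ t != 0]).
    split; [apply: filterI => //; exact: (open_nbhs_nbhs (conj oO ndx))|].
    by apply: filterI tpos; exact: near_pinfty_inv.
  move=> [y t] /= [[By oy] [At t0]]; rewrite !branch_outer//.
  rewrite (iter_partial_eq s oO fo oy).
  have -> : iter_partial s (outer (L t)) y = iter_partial s (fun y => sg * Fout h t^-1 y) y.
    by apply: (iter_partial_eq s oO _ oy) => z _; exact: Lo.
  exact: AB.
have cx := disc_cyl dx (KE x Kx).
have [A [B [nA nB AB]]] := pcont_locally_uniform
  (Ck_iter_pcont ng oC (s := s) (Ck_Fcyl sg)) cx d0.
exists (B `&` cyl h, [set t | (A `&` [set e | good h e]) t^-1 /\ t != 0]).
  split; [apply: filterI => //; exact: (open_nbhs_nbhs (conj oC cx))|].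
  by apply: filterI tpos; apply: near_pinfty_inv; exact: filterI.
move=> [y t] /= [[By cy] [[At gt] t0]].
have EL z : cyl h z -> inner (L t) z = sg * Fcyl h t^-1 z by exact: Li.
have sm e (F : V -> R) : good h e -> (forall z, cyl h z -> F z = sg * Fcyl h e z) ->
    smooth_on (cyl h) F.
  move=> ge HF s' z cz; apply: near_eq_differentiable (smooth_Fcyl h_gt0 sg ge s' cz).
  by apply: (near_U oC cz) => w cw; rewrite (iter_partial_eq s' oC HF cw).
rewrite !iter_partial_branch_cyl//; last 2 first.
- exact: sm (good0 h) fi.
- exact: sm gt EL.
rewrite -mulrBr normrM (_ : `|if _ then _ else _| = 1).
  rewrite mul1r (iter_partial_eq s oC fi cy) (iter_partial_eq s oC EL cy).
  exact: AB.
have [_|/negP ndy] := boolP (y \in disc h); first by rewrite normr1.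
rewrite normr_sg; case: eqVneq => // y0; exfalso; apply: ndy; apply/mem_set.
by split => //; exact: ltW.
Qed.

End Convergence.

Theorem proposition1p4 (R : realType) (m : nat) (hn : (3 <= m.+1)%N)
    (h : 'I_m -> R) (h_gt0 : forall j, 0 < h j)
    (f : Z2fun h) (hf : is_f_h f) :
  exists (T : R) (F : R -> Z2fun h),
    [/\ 0 < T,
        forall t : R, T < t ->
          Z2smooth (F t) /\
          (exists2 c : 'I_m.+1 -> R, (forall k, 0 < c k) &
             defines_lawlor_neck (F t) c)
      & cvg_Cinf_loc (fun t : R => Z2scale t (F t)) f].
Proof.
have [e0 e00 He0] := good_small h_gt0.
have T0 : 0 < e0^-1 by rewrite invr_gt0.
exists e0^-1, (fun t => LZ2 h t^-1 t^-1); split => // [t Tt|].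
  have t0 : 0 < t^-1 by rewrite invr_gt0 (lt_trans T0).
  have gt : good h t^-1.
    by apply: He0; rewrite gtr0_norm// -[e0]invrK ltf_pV2 ?posrE// -invr_gt0.
  split; first exact: smooth_LZ2.
  by exists (cc h t^-1) => [k|]; [exact: cc_gt0|exact: closure_graph].
have [sg sg1 [fo fi]] := f_h_unique h_gt0 hn hf.
exact: cvg_LZ2 sg1 fo fi.
Qed.
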